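(* Let $\Omega\subset\mathbb{R}^n$ be a bounded domain and let $\mathcal{D}\subset\mathbb{R}^n$ be a directional cone. Let $f\in C(\overline{\Omega})$ and $g\in C(\mathcal{D})$ be nonnegative, and assume that $$g(p+q)\ge g(p)\quad\text{for each }p,q\in\mathcal{D},$$ and that there exist $\bar q\in\operatorname{int}\mathcal{D}$ and a modulus of continuity $\omega:(0,\infty)\to(0,\infty)$ (satisfying $\omega(0^+)=0$) such that $$g(p+\eta\bar q)\ge g(p)+\omega(\eta)\quad\text{for each }p\in\mathcal{D}\text{ and each }\eta>0.$$ Then the comparison principle holds for $\mathcal{M}(\mathcal{D},\mathcal{P})$-admissible viscosity sub/supersolutions of the equation $g(Du)\det(D^2u)=f(x)$ on $\Omega$: if $u\in\mathrm{USC}(\overline{\Omega})$ is an $\mathcal{M}(\mathcal{D},\mathcal{P})$-admissible subsolution in $\Omega$ and $v\in\mathrm{LSC}(\overline{\Omega})$ is an $\mathcal{M}(\mathcal{D},\mathcal{P})$-admissible supersolution in $\Omega$, then $$u\le v\ \text{on }\partial\Omega\quad\Longrightarrow\quad u\le v\ \text{in }\Omega.$$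
   Context: A directional cone is a closed convex cone in $\mathbb{R}^n$ with vertex at the origin and nonempty interior. $\mathcal{S}(n)$ is the space of real symmetric $n\times n$ matrices, $\mathcal{P}=\{A\in\mathcal{S}(n):A\ge0\}$ and $\mathcal{M}(\mathcal{D},\mathcal{P})=\mathbb{R}\times\mathcal{D}\times\mathcal{P}\subset\mathbb{R}\times\mathbb{R}^n\times\mathcal{S}(n)$. $\mathrm{USC}$ (resp. $\mathrm{LSC}$) denotes upper (lower) semicontinuous functions with values in $[-\infty,+\infty)$ (resp. $(-\infty,+\infty]$). $J^{2,+}_xu$ (resp. $J^{2,-}_xu$) is the set of $(\varphi(x),D\varphi(x),D^2\varphi(x))$ with $\varphi$ of class $C^2$ near $x$ and $u\le\varphi$ (resp. $u\ge\varphi$) near $x$ with equality at $x$. Put $F(x,r,p,A)=g(p)\det(A)-f(x)$ for $x\in\overline\Omega$, $(r,p,A)\in\mathcal{M}(\mathcal{D},\mathcal{P})$. $u$ is an $\mathcal{M}(\mathcal{D},\mathcal{P})$-admissible (viscosity) subsolution in $\Omega$ if for every $x\in\Omega$ and $J\in J^{2,+}_xu$ one has $J\in\mathcal{M}(\mathcal{D},\mathcal{P})$ and $F(x,J)\ge0$. $v$ is an $\mathcal{M}(\mathcal{D},\mathcal{P})$-admissible (viscosity) supersolution in $\Omega$ if for every $x\in\Omega$ and $J\in J^{2,-}_xv$, either $J\in\mathcal{M}(\mathcal{D},\mathcal{P})$ and $F(x,J)\le0$, or $J\notin\mathcal{M}(\mathcal{D},\mathcal{P})$. *)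

(* Defs.v *)
From HB Require Import structures.
From mathcomp Require Import all_boot all_order all_algebra.
From mathcomp Require Import all_classical all_reals all_analysis.

Set Implicit Arguments.
Unset Strict Implicit.
Unset Printing Implicit Defensive.

Import Order.TTheory GRing.Theory Num.Theory.
Import numFieldNormedType.Exports.

Local Open Scope classical_set_scope.
Local Open Scope ring_scope.

(* R^n is 'rV[R]_n.  Its library norm is the sup norm, but only the topology
   and the bounded sets of R^n are used below, and these do not depend on the
   choice of a norm. *)

Section Geometry.
Context {R : realType} {n : nat}.

Definition bounded_domain (Omega : set 'rV[R]_n) : Prop :=
  [/\ open Omega, connected Omega, Omega !=set0 & bounded_set Omega].

Definition boundary (A : set 'rV[R]_n) : set 'rV[R]_n := closure A `\` A°.

Definition directional_cone (D : set 'rV[R]_n) : Prop :=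
  [/\ closed D,
      convex_set D,
      forall (t : R) (p : 'rV[R]_n), 0 <= t -> D p -> D (t *: p)
    & D° !=set0].

Definition psd : set 'M[R]_n :=
  [set A | A^T = A /\ forall z : 'rV[R]_n, 0 <= (z *m A *m z^T) 0 0].

End Geometry.

Section Semicontinuity.
Local Open Scope ereal_scope.

(* Companion of the library's [lower_semicontinuous]. *)
Definition upper_semicontinuous {X : topologicalType} {R : numFieldType}
    (f : X -> \bar R) : Prop :=
  forall x a, f x < a%:E -> exists2 V, nbhs x V & forall y, V y -> f y < a%:E.

Context {R : realType} {n : nat}.
Implicit Types (K : set 'rV[R]_n) (u v : 'rV[R]_n -> \bar R).

(* Functions on K are total functions whose values off K are irrelevant: in the
   topology of [subspace K], the points off K are isolated. *)
Definition USC K u : Prop :=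
  (forall x, K x -> u x != +oo) /\ upper_semicontinuous (u : subspace K -> _).

Definition LSC K v : Prop :=
  (forall x, K x -> v x != -oo) /\ lower_semicontinuous (v : subspace K -> _).

End Semicontinuity.

Section Jets.
Context {R : realType} {n : nat}.
Implicit Types (phi : 'rV[R]_n -> R) (x : 'rV[R]_n).

Definition partial (i : 'I_n) phi : 'rV[R]_n -> R := 'D_(delta_mx 0 i) phi.

Definition grad phi x : 'rV[R]_n := \row_i partial i phi x.

Definition hess phi x : 'M[R]_n := \matrix_(i, j) partial i (partial j phi) x.

Definition C2_near phi x : Prop :=
  \forall y \near x,
    [/\ {for y, continuous phi},
        forall i, derivable phi y (delta_mx 0 i) /\
          {for y, continuous (partial i phi)}
      & forall i j, derivable (partial j phi) y (delta_mx 0 i) /\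
          {for y, continuous (partial i (partial j phi))}].

Definition jet : Type := (R * 'rV[R]_n * 'M[R]_n)%type.

Definition J2plus (u : 'rV[R]_n -> \bar R) x : set jet :=
  [set J | exists phi, [/\ C2_near phi x,
     \forall y \near x, (u y <= (phi y)%:E)%E,
     u x = (phi x)%:E
   & J = (phi x, grad phi x, hess phi x)]].

Definition J2minus (v : 'rV[R]_n -> \bar R) x : set jet :=
  [set J | exists phi, [/\ C2_near phi x,
     \forall y \near x, ((phi y)%:E <= v y)%E,
     v x = (phi x)%:E
   & J = (phi x, grad phi x, hess phi x)]].

(* Only the symmetric third components matter: jets of C^2 functions have a
   symmetric third component, and [monotonicity_cone D P] with P included in
   the symmetric matrices contains no others. *)
Definition monotonicity_cone (D : set 'rV[R]_n) (P : set 'M[R]_n) : set jet :=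
  [set J | D J.1.2 /\ P J.2].

Definition admissible_subsolution (M : set jet) (F : 'rV[R]_n -> jet -> R)
    (Omega : set 'rV[R]_n) (u : 'rV[R]_n -> \bar R) : Prop :=
  forall x, Omega x -> forall J, J2plus u x J -> M J /\ 0 <= F x J.

Definition admissible_supersolution (M : set jet) (F : 'rV[R]_n -> jet -> R)
    (Omega : set 'rV[R]_n) (v : 'rV[R]_n -> \bar R) : Prop :=
  forall x, Omega x -> forall J, J2minus v x J ->
    (M J /\ F x J <= 0) \/ ~ M J.

Definition gdet_operator (f g : 'rV[R]_n -> R) (x : 'rV[R]_n) (J : jet) : R :=
  g J.1.2 * \det J.2 - f x.

End Jets.

(* Main.v *)
Require Import Defs.
From mathcomp Require Import all_boot all_order all_algebra.
From mathcomp Require Import all_classical all_reals all_analysis.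
From mathcomp Require Import ring lra.

Set Implicit Arguments.
Unset Strict Implicit.
Unset Printing Implicit Defensive.

Import Order.TTheory GRing.Theory Num.Theory.
Import numFieldNormedType.Exports.

Local Open Scope classical_set_scope.
Local Open Scope ring_scope.

(** Suppose that the conclusion fails and truncate [u] from below and [v] from
    above by large constants, so that both become real valued, without effect at
    the points that matter. Call the truncations [U] and [V].

    A function touching a subsolution from above has a nonnegative Hessian at the
    contact point, hence a subsolution is locally convex ([convex_of_touching]) and continuous.

    Doubling the variables ([doubling]) in [U + theta - V], where [theta] is a small
    quadratic polynomial with positive curvature and gradient in the interior of
    [D], yields interior points [xh] and [yh] at which [f] nearly agrees, such that
    [V (yh + z) - V yh] lies above [U (xh + z) - U xh] plus the increment of [theta]
    at [xh]. If [theta] were added to a smooth [U], its gradient would raise [g] by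
    some [om > 0] and its Hessian would raise the determinant by some
    [kap ^+ n > 0], so that [f yh >= f xh + om * kap ^+ n], a contradiction.

    In place of the second-order theory of semiconvex functions (the theorem on
    sums), [U] is approximated near [xh] by smooth functions for which this argument
    is legitimate ([smooth_subsolution]). The penalization touches [U] from above at
    [xh] by a paraboloid. Being convex, [U] is then differentiable at [xh], with a
    gradient [P] that belongs to [D], and every function touching [U] from above
    near [xh] has a gradient close to [P] ([touching_subgradient], [slope_close]).
    So [g] can be frozen at [g P], and [U] satisfies [det (D^2 U) >= c ^+ n] with a
    constant [c] near [xh].

    This inequality survives mollification. By the inequality between the
    arithmetic and the geometric mean it is equivalent to a family of linear
    inequalities [tr (X * D^2 U * X^T) >= const] ([det_le_mxtrace_conj],
    [det_ge_of_mxtrace_conj]). Each has constant coefficients, so it should hold for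
    averages of translates of [U]; that it does, although it is only known for
    functions touching [U], is [mollify_trace_ge]. To prove this, the random walk
    with steps along the rows of [X] is compared with [U]: by a maximum principle
    the walk started from [U] grows at least at the rate given by the constant
    ([le_iter_stepavg]), while its growth started from a mollification is governed
    by the Hessian of the latter.

    The mollifications of [U] plus [theta] are finally used as test functions for
    the supersolution ([local_comparison]). *)

(** * Quadratic forms and determinants *)

Definition qf {R : realType} {n : nat} (A : 'M[R]_n) (z : 'rV[R]_n) : R :=
  (z *m A *m z^T) 0 0.

Definition dotp {R : realType} {n : nat} (x y : 'rV[R]_n) : R :=
  (x *m y^T) 0 0.

Section Dot.
Context {R : realType} {n : nat}.
Implicit Types (x y z : 'rV[R]_n) (A B : 'M[R]_n).

Lemma dotpE x y : dotp x y = \sum_i x 0 i * y 0 i.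
Proof. by rewrite /dotp mxE; apply: eq_bigr => i _; rewrite mxE. Qed.

Lemma dotpC x y : dotp x y = dotp y x.
Proof. by rewrite !dotpE; apply: eq_bigr => i _; rewrite mulrC. Qed.

Lemma dotpDl x y z : dotp (x + y) z = dotp x z + dotp y z.
Proof. by rewrite /dotp mulmxDl mxE. Qed.

Lemma dotpDr x y z : dotp x (y + z) = dotp x y + dotp x z.
Proof. by rewrite dotpC dotpDl !(dotpC x). Qed.

Lemma dotpZl (t : R) x y : dotp (t *: x) y = t * dotp x y.
Proof. by rewrite /dotp -scalemxAl mxE. Qed.

Lemma dotpZr (t : R) x y : dotp x (t *: y) = t * dotp x y.
Proof. by rewrite dotpC dotpZl dotpC. Qed.

Lemma dotpNl x y : dotp (- x) y = - dotp x y.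
Proof. by rewrite -scaleN1r dotpZl mulN1r. Qed.

Lemma dotpNr x y : dotp x (- y) = - dotp x y.
Proof. by rewrite dotpC dotpNl dotpC. Qed.

Lemma dotpBl x y z : dotp (x - y) z = dotp x z - dotp y z.
Proof. by rewrite dotpDl dotpNl. Qed.

Lemma dotpBr x y z : dotp x (y - z) = dotp x y - dotp x z.
Proof. by rewrite dotpDr dotpNr. Qed.

Lemma dotp0l x : dotp 0 x = 0.
Proof. by rewrite -(scale0r 0) dotpZl mul0r. Qed.

Lemma dotp0r x : dotp x 0 = 0.
Proof. by rewrite dotpC dotp0l. Qed.

Lemma dotp_delta x i : dotp x (delta_mx 0 i) = x 0 i.
Proof.
rewrite dotpE (bigD1 i) //= !mxE !eqxx mulr1 big1 ?addr0// => j ji.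
by rewrite mxE eqxx (negbTE ji) mulr0.
Qed.

Lemma dotp_ge0 x : 0 <= dotp x x.
Proof. by rewrite dotpE; apply: sumr_ge0 => i _; rewrite -expr2 sqr_ge0. Qed.

Lemma dotp_eq0 x : dotp x x = 0 -> x = 0.
Proof.
rewrite dotpE => /eqP; rewrite psumr_eq0; last first.
  by move=> i _; rewrite -expr2 sqr_ge0.
move=> /allP h; apply/rowP => i; rewrite mxE; apply/eqP.
by have := h i (mem_index_enum i); rewrite -expr2 sqrf_eq0.
Qed.

Lemma qfE A z : qf A z = dotp (z *m A) z. Proof. by []. Qed.

Lemma qfDl A B z : qf (A + B) z = qf A z + qf B z.
Proof. by rewrite /qf mulmxDr mulmxDl mxE. Qed.

Lemma qfZl (t : R) A z : qf (t *: A) z = t * qf A z.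
Proof. by rewrite /qf -scalemxAr -scalemxAl mxE. Qed.

Lemma qfNl A z : qf (- A) z = - qf A z.
Proof. by rewrite -scaleN1r qfZl mulN1r. Qed.

Lemma qfBl A B z : qf (A - B) z = qf A z - qf B z.
Proof. by rewrite qfDl qfNl. Qed.

Lemma qfZr (t : R) A z : qf A (t *: z) = t ^+ 2 * qf A z.
Proof. by rewrite /qf linearZ/= -!scalemxAl -scalemxAr !mxE mulrA -expr2. Qed.

Lemma qf1 z : qf 1%:M z = dotp z z.
Proof. by rewrite /qf mulmx1. Qed.

Lemma qf_scalar (t : R) z : qf t%:M z = t * dotp z z.
Proof. by rewrite -scalemx1 qfZl qf1. Qed.

Lemma qf_rank1 x z : qf (x^T *m x) z = dotp x z ^+ 2.
Proof.
by rewrite qfE mulmxA /dotp -mulmxA mxE big_ord1 -!/(dotp _ _) (dotpC z) expr2.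
Qed.

Lemma dotp_mulmxC x y A : A^T = A -> dotp (x *m A) y = dotp x (y *m A).
Proof. by move=> sA; rewrite /dotp trmx_mul sA mulmxA. Qed.

Lemma qfDr A x y : A^T = A ->
  qf A (x + y) = qf A x + qf A y + 2 * dotp (x *m A) y.
Proof.
move=> sA; rewrite !qfE mulmxDl dotpDl !dotpDr (dotp_mulmxC y) // (dotpC y).
ring.
Qed.

End Dot.

Section Psd.
Context {R : realType}.

Lemma psd_qf n (A : 'M[R]_n) z : psd A -> 0 <= qf A z.
Proof. by move=> [_ h]; exact: h. Qed.

Lemma psdD n (A B : 'M[R]_n) : psd A -> psd B -> psd (A + B).
Proof.
move=> [sA pA] [sB pB]; split; first by rewrite linearD/= sA sB.
by move=> z; rewrite -/(qf _ _) qfDl addr_ge0 ?pA ?pB.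
Qed.

Lemma psd_scalar n (t : R) : 0 <= t -> psd (t%:M : 'M[R]_n).
Proof.
move=> t0; split; first by rewrite tr_scalar_mx.
by move=> z; rewrite -/(qf _ _) qf_scalar mulr_ge0 // dotp_ge0.
Qed.

Lemma psd_conj n (A X : 'M[R]_n) : psd A -> psd (X *m A *m X^T).
Proof.
move=> [sA pA]; split; first by rewrite !trmx_mul trmxK sA mulmxA.
move=> z; have := pA (z *m X); congr (_ <= _).
by rewrite trmx_mul !mulmxA.
Qed.

Lemma linear_ge0_eq0 (a c : R) : (forall t, 0 <= t * a + c) -> a = 0.
Proof.
move=> h; apply/eqP/negPn/negP => a0.
by have := h (- (c + 1) / a); rewrite divfK //; lra.
Qed.

(** Completing the square in the first variable reduces the size by one.  When
    the pivot vanishes so does its row, and the convention 0^-1 = 0 lets the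
    same formula cover both cases. *)
Lemma psd_cholesky n (S : 'M[R]_n) : psd S ->
  exists2 T : 'M[R]_n, S = T^T *m T & forall i j : 'I_n, (j < i)%N -> T i j = 0.
Proof.
elim: n S => [|n IH] S.
  by move=> _; exists 0 => [|[]//]; rewrite [LHS]flatmx0 [RHS]flatmx0.
suff main (S1 : 'M[R]_(1 + n)) : psd S1 -> exists2 T : 'M[R]_(1 + n),
    S1 = T^T *m T & forall i j : 'I_(1 + n), (j < i)%N -> T i j = 0.
  by move=> pS; exact: main.
rewrite -(submxK S1).
move: (ulsubmx S1) (ursubmx S1) (dlsubmx S1) (drsubmx S1) => a b b' C.
move=> [sS pS]; move: sS; rewrite tr_block_mx => /eq_block_mx[_ eb _ sC].
have qS t w : 0 <= t ^+ 2 * a 0 0 + t * (2 * dotp b w) + qf C w.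
  have := pS (row_mx t%:M w); rewrite -eb mul_row_block tr_row_mx mul_row_col.
  rewrite !mulmxDl tr_scalar_mx !mul_scalar_mx !mul_mx_scalar mxE mxE !mxE.
  have -> : \sum_j w 0 j * b' j 0 = dotp b'^T w.
    by rewrite dotpE; apply: eq_bigr => j _; rewrite mxE mulrC.
  have -> : \sum_j (t *: b'^T) 0 j * w^T j 0 = t * dotp b'^T w.
    by rewrite dotpE mulr_sumr; apply: eq_bigr => j _; rewrite !mxE mulrA.
  have -> : \sum_j (w *m C) 0 j * w^T j 0 = qf C w by rewrite /qf mxE.
  by congr (_ <= _); ring.
(* the pivot is nonnegative, and its row vanishes with it *)
have a0 : 0 <= a 0 0.
  by have := qS 1 0; rewrite dotp0r /qf mul0mx mul0mx mxE; lra.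
have b0 : a 0 0 = 0 -> b = 0.
  move=> az; apply: dotp_eq0.
  suff : 2 * dotp b b = 0 by lra.
  by apply: (@linear_ge0_eq0 _ (qf C b)) => t; have := qS t b; rewrite az; lra.
(* the Schur complement of the pivot *)
pose D : 'M[R]_n := C - (a 0 0)^-1 *: (b^T *m b).
have pD : psd D.
  split; first by rewrite /D linearB linearZ/= trmx_mul trmxK sC.
  move=> w; rewrite -/(qf _ _) qfBl qfZl qf_rank1.
  have [az|anz] := eqVneq (a 0 0) 0.
    by have := qS 0 w; rewrite az invr0; lra.
  have := qS (- dotp b w / a 0 0) w; congr (_ <= _); field.
  by [].
have [T eT tT] := IH D pD.
pose s := Num.sqrt (a 0 0).
have ss : s * s = a 0 0 by rewrite -expr2 sqr_sqrtr.
exists (block_mx s%:M (s^-1 *: b) 0 T : 'M[R]_(1 + n)).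
  rewrite tr_block_mx mulmx_block tr_scalar_mx trmx0 !mul0mx !addr0 mulmx0 addr0.
  have e1 : s%:M *m (s^-1 *: b) = b.
    rewrite mul_scalar_mx scalerA; have [sz|snz] := eqVneq s 0.
      by rewrite b0 ?scaler0// -ss sz mul0r.
    by rewrite divff // scale1r.
  have e2 : (s^-1 *: b)^T *m s%:M = b'.
    by apply: trmx_inj; rewrite trmx_mul trmxK tr_scalar_mx e1 eb.
  have e3 : (s^-1 *: b)^T *m (s^-1 *: b) = (a 0 0)^-1 *: (b^T *m b).
    by rewrite [X in X *m _]linearZ/= -scalemxAl -scalemxAr scalerA -invfM ss.
  rewrite e1 e2 e3 -scalar_mxM ss -mx11_scalar -eT /D.
  by rewrite addrCA subrr addr0.
move=> i j; rewrite !mxE; case: splitP => i' -> /=; first by case: i' => -[].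
rewrite mxE; case: splitP => j' -> /=; rewrite ?mxE//.
by rewrite !add1n ltnS => ij; apply: tT.
Qed.

(** Hadamard's inequality followed by the inequality between the arithmetic and
    the geometric mean. *)
Lemma psd_det_le_trace n (S : 'M[R]_n) : psd S ->
  \det S * n%:R ^+ n <= (\tr S) ^+ n.
Proof.
move=> /psd_cholesky[T -> tT].
have dT : \det T = \prod_i T i i.
  by rewrite -det_tr det_trig ?mxE; [apply: eq_bigr => i _; rewrite mxE|
    apply/is_trig_mxP => i j ij; rewrite mxE tT].
pose E (i : 'I_n) := (T^T *m T) i i.
have hE i : T i i ^+ 2 <= E i.
  rewrite /E mxE (bigD1 i) //= mxE -expr2 lerDl.
  by apply: sumr_ge0 => j _; rewrite mxE -expr2 sqr_ge0.
have E0 i : 0 <= E i by exact: le_trans (sqr_ge0 _) (hE i).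
rewrite det_mulmx det_tr dT -expr2 -prodrXl.
have [+ _] := @leif_AGM_scaled _ 'I_n {: 'I_n} E (fun i _ => mulrn_wge0 _ (E0 i)).
rewrite card_ord /mxtrace; under eq_bigr do rewrite -mulr_natr.
rewrite big_split/= prodr_const card_ord; apply: le_trans.
rewrite ler_wpM2r ?exprn_ge0//; apply: ler_prod => i _.
by rewrite sqr_ge0 hE.
Qed.

Lemma mxtrace_conj n (A X : 'M[R]_n) :
  \tr (X *m A *m X^T) = \sum_k qf A (row k X).
Proof.
apply: eq_bigr => k _; rewrite /qf -row_mul [LHS]mxE [RHS]mxE.
by apply: eq_bigr => j _; rewrite [X^T _ _]mxE [(row k X)^T _ _]mxE !mxE.
Qed.

Lemma nth_rootP n (x : R) : (0 < n)%N -> 0 <= x ->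
  exists2 r : R, 0 <= r & r ^+ n = x.
Proof.
move=> n0 x0; exists (x `^ n%:R^-1); first exact: powR_ge0.
by rewrite -powR_mulrn ?powR_ge0// -powRrM mulVf ?powRr1// pnatr_eq0 -lt0n.
Qed.

(** The concavity of A |-> (det A)^(1/n) in linear form: for a fixed X the
    trace of X A X^T is a linear lower bound of it. *)
Lemma det_le_mxtrace_conj n (A X : 'M[R]_n) (c mu : R) : (0 < n)%N ->
  psd A -> 0 <= c -> c ^+ n <= \det A -> 0 <= mu -> mu ^+ n = \det X ^+ 2 ->
  n%:R * (c * mu) <= \sum_k qf A (row k X).
Proof.
move=> n0 pA c0 cA mu0 muX; have pS := psd_conj X pA.
rewrite -mxtrace_conj -(@ler_pXn2r _ n) ?nnegrE ?mulr_ge0 ?ler0n//; last first.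
  by rewrite mxtrace_conj sumr_ge0// => k _; exact: psd_qf.
apply: le_trans (psd_det_le_trace pS).
rewrite !det_mulmx det_tr !exprMn muX mulrC ler_wpM2r ?exprn_ge0 ?ler0n//.
by rewrite [leRHS]mulrAC -expr2 mulrC ler_wpM2l ?sqr_ge0.
Qed.

(** Conversely these linear bounds recover the determinant: the optimal X
    conjugates A + s to the identity. *)
Lemma det_ge_of_mxtrace_conj n (A : 'M[R]_n) (c s : R) : (0 < n)%N ->
  psd A -> 0 <= c -> 0 < s ->
  (forall (X : 'M[R]_n) (mu : R), 0 <= mu -> mu ^+ n = \det X ^+ 2 ->
    n%:R * (c * mu) <= \sum_k qf A (row k X)) ->
  (c + s) ^+ n <= \det (A + s%:M).
Proof.
move=> n0 pA c0 s0 h.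
have pA1 : psd (A + s%:M) by apply: psdD => //; exact/psd_scalar/ltW.
have [T eT _] := psd_cholesky pA1.
have dT0 : \det T != 0.
  rewrite -det_tr; apply/negP => /det0P[z z0 zT].
  have : qf (A + s%:M) z = 0 by rewrite eT /qf mulmxA zT !mul0mx mxE.
  rewrite qfDl qf_scalar => e.
  have : 0 < s * dotp z z.
    rewrite mulr_gt0 // lt_neqAle dotp_ge0 andbT eq_sym.
    by apply: contra_neq z0; exact: dotp_eq0.
  by have := psd_qf z pA; lra.
have uT : T \in unitmx by rewrite unitmxE unitfE.
(* X (A + s) X^T = 1, the case of equality in the bound for A + s *)
pose X := (invmx T)^T.
have [mu mu0 emu] := nth_rootP n0 (sqr_ge0 (\det X)).
have dX : \det X ^+ 2 = (\det T ^+ 2)^-1 by rewrite det_tr det_inv exprVn.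
have e1 : \sum_k qf (A + s%:M) (row k X) = n%:R.
  rewrite -mxtrace_conj eT /X trmxK -!mulmxA mulmxV // mulmx1.
  by rewrite -trmx_mul mulmxV // trmx1 mxtrace1.
have h1 := h X mu mu0 emu.
have h2 : n%:R * (1 * mu) <= \sum_k qf (1%:M : 'M[R]_n) (row k X).
  by apply: det_le_mxtrace_conj => //; [exact: psd_scalar|rewrite det1 expr1n].
have le1 : (c + s) * mu <= 1.
  have : n%:R * ((c + s) * mu) <= n%:R * 1.
    rewrite mulr1 -[leRHS]e1; under eq_bigr do rewrite qfDl -scalemx1 qfZl.
    rewrite big_split/= -mulr_sumr mulrDl mulrDr lerD//.
    by rewrite mulrCA ler_wpM2l ?(ltW s0)// -[mu]mul1r.
  by rewrite ler_pM2l // ltr0n.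
have : ((c + s) * mu) ^+ n <= 1 by rewrite exprn_ile1// mulr_ge0// addr_ge0// ltW.
rewrite exprMn emu dX ler_pdivrMr ?mul1r; last first.
  by rewrite lt_neqAle sqr_ge0 andbT eq_sym expf_neq0.
by rewrite eT det_mulmx det_tr expr2.
Qed.

End Psd.

(** * Differentiation *)

Section OneVariable.
Context {R : realType}.

Lemma is_derive_remainderP (V : normedModType R) (f : V -> R) (x v : V) (d : R) :
  is_derive x v f d <->
  forall e : R, 0 < e -> \forall h \near (0 : R), `|f (x + h *: v) - f x - h * d| <= e * `|h|.
Proof.
split=> [[dfx <-] e e0|H].
  have /cvgrPdist_le/(_ e e0) := dfx.
  rewrite near_withinE; apply: filterS => h; have [->|h0] := eqVneq h 0.
    by rewrite scale0r addr0 subrr mul0r subr0 normr0 mulr0.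
  move=> /(_ isT); rewrite -['D_v f x]/(lim _) /= => le.
  rewrite -ler_pdivrMr ?normr_gt0// -normfV -normrM.
  congr (_ <= _) : le; rewrite distrC; congr `|_|.
  by rewrite /= (addrC x); move: (lim _) => L; rewrite /GRing.scale /=; field.
have cv : h^-1 *: ((f \o shift x) (h *: v) - f x) @[h --> 0^'] --> d.
  apply/cvgrPdist_le => e e0; rewrite near_withinE.
  apply: filterS (H e e0) => h le h0.
  rewrite -ler_pdivrMr ?normr_gt0// -normfV -normrM in le.
  congr (_ <= _) : le; rewrite distrC; congr `|_|.
  by rewrite /= (addrC x) /GRing.scale /=; field.
split; first by apply: cvgP; exact: cv.
exact/cvg_lim.
Qed.

Lemma is_deriveP (V : normedModType R) (f : V -> R) (x v : V) (d : R) :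
  is_derive x v f d <->
  forall e : R, 0 < e -> exists2 r : R, 0 < r &
    forall h : R, `|h| < r -> `|f (x + h *: v) - f x - h * d| <= e * `|h|.
Proof.
rewrite is_derive_remainderP; split=> H e e0.
  have /nbhs_ballP[r r0 hr] := H e e0; exists r => // h hh; apply: hr.
  by rewrite /ball /= sub0r normrN.
have [r r0 hr] := H e e0; apply/nbhs_ballP; exists r => // h.
by rewrite /ball /= sub0r normrN => /hr.
Qed.

Lemma is_derive_line (V : normedModType R) (f : V -> R) (x v : V) (t d : R) :
  is_derive (x + t *: v) v f d -> is_derive t 1 (fun s : R => f (x + s *: v)) d.
Proof.
move=> /is_deriveP H; apply/is_deriveP => e e0.
have [r r0 hr] := H e e0; exists r => // h /hr; congr (_ <= _); congr (`| f _ - _ - _ |).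
by rewrite [h%:A]mulr1 scalerDl addrA.
Qed.

Lemma is_derive_dirZ (V : normedModType R) (f : V -> R) (x v : V) (t d : R) :
  is_derive x v f d -> is_derive x (t *: v) f (t * d).
Proof.
move=> /is_deriveP H; apply/is_deriveP => e e0.
have t1 : 0 < `|t| + 1 by rewrite ltr_wpDl.
have [r r0 hr] := H (e / (`|t| + 1)) (divr_gt0 e0 t1).
exists (r / (`|t| + 1)); first exact: divr_gt0.
move=> h; rewrite ltr_pdivlMr// => hh; rewrite scalerA mulrA.
apply: le_trans (hr _ _) _.
  by rewrite normrM (le_lt_trans _ hh)// ler_wpM2l// lerDl.
rewrite normrM (_ : _ * _ = (`|t| / (`|t| + 1)) * (e * `|h|)); last by ring.
by rewrite ler_piMl ?(mulr_ge0, ltW e0)// ler_pdivrMr// mul1r lerDl.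
Qed.

Lemma is_derive_translate (V : normedModType R) (f : V -> R) (x a v : V) (d : R) :
  is_derive (x + a) v f d -> is_derive x v (fun y => f (y + a)) d.
Proof.
move=> /is_deriveP D; apply/is_deriveP => e e0.
by have [r r0 hr] := D e e0; exists r => // t tr; rewrite (addrAC x); exact: hr.
Qed.

Lemma is_derive1_continuous (f : R -> R) (x d : R) :
  is_derive x 1 f d -> {for x, continuous f}.
Proof. by move=> H; apply/differentiable_continuous/derivable1_diffP. Qed.

Lemma mean_value (f df : R -> R) (a b : R) : a < b ->
  (forall x, a <= x <= b -> is_derive x 1 f (df x)) ->
  exists2 c : R, a < c < b & f b - f a = df c * (b - a).
Proof.
move=> ab H; have [||c + ->] := @MVT R f df a b ab.
- by move=> x; rewrite in_itv /= => /andP[? ?]; apply: H; rewrite !ltW.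
- apply: continuous_in_subspaceT => x; rewrite inE /= in_itv /= => xab.
  exact/is_derive1_continuous/H.
by rewrite in_itv /= => cab; exists c.
Qed.

(** With no error term, bounds on [f2] are bounds on second differences. *)
Lemma mean_value2 (f f1 f2 : R -> R) (t : R) : 0 < t ->
  (forall x : R, is_derive x 1 f (f1 x)) ->
  (forall x : R, is_derive x 1 f1 (f2 x)) ->
  exists2 s : R, `|s| <= t & f t + f (- t) - 2 * f 0 = t ^+ 2 * f2 s.
Proof.
move=> t0 d1 d2.
pose F s := f s + f (- s) - 2 * f 0.
pose K s := F s * t ^+ 2 - s ^+ 2 * F t.
have dopp (g : R -> R) (dg s : R) : is_derive (- s) 1 g dg -> is_derive s 1 (fun x : R => g (- x)) (- dg).
  move=> /is_deriveP H; apply/is_deriveP => e e0.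
  have [r r0 hr] := H e e0; exists r => // h; rewrite -normrN => /hr.
  by congr (`| g _ - _ - _ | <= _); rewrite /GRing.scale /=; ring.
have dK (s : R) : is_derive s 1 K ((f1 s - f1 (- s)) * t ^+ 2 - 2 * s * F t).
  have D1 := d1 s; have D2 := dopp f (f1 (- s)) s (d1 (- s)).
  have -> : K = (f + (fun x => f (- x)) - cst (2 * f 0)) * cst (t ^+ 2) -
                (id ^+ 2) * cst (F t) by apply/funext => x; rewrite /K /F !fctE.
  by apply: is_derive_eq; rewrite /GRing.scale /=; ring.
have K0 : K 0 = K t by rewrite /K /F !oppr0; ring.
have [s s0t] := mean_value t0 (fun s _ => dK s).
rewrite K0 subrr => /esym/eqP; rewrite mulf_eq0 subr0 (gt_eqF t0) orbF => /eqP e.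
have ss : - s < s by lra.
have [r rs er] := mean_value ss (fun x _ => d2 x).
exists r; first by rewrite ler_norml; lra.
rewrite -/(F t); have s0 : s != 0 by lra.
rewrite er in e; apply: (mulfI s0); lra.
Qed.

End OneVariable.

Section SupNorm.
Context {R : realType} {n : nat}.
Implicit Types (x y z w : 'rV[R]_n).

Lemma rV_norm_le x (e : R) : 0 <= e -> (`|x| <= e) = [forall i, `|x 0 i| <= e].
Proof.
move=> e0; rewrite /Num.norm /= mx_normrE; apply/idP/forallP => [le i|h].
  by apply: le_trans le; apply: (le_bigmax _ (fun i => `|x i.1 i.2|) (0, i)).
by apply: bigmax_le => // -[i j] _; rewrite (ord1 i); exact: h.
Qed.

Lemma rV_coord_le x i : `|x 0 i| <= `|x|.
Proof. by have := lexx `|x|; rewrite rV_norm_le// => /forallP. Qed.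

Lemma dotp_le_norm x y : `|dotp x y| <= n%:R * (`|x| * `|y|).
Proof.
rewrite dotpE; apply: le_trans (ler_norm_sum _ _ _) _.
rewrite -[n in n%:R]card_ord -sumr_const mulr_suml ler_sum// => i _.
by rewrite mul1r normrM ler_pM// rV_coord_le.
Qed.

Lemma norm_sqr_le_dotp x : `|x| ^+ 2 <= dotp x x.
Proof.
rewrite -[leRHS]sqr_sqrtr ?dotp_ge0// ler_pXn2r ?nnegrE ?sqrtr_ge0//.
rewrite rV_norm_le ?sqrtr_ge0//; apply/forallP => i.
rewrite -sqrtr_sqr ler_wsqrtr// dotpE (bigD1 i) //= -expr2 lerDl.
by apply: sumr_ge0 => j _; rewrite -expr2 sqr_ge0.
Qed.

Lemma continuous_coord i : continuous (fun x => x 0 i).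
Proof. exact: coord_continuous. Qed.

Lemma continuous_sumr (T : topologicalType) (I : Type) (r : seq I)
    (F : I -> T -> R) :
  (forall i, continuous (F i)) -> continuous (fun z : T => \sum_(i <- r) F i z).
Proof. by move=> cF; apply: continuous_big => //; exact: add_continuous. Qed.

Lemma continuous_mull (T : topologicalType) (c : R) (f : T -> R) :
  continuous f -> continuous (fun p : T => c * f p).
Proof. by move=> cf p; apply: cvgMr; exact: cf. Qed.

Lemma continuous_mulr (T : topologicalType) (c : R) (f : T -> R) :
  continuous f -> continuous (fun p : T => f p * c).
Proof. by move=> cf p; apply: cvgMl; exact: cf. Qed.

Lemma continuous_addr (T : topologicalType) (f h : T -> R) :
  continuous f -> continuous h -> continuous (fun p : T => f p + h p).
Proof. by move=> cf ch p; apply: cvgD; [exact: cf|exact: ch]. Qed.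

Lemma continuous_mul (T : topologicalType) (f h : T -> R) :
  continuous f -> continuous h -> continuous (fun p : T => f p * h p).
Proof. by move=> cf ch p; apply: cvgM; [exact: cf|exact: ch]. Qed.

Lemma continuous_epsP (f : 'rV[R]_n -> R) x : {for x, continuous f} <->
  forall e : R, 0 < e -> exists2 r : R, 0 < r & forall y, `|y| < r -> `|f (x + y) - f x| <= e.
Proof.
split=> [/cvgrPdist_le H e e0|H].
  have /nbhs_normP[r r0 hr] := H e e0; exists r => // y yr; rewrite distrC.
  by apply: hr; rewrite /ball_ /= opprD addrA subrr sub0r normrN.
apply/(@cvgrPdist_le _ _ _ (nbhs x) (nbhs_filter x) f (f x)) => e e0; have [r r0 hr] := H e e0.
apply/(@nbhs_normP R 'rV[R]_n x); exists r => // y; rewrite /ball_ /= distrC => yr.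
by have := hr _ yr; rewrite addrCA subrr addr0 distrC.
Qed.

End SupNorm.

Section C2.
Context {R : realType} {n : nat}.
Implicit Types (f : 'rV[R]_n -> R) (G : 'rV[R]_n -> 'rV[R]_n)
  (H : 'rV[R]_n -> 'M[R]_n) (x y v w : 'rV[R]_n).

(** The vertices of the path from 0 to [w] that moves along one axis at a time. *)
Definition truncate k w : 'rV[R]_n := \row_i (if (i < k)%N then w 0 i else 0).

Lemma truncateS (k : 'I_n) w :
  truncate k.+1 w = truncate k w + w 0 k *: delta_mx 0 k.
Proof.
apply/rowP => i; rewrite !mxE ltnS eqxx /=; have [->|ik] := eqVneq i k.
  by rewrite leqnn ltnn mulr1 add0r.
by rewrite mulr0 addr0 leq_eqVlt (inj_eq val_inj) (negbTE ik).
Qed.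

(** Continuous partial derivatives give a full first-order expansion: move along
    one coordinate at a time. *)
Lemma C1_expansion f G y (e : R) :
  (forall i, continuous (fun y => G y 0 i)) ->
  (forall y i, is_derive y (delta_mx 0 i) f (G y 0 i)) -> 0 < e ->
  exists2 r : R, 0 < r &
    forall w, `|w| < r -> `|f (y + w) - f y - dotp (G y) w| <= e * `|w|.
Proof.
move=> cG dG e0; pose e' : R := e / n.+1%:R.
have e'0 : 0 < e' by rewrite divr_gt0.
have : \forall z \near y, forall i, `|G y 0 i - G z 0 i| <= e'.
  apply: (@filter_forall _ _ _ (nbhs y) (nbhs_filter y)) => i.
  by have /cvgrPdist_le/(_ _ e'0) := cG i y.
move=> /nbhs_normP[r r0 hr]; exists r => // w wr.
(* the k-th step moves along the k-th axis, where one partial derivative controls f *)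
have step (k : 'I_n) :
    `|f (y + truncate k.+1 w) - f (y + truncate k w) - G y 0 k * w 0 k| <= e' * `|w|.
  have dk (s : R) : is_derive s 1 (fun s => f (y + truncate k w + s *: (w 0 k *: delta_mx 0 k)))
      (w 0 k * G (y + truncate k w + s *: (w 0 k *: delta_mx 0 k)) 0 k).
    exact/is_derive_line/is_derive_dirZ.
  have [c c01] := mean_value (@ltr01 R) (fun s _ => dk s).
  rewrite scale1r scale0r addr0 subr0 mulr1 -addrA -truncateS => ->.
  rewrite mulrC -mulrBl normrM ler_pM ?rV_coord_le// distrC.
  apply: hr; rewrite /ball_ /= -addrA opprD addrA subrr sub0r normrN.
  apply: le_lt_trans wr; rewrite rV_norm_le ?normr_ge0//.
  apply/forallP => i; rewrite !mxE eqxx /=; case: eqVneq => [->|ik].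
    rewrite ltnn add0r mulr1 normrM ger0_norm; last by lra.
    by apply: le_trans (rV_coord_le w k); rewrite ler_piMl//; lra.
  rewrite mulr0n !mulr0 addr0.
  by case: ifP => _; rewrite ?normr0// rV_coord_le.
have -> : f (y + w) - f y - dotp (G y) w =
    \sum_(k < n) (f (y + truncate k.+1 w) - f (y + truncate k w) - G y 0 k * w 0 k).
  rewrite big_split/= sumrN dotpE; congr (_ - _).
  rewrite -(big_mkord xpredT (fun k => f (y + truncate k.+1 w) - f (y + truncate k w))).
  rewrite telescope_sumr//; congr (f _ - f _).
    by congr (_ + _); apply/rowP => i; rewrite mxE ltn_ord.
  by rewrite -[LHS]addr0; congr (_ + _); apply/rowP => i; rewrite !mxE.
apply: le_trans (ler_norm_sum _ _ _) _.
apply: le_trans (ler_sum _ (fun k _ => step k)) _.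
rewrite sumr_const card_ord -mulr_natl /e' mulrA ler_wpM2r//.
by rewrite mulrCA ler_piMr ?(ltW e0)// ler_pdivrMr// mul1r ler_nat.
Qed.

Lemma C1_line f G x v (t : R) :
  (forall i, continuous (fun y => G y 0 i)) ->
  (forall y i, is_derive y (delta_mx 0 i) f (G y 0 i)) ->
  is_derive t 1 (fun s : R => f (x + s *: v)) (dotp (G (x + t *: v)) v).
Proof.
move=> cG dG; apply: is_derive_line; apply/is_deriveP => e e0.
have v1 : 0 < `|v| + 1 by rewrite ltr_wpDl.
have [r r0 hr] := C1_expansion (x + t *: v) cG dG (divr_gt0 e0 v1).
exists (r / (`|v| + 1)); first exact: divr_gt0.
move=> h; rewrite ltr_pdivlMr// => hh; rewrite -dotpZr.
apply: le_trans (hr _ _) _.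
  by rewrite normrZ (le_lt_trans _ hh)// ler_wpM2l// lerDl.
rewrite normrZ mulrACA ler_piMr ?(mulr_ge0, ltW e0)//.
by rewrite mulrC ler_pdivrMr// mul1r lerDl.
Qed.

(** Everywhere twice continuously differentiable functions, with their gradient
    and Hessian as data so that sums and translates need no uniqueness of
    derivatives. *)
Definition C2_with f G H : Prop :=
  [/\ continuous f, forall i, continuous (fun y => G y 0 i),
      forall i j, continuous (fun y => H y i j),
      forall y i, is_derive y (delta_mx 0 i) f (G y 0 i)
    & forall y i j, is_derive y (delta_mx 0 i) (fun z => G z 0 j) (H y i j)].

Section Props.
Variables (f : 'rV[R]_n -> R) (G : 'rV[R]_n -> 'rV[R]_n) (H : 'rV[R]_n -> 'M[R]_n).
Hypothesis fGH : C2_with f G H.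

Lemma C2_with_partial i : partial i f = fun y => G y 0 i.
Proof. by case: fGH => _ _ _ d _; apply/funext => y; apply: derive_val. Qed.

Lemma C2_with_partial2 i j : partial i (partial j f) = fun y => H y i j.
Proof.
case: fGH => _ _ _ _ d; rewrite C2_with_partial.
by apply/funext => y; apply: derive_val.
Qed.

Lemma C2_with_grad x : grad f x = G x.
Proof. by apply/rowP => i; rewrite mxE C2_with_partial. Qed.

Lemma C2_with_hess x : hess f x = H x.
Proof. by apply/matrixP => i j; rewrite mxE C2_with_partial2. Qed.

Lemma C2_with_near x : C2_near f x.
Proof.
case: fGH => c0 c1 c2 d1 d2.
apply: (@filterE _ (nbhs x) (nbhs_filter x)) => y; split=> [|i|i j].
- exact: c0.
- by rewrite C2_with_partial; split; [apply: ex_derive|exact: c1].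
- rewrite C2_with_partial2 C2_with_partial.
  by split; [apply: ex_derive|exact: c2].
Qed.

Lemma C2_with_line x v (t : R) :
  is_derive t 1 (fun s : R => f (x + s *: v)) (dotp (G (x + t *: v)) v).
Proof. by case: fGH => _ c1 _ d1 _; exact: C1_line. Qed.

Lemma C2_with_line2 x v (t : R) :
  is_derive t 1 (fun s : R => dotp (G (x + s *: v)) v) (qf (H (x + t *: v)) v).
Proof.
case: fGH => _ _ c2 _ d2.
have -> : (fun s : R => dotp (G (x + s *: v)) v) =
    \sum_(j < n) (v 0 j *: (fun s : R => G (x + s *: v) 0 j)).
  apply/funext => s; rewrite fct_sumE dotpE.
  by apply: eq_bigr => j _; rewrite /GRing.scale /= mulrC.
have d j : is_derive t 1 (fun s : R => G (x + s *: v) 0 j)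
    (dotp (\row_i H (x + t *: v) i j) v).
  apply: (@C1_line (fun y => G y 0 j) (fun y => \row_i H y i j)) => [i|y i].
    by under eq_fun do rewrite mxE; exact: c2.
  by rewrite mxE; exact: d2.
apply: is_derive_eq; rewrite /qf mxE; apply: eq_bigr => j _.
rewrite mulrC !mxE; congr (_ * _); rewrite dotpE.
by apply: eq_bigr => i _; rewrite mxE mulrC.
Qed.

Lemma second_difference x v (t : R) : 0 < t -> exists2 s : R, `|s| <= t &
  f (x + t *: v) + f (x - t *: v) - 2 * f x = t ^+ 2 * qf (H (x + s *: v)) v.
Proof.
move=> t0.
have [s st] := mean_value2 t0 (C2_with_line x v) (C2_with_line2 x v).
by rewrite scale0r addr0 scaleNr => e; exists s.
Qed.

Lemma psd_tangent_le x v : (forall y, psd (H y)) ->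
  f x + dotp (G x) v <= f (x + v).
Proof.
move=> pH.
have [c c01] := mean_value (@ltr01 R) (fun s _ => C2_with_line x v s).
rewrite scale1r scale0r addr0 subr0 mulr1 => e.
have c0 : 0 < c by lra.
have [b bc] := mean_value c0 (fun s _ => C2_with_line2 x v s).
rewrite scale0r addr0 subr0 => e2.
have : 0 <= qf (H (x + b *: v)) v * c by rewrite mulr_ge0 ?psd_qf// ltW.
by lra.
Qed.

Lemma hess_global_min x : (forall y, f x <= f y) -> (H x)^T = H x -> psd (H x).
Proof.
case: fGH => _ _ c2 _ _ fx sH; split=> // v.
rewrite -/(qf _ _) leNgt; apply/negP => neg.
have cq : continuous (fun y => qf (H y) v).
  have -> : (fun y => qf (H y) v) = fun y => \sum_j (\sum_i v 0 i * H y i j) * v 0 j.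
    apply/funext => y; rewrite /qf mxE; apply: eq_bigr => j _.
    by rewrite !mxE.
  apply: continuous_sumr => j; apply: continuous_mulr.
  by apply: continuous_sumr => i; apply: continuous_mull; exact: c2.
have /continuous_epsP/(_ (- qf (H x) v / 2)) := cq x.
case=> [|r r0 hr]; first by lra.
have v1 : 0 < `|v| + 1 by rewrite ltr_wpDl.
pose t := r / 2 / (`|v| + 1).
have t0 : 0 < t by rewrite !divr_gt0.
have [s st] := second_difference x v t0.
have : `|qf (H (x + s *: v)) v - qf (H x) v| <= - qf (H x) v / 2.
  apply: hr; rewrite normrZ; apply: (@le_lt_trans _ _ (t * (`|v| + 1))).
    by rewrite ler_pM// lerDl.
  by rewrite divfK ?gt_eqF//; lra.
rewrite ler_norml => /andP[_ le]; have le2 : qf (H (x + s *: v)) v < 0 by lra.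
have := fx (x + t *: v); have := fx (x - t *: v).
have : t ^+ 2 * qf (H (x + s *: v)) v < 0 by rewrite pmulr_rlt0// exprn_gt0.
by lra.
Qed.

End Props.

Lemma C2_withD f1 G1 H1 f2 G2 H2 : C2_with f1 G1 H1 -> C2_with f2 G2 H2 ->
  C2_with (fun y => f1 y + f2 y) (fun y => G1 y + G2 y) (fun y => H1 y + H2 y).
Proof.
case=> a0 a1 a2 d1 d2 [b0 b1 b2 e1 e2]; split=> [|i|i j|y i|y i j].
- exact: continuous_addr.
- by under eq_fun do rewrite mxE; exact: continuous_addr.
- by under eq_fun do rewrite mxE; exact: continuous_addr.
- by rewrite mxE; exact: is_deriveD.
- rewrite mxE; under eq_fun do rewrite mxE.
  by apply: is_deriveD.
Qed.

Lemma C2_with_translate a f G H : C2_with f G H ->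
  C2_with (fun y => f (y + a)) (fun y => G (y + a)) (fun y => H (y + a)).
Proof.
have tc (h : 'rV[R]_n -> R) : continuous h -> continuous (fun y => h (y + a)).
  move=> ch y; apply/continuous_epsP => e e0.
  have /continuous_epsP/(_ e e0)[r r0 hr] := ch (y + a); exists r => // w wr.
  by rewrite (addrAC y); exact: hr.
case=> a0 a1 a2 d1 d2; split=> [|i|i j|y i|y i j].
- exact: tc.
- exact: (tc (fun y => G y 0 i)).
- exact: (tc (fun y => H y i j)).
- exact: is_derive_translate.
- by apply: (@is_derive_translate R _ (fun y => G y 0 j)).
Qed.

Definition quad (A : 'M[R]_n) p x (c : R) y := c + dotp p (y - x) + qf A (y - x).

Lemma C2_with_quad A p x c : A^T = A ->
  C2_with (quad A p x c) (fun y => p + 2 *: ((y - x) *m A)) (fun=> 2 *: A).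
Proof.
move=> sA; have expand y w :
    quad A p x c (y + w) = quad A p x c y + dotp (p + 2 *: ((y - x) *m A)) w + qf A w.
  rewrite /quad (addrAC y) (dotpDr _ (y - x)) (qfDr (y - x)) // (dotpDl p) dotpZl.
  ring.
have cc i : continuous (fun y => (y - x) 0 i).
  under eq_fun do rewrite mxE.
  by apply: continuous_addr; [exact: continuous_coord|exact: cst_continuous].
have cA j : continuous (fun y => ((y - x) *m A) 0 j).
  under eq_fun do rewrite mxE.
  by apply: continuous_sumr => i; exact: continuous_mulr.
split=> [|i|i j|y i|y i j].
- rewrite /quad; apply: continuous_addr.
    apply: continuous_addr; first exact: cst_continuous.
    under eq_fun do rewrite dotpE.
    by apply: continuous_sumr => i; exact: continuous_mull.
  under eq_fun do rewrite qfE dotpE.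
  by apply: continuous_sumr => i; exact: continuous_mul.
- under eq_fun do rewrite mxE; apply: continuous_addr; first exact: cst_continuous.
  by under eq_fun do rewrite mxE; exact: continuous_mull.
- exact: cst_continuous.
- apply/is_deriveP => e e0.
  have A1 : 0 < `|A i i| + 1 by rewrite ltr_wpDl.
  exists (e / (`|A i i| + 1)); first exact: divr_gt0.
  move=> h; rewrite ltr_pdivlMr// => hh; rewrite expand dotpZr dotp_delta qfZr.
  have -> : qf A (delta_mx 0 i) = A i i by rewrite qfE dotp_delta -rowE mxE.
  rewrite (_ : _ - _ - _ = h * A i i * h); last by ring.
  rewrite normrM ler_wpM2r// normrM; apply: le_trans (ltW hh).
  by rewrite ler_wpM2l// lerDl.
apply/is_deriveP => e e0; exists 1 => // h _.
rewrite (addrAC y) mulmxDl -scalemxAl -rowE !mxE.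
rewrite (_ : _ - _ - _ = 0) ?normr0 ?mulr_ge0 ?(ltW e0)//; ring.
Qed.
End C2.

(** * Averages over segments *)

Section Segavg.
Context {R : realType} {n : nat}.
Implicit Types (w : 'rV[R]_n -> R) (v x y z : 'rV[R]_n) (d : R -> R).

Lemma primitive_exists (f : R -> R) (a : R) : continuous f ->
  exists W : R -> R, forall t : R, a < t -> is_derive t 1 W (f t).
Proof.
move=> cf; exists (fun b : R => \int[lebesgue_measure]_(s in `[a, b]) f s)%R => t at_.
have [||dW eW] := @continuous_FTC1_closed R f a t (t + 1) _ _ at_ (cf t).
- by rewrite ltrDl.
- apply: continuous_compact_integrable; first exact: segment_compact.
  exact: continuous_subspaceT.
by split; [exact: dW|rewrite -derive1E].
Qed.

Definition segavg v w x : R := (\int[lebesgue_measure]_(t in `[0%R, 1%R]) w (x + t *: v))%R.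

(** Uniform continuity with the modulus as data: averages and translates of [w]
    keep the same modulus. *)
Definition has_modulus d w : Prop := forall e : R, 0 < e ->
  0 < d e /\ forall x y, `|x - y| < d e -> `|w x - w y| <= e.

Lemma has_modulus_continuous d w : has_modulus d w -> continuous w.
Proof.
move=> mw x; apply/continuous_epsP => e e0.
have [d0 hd] := mw e e0; exists (d e) => // y yd.
by apply: hd; rewrite addrAC subrr add0r.
Qed.

Lemma line_continuous w x v : continuous w -> continuous (fun t : R => w (x + t *: v)).
Proof.
move=> cw t; apply/cvgrPdist_le => e e0.
have /continuous_epsP/(_ e e0)[r r0 hr] := cw (x + t *: v).
have v1 : 0 < `|v| + 1 by rewrite ltr_wpDl.
apply/nbhs_normP; exists (r / (`|v| + 1)); first exact: divr_gt0.
move=> s; rewrite /ball_ /= ltr_pdivlMr// => st; rewrite distrC.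
have := hr ((s - t) *: v); rewrite -addrA -scalerDl addrCA subrr addr0; apply.
by rewrite normrZ distrC (le_lt_trans _ st)// ler_wpM2l// lerDl.
Qed.

Lemma segavgE v w x (W : R -> R) : continuous w ->
  (forall t : R, 0 <= t <= 1 -> is_derive t 1 W (w (x + t *: v))) ->
  segavg v w x = W 1 - W 0.
Proof.
move=> cw dW; rewrite /segavg /Rintegral.
have cWt t : 0 <= t <= 1 -> {for t, continuous W}.
  by move=> /dW; exact: is_derive1_continuous.
rewrite (@continuous_FTC2 R _ W)//.
- by apply: continuous_subspaceT; exact: line_continuous.
- split.
  + by move=> t; rewrite in_itv /= => /andP[? ?]; apply: ex_derive; apply: dW; rewrite !ltW.
  + by apply: cvg_at_right_filter; apply: cWt; rewrite lexx ler01.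
  + by apply: cvg_at_left_filter; apply: cWt; rewrite lexx ler01.
- move=> t; rewrite in_itv /= => /andP[? ?]; rewrite derive1E.
  by apply: derive_val; apply: dW; rewrite !ltW.
Qed.

Lemma line_primitive v w x : continuous w -> exists W : R -> R,
  forall t : R, -2 < t -> is_derive t 1 W (w (x + t *: v)).
Proof. by move=> cw; apply: primitive_exists; exact: line_continuous. Qed.

Lemma segavg_mean v w x : continuous w ->
  exists2 c : R, 0 < c < 1 & segavg v w x = w (x + c *: v).
Proof.
move=> cw; have [W dW] := line_primitive v x cw.
have -> : segavg v w x = W 1 - W 0 by apply: (segavgE cw) => t t01; apply: dW; lra.
have [||c c01 ->] := @mean_value R W (fun t => w (x + t *: v)) 0 1.
- exact: ltr01.
- by move=> t t01; apply: dW; lra.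
by exists c; rewrite ?subr0 ?mulr1.
Qed.

Lemma segavg_linear v w1 w2 (a : R) x : continuous w1 -> continuous w2 ->
  segavg v (fun y => a * w1 y + w2 y) x = a * segavg v w1 x + segavg v w2 x.
Proof.
move=> c1 c2.
have [W1 dW1] := line_primitive v x c1; have [W2 dW2] := line_primitive v x c2.
have -> : segavg v w1 x = W1 1 - W1 0.
  by apply: (segavgE c1) => t t01; apply: dW1; lra.
have -> : segavg v w2 x = W2 1 - W2 0.
  by apply: (segavgE c2) => t t01; apply: dW2; lra.
have -> : a * (W1 1 - W1 0) + (W2 1 - W2 0) = (a *: W1 + W2) 1 - (a *: W1 + W2) 0.
  by rewrite !fctE /GRing.scale /=; ring.
apply: segavgE => [|t t01].
  by apply: continuous_addr => //; exact: continuous_mull.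
have D1 : is_derive t 1 W1 (w1 (x + t *: v)) by apply: dW1; lra.
have D2 : is_derive t 1 W2 (w2 (x + t *: v)) by apply: dW2; lra.
exact: is_deriveD.
Qed.

Lemma segavg_cst v (a : R) x : segavg v (fun=> a) x = a.
Proof. by have [|c _ ->//] := @segavg_mean v (fun=> a) x; exact: cst_continuous. Qed.

Lemma segavg_translate v w z x :
  segavg v (fun y => w (y + z)) x = segavg v w (x + z).
Proof. by rewrite /segavg; congr Rintegral; apply/funext => t; rewrite addrAC. Qed.

Opaque segavg.

Lemma segavg_dist v w1 w2 x y (e : R) : continuous w1 -> continuous w2 ->
  (forall z, `|w1 (x + z) - w2 (y + z)| <= e) ->
  `|segavg v w1 x - segavg v w2 y| <= e.
Proof.
move=> c1 c2 h.
have tc u w : continuous w -> continuous (fun z => w (z + u)).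
  move=> cw z; apply/continuous_epsP => e' e'0.
  have /continuous_epsP/(_ e' e'0)[r r0 hr] := cw (z + u); exists r => // s sr.
  by rewrite (addrAC z); exact: hr.
rewrite -(add0r x) -(add0r y) -!segavg_translate.
have := @segavg_linear v (fun z => w2 (z + y)) (fun z => w1 (z + x)) (-1) 0.
rewrite !mulN1r => /(_ (tc _ _ c2) (tc _ _ c1)) e1; rewrite addrC -e1.
have [|c _ ->] := @segavg_mean v (fun z => -1 * w2 (z + y) + w1 (z + x)) 0.
  by apply: continuous_addr; [apply: continuous_mull|]; exact: tc.
by rewrite mulN1r addrC ![_ + _ *: _ + _]addrC; exact: h.
Qed.

Lemma segavg_le v w1 w2 x : continuous w1 -> continuous w2 ->
  (forall y, w1 y <= w2 y) -> segavg v w1 x <= segavg v w2 x.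
Proof.
move=> c1 c2 h; rewrite -subr_ge0.
have := @segavg_linear v w1 w2 (-1) x c1 c2; rewrite mulN1r addrC => <-.
have [|c _ ->] := @segavg_mean v (fun z => -1 * w1 z + w2 z) x.
  by apply: continuous_addr => //; exact: continuous_mull.
by have := h (x + c *: v); lra.
Qed.

Lemma has_modulus_translate d w z : has_modulus d w -> has_modulus d (fun y => w (y + z)).
Proof.
move=> mw e e0; have [d0 hd] := mw e e0; split=> // x y xy; apply: hd.
by rewrite opprD addrACA subrr addr0.
Qed.

Lemma has_modulus_segavg d v w : has_modulus d w -> has_modulus d (segavg v w).
Proof.
move=> mw e e0; have cw := has_modulus_continuous mw.
have [d0 hd] := mw e e0; split=> // x y xy; apply: segavg_dist => // z.
by apply: hd; rewrite opprD addrACA subrr addr0.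
Qed.

(** Averaging along [v] gains one derivative along [v]. *)
Lemma is_derive_segavg v w x : continuous w ->
  is_derive x v (segavg v w) (w (x + v) - w x).
Proof.
move=> cw; have [W dW] := line_primitive v x cw.
have key (s : R) : -1 < s -> segavg v w (x + s *: v) = W (1 + s) - W s.
  move=> s1; have -> : W (1 + s) - W s = W (1 + s) - W (0 + s) by rewrite add0r.
  apply: (@segavgE v w (x + s *: v) (fun t => W (t + s)) cw) => t t01.
  have /is_deriveP D : is_derive (t + s) 1 W (w (x + (t + s) *: v)).
    by apply: dW; lra.
  apply/is_deriveP => e e0; have [r r0 hr] := D e e0; exists r => // h hh.
  by have := hr h hh; rewrite (addrAC t) -[x + s *: v + _]addrA -scalerDl (addrC s).
have /is_deriveP D1 : is_derive (1 : R) 1 W (w (x + v)).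
  by rewrite -[v in w (x + v)]scale1r; apply: dW; lra.
have /is_deriveP D0 : is_derive (0 : R) 1 W (w x).
  by rewrite -[x in w x]addr0 -(scale0r v); apply: dW; lra.
apply/is_deriveP => e e0; have e2 : 0 < e / 2 by lra.
have [r1 r10 h1] := D1 _ e2; have [r2 r20 h2] := D0 _ e2.
exists (Num.min 1 (Num.min r1 r2)); first by rewrite !lt_min ltr01 r10.
move=> h; rewrite !lt_min => /and3P[hl /h1 + /h2].
rewrite key; last by move: hl; rewrite ltr_norml; lra.
have -> : segavg v w x = W 1 - W 0.
  by have := key 0; rewrite scale0r !addr0; apply; lra.
rewrite /GRing.scale /= mulr1 add0r => A B.
rewrite (_ : _ - _ - _ = (W (1 + h) - W 1 - h * w (x + v)) -
  (W h - W 0 - h * w x)); last by ring.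
by apply: le_trans (ler_normB _ _) _; lra.
Qed.

Lemma mean_value_gt (W f : R -> R) (a s h : R) :
  (forall t : R, a < t -> is_derive t 1 W (f t)) -> a < s -> a < s + h ->
  exists2 c : R, `|c - s| <= `|h| & W (s + h) - W s = f c * h.
Proof.
move=> dW as_ ash; have [h0|h0|->] := ltgtP h 0; last first.
- by exists s; rewrite ?addr0 ?subrr ?normr0 ?mulr0.
- have [||c c01 e] := @mean_value R W f s (s + h).
  + by rewrite ltrDl.
  + by move=> t t01; apply: dW; lra.
  exists c; first by rewrite ler_norml (gtr0_norm h0); lra.
  by rewrite e; congr (_ * _); ring.
have [||c c01 e] := @mean_value R W f (s + h) s.
- by rewrite gtrDl.
- by move=> t t01; apply: dW; lra.
exists c; first by rewrite ler_norml (ltr0_norm h0); lra.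
by move: e; rewrite opprD addNKr => e; lra.
Qed.

(** Fubini for uniformly continuous functions: as functions of the length [s] of
    the initial part of the segment along [u], both iterated integrals vanish at 0
    and have the derivative [segavg v w (x + s *: u)]. *)
Lemma segavg_comm d u v w x : has_modulus d w ->
  segavg u (segavg v w) x = segavg v (segavg u w) x.
Proof.
move=> mw; have cw := has_modulus_continuous mw.
have ms z := has_modulus_segavg z mw.
have cs z := has_modulus_continuous (ms z).
(* [G s] is the average along [v] of the integral of [w] over the first part,
   of length [s], of the line along [u] *)
pose G s := s * segavg v (segavg (s *: u) w) x.
have part y (W : R -> R) (s : R) : (forall t : R, -2 < t -> is_derive t 1 W (w (y + t *: u))) ->
    -2 < s -> s * segavg (s *: u) w y = W s - W 0.
  move=> dW s2; have [->|s0] := eqVneq s 0; first by rewrite mul0r subrr.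
  have -> : W s - W 0 = s * ((s^-1 *: (fun t : R => W (0 + t *: s))) 1 -
      (s^-1 *: (fun t : R => W (0 + t *: s))) 0).
    by rewrite !fctE scale0r scale1r addr0 add0r /GRing.scale /=; field.
  congr (_ * _); apply: (segavgE cw) => t t01; rewrite scalerA.
  have D : is_derive (0 + t *: s) (s * 1) W (s * w (y + (t * s) *: u)).
    apply: is_derive_dirZ; rewrite add0r; apply: dW; rewrite /GRing.scale /=.
    by case: (lerP 0 s) => ss; nra.
  rewrite mulr1 in D; have D2 := is_derive_line D.
  have -> : w (y + (t * s) *: u) = s^-1 *: (s * w (y + (t * s) *: u)).
    by rewrite /GRing.scale /= mulKf.
  exact: is_deriveZ.
have step (s h e : R) : 0 < e -> -1 < s -> -1 < s + h -> `|h| * (`|u| + 1) < d e ->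
    `|G (s + h) - G s - h * segavg v w (x + s *: u)| <= e * `|h|.
  move=> e0 s1 sh1 hd.
  have sh2 : -2 < s + h by lra.
  have s2 : -2 < s by lra.
  pose F y := (s + h) * segavg ((s + h) *: u) w y +
    (- s * segavg (s *: u) w y + (- h * w (y + s *: u) + 0)).
  have ct : continuous (fun y => w (y + s *: u)).
    exact: (has_modulus_continuous (has_modulus_translate (s *: u) mw)).
  have c0 : continuous (fun _ : 'rV[R]_n => 0 : R) by move=> y; exact: cst_continuous.
  have c1 := continuous_addr (continuous_mull (c := - h) ct) c0.
  have c2 := continuous_addr (continuous_mull (c := - s) (cs (s *: u))) c1.
  have eF : segavg v F x = G (s + h) - G s - h * segavg v w (x + s *: u).
    rewrite /F (segavg_linear _ _ _ (cs _) c2) (segavg_linear _ _ _ (cs _) c1).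
    rewrite (segavg_linear _ _ _ ct c0).
    rewrite (segavg_cst v 0 x).
    rewrite segavg_translate.
    rewrite /G; move: (segavg v (segavg ((s + h) *: u) w) x) (segavg v (segavg (s *: u) w) x).
    by move: (segavg v w (x + s *: u)) => A B C; ring.
  have [|c _] := @segavg_mean v F x.
    exact: continuous_addr (continuous_mull (cs _)) c2.
  rewrite eF {eF} => ->; rewrite /F; move: (x + c *: v) => y.
  have [W dW] := line_primitive u y cw.
  rewrite mulNr (part y W _ dW sh2) (part y W _ dW s2).
  have [b bs e1] := mean_value_gt dW s2 sh2.
  rewrite (_ : _ + _ = h * (w (y + b *: u) - w (y + s *: u))); last first.
    by rewrite mulrBr [h * w (y + b *: u)]mulrC -e1; ring.
  rewrite normrM mulrC ler_wpM2r//; have [_ hw] := mw e e0; apply: hw.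
  rewrite opprD addrACA subrr add0r -scalerBl normrZ.
  apply: le_lt_trans hd; rewrite ler_pM// lerDl.
  by [].
have dG (s : R) : 0 <= s <= 1 -> is_derive s 1 G (segavg v w (x + s *: u)).
  move=> s01; apply/is_deriveP => e e0; have [d0 _] := mw e e0.
  have u1 : 0 < `|u| + 1 by rewrite ltr_wpDl.
  exists (Num.min 1 (d e / (`|u| + 1))).
    by rewrite lt_min ltr01 divr_gt0.
  move=> h; rewrite lt_min ltr_pdivlMr// => /andP[hl hd].
  rewrite /GRing.scale /= mulr1; apply: step => //; first by lra.
  by move: hl; rewrite ltr_norml; lra.
by rewrite (segavgE (cs v) dG) /G mul0r subr0 mul1r scale1r.
Qed.

End Segavg.

(** * Mollification *)

Section Smooth.
Context {R : realType} {n : nat}.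
Implicit Types (w : 'rV[R]_n -> R) (u v x y z : 'rV[R]_n) (d : R -> R)
  (s : seq 'rV[R]_n).

Definition smooth s w : 'rV[R]_n -> R := foldr segavg w s.

Lemma has_modulus_smooth d s w : has_modulus d w -> has_modulus d (smooth s w).
Proof. by move=> mw; elim: s => //= v s IH; exact: has_modulus_segavg. Qed.

Lemma smooth_continuous d s w : has_modulus d w -> continuous (smooth s w).
Proof. by move=> mw; apply: has_modulus_continuous; exact: has_modulus_smooth mw. Qed.

Lemma smooth_perm d s1 s2 w : has_modulus d w -> perm_eq s1 s2 ->
  smooth s1 w = smooth s2 w.
Proof.
move=> mw; have front v s : smooth (rcons s v) w = smooth (v :: s) w.
  elim: s => //= u s -> /=; apply/funext => x; apply: (@segavg_comm _ _ d).
  exact: has_modulus_smooth.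
have mid s v s' : smooth (s ++ v :: s') w = smooth (v :: s ++ s') w.
  elim: s => //= u s -> /=; apply/funext => x; apply: (@segavg_comm _ _ d).
  exact: has_modulus_smooth.
elim: s1 s2 => [|v s IH] s2; first by rewrite perm_sym => /perm_nilP ->.
move=> p; have vs2 : v \in s2 by rewrite -(perm_mem p) mem_head.
case/splitPr: vs2 p => s3 s4 p; rewrite mid /= (IH (s3 ++ s4))//.
by rewrite -(perm_cons v); apply: perm_trans p _; rewrite -cat1s perm_catCA.
Qed.

Lemma smooth_linear d1 d2 s w1 w2 (a : R) :
  has_modulus d1 w1 -> has_modulus d2 w2 ->
  smooth s (fun y => a * w1 y + w2 y) = fun y => a * smooth s w1 y + smooth s w2 y.
Proof.
move=> m1 m2; elim: s => //= v s ->; apply/funext => x.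
by rewrite segavg_linear//; [exact: smooth_continuous m1|exact: smooth_continuous m2].
Qed.

Lemma smooth_dist d1 d2 s w1 w2 x y (e : R) :
  has_modulus d1 w1 -> has_modulus d2 w2 ->
  (forall z, `|w1 (x + z) - w2 (y + z)| <= e) ->
  `|smooth s w1 x - smooth s w2 y| <= e.
Proof.
move=> m1 m2 h; elim: s x y h => [|v s IH] x y h.
  by rewrite -[x]addr0 -[y]addr0; exact: h.
apply: segavg_dist => [||z]; first exact: smooth_continuous m1.
  exact: smooth_continuous m2.
by apply: IH => z'; rewrite -!addrA; exact: h.
Qed.

Lemma smooth_le d1 d2 s w1 w2 x : has_modulus d1 w1 -> has_modulus d2 w2 ->
  (forall y, w1 y <= w2 y) -> smooth s w1 x <= smooth s w2 x.
Proof.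
move=> m1 m2 h; elim: s x => [|v s IH] x //=; apply: segavg_le => //.
  exact: smooth_continuous m1.
exact: smooth_continuous m2.
Qed.

Lemma smooth_cst s (a : R) x : smooth s (fun=> a) x = a.
Proof.
elim: s x => //= v s IH x; rewrite -[RHS](segavg_cst v a x); congr segavg.
exact/funext.
Qed.

Lemma smooth_mean d s w x : has_modulus d w ->
  exists2 z, `|z| <= \sum_(v <- s) `|v| & smooth s w x = w (x + z).
Proof.
move=> mw; elim: s x => [|v s IH] x /=.
  by exists 0; rewrite ?addr0// big_nil normr0.
have [c c01 ->] := segavg_mean v x (smooth_continuous (s := s) mw).
have [z zs ->] := IH (x + c *: v); exists (c *: v + z); last by rewrite addrA.
rewrite big_cons; apply: le_trans (ler_normD _ _) (lerD _ zs).
by rewrite normrZ ger0_norm ?ler_piMl//; lra.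
Qed.

Definition axes (h : R) : seq 'rV[R]_n := [seq h *: delta_mx 0 i | i <- enum 'I_n].

(** Smoothing by segment averages is enough here, and needs no integration in
    several variables: each coordinate direction is averaged over twice, so that
    a continuous function becomes twice continuously differentiable. *)
Definition mollify h w := smooth (axes h ++ axes h) w.

Lemma mem_axes h i : h *: delta_mx 0 i \in axes h.
Proof. by apply/mapP; exists i => //; rewrite mem_enum. Qed.

Lemma mollify_radius h : 0 <= h ->
  \sum_(v <- axes h ++ axes h) `|v| <= 2 * n%:R * h.
Proof.
move=> h0; have le1 : \sum_(v <- axes h) `|v| <= n%:R * h.
  rewrite big_map big_enum -[n in leRHS]card_ord mulr_natl -sumr_const ler_sum// => i _.
  rewrite normrZ ger0_norm// ler_piMr// rV_norm_le//; apply/forallP => j.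
  by rewrite mxE /=; case: (j == i); rewrite ?normr1 ?normr0.
by rewrite big_cat/=; lra.
Qed.

Lemma mollify_mean d h w x : 0 <= h -> has_modulus d w ->
  exists2 z, `|z| <= 2 * n%:R * h & mollify h w x = w (x + z).
Proof.
move=> h0 mw; have [z zle e] := smooth_mean (axes h ++ axes h) x mw.
by exists z => //; exact: le_trans zle (mollify_radius h0).
Qed.

(** The gradient and the Hessian of [mollify h w]: differentiating an average
    over a segment replaces that average by a difference quotient, so one copy of
    each axis involved is removed from the list. *)
Definition mollify_grad h w x : 'rV[R]_n := \row_i
  let P := smooth (rem (h *: delta_mx 0 i) (axes h) ++ axes h) w in
  h^-1 * (P (x + h *: delta_mx 0 i) - P x).

Definition mollify_hess h w x : 'M[R]_n := \matrix_(i, j)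
  let P := smooth (rem (h *: delta_mx 0 i) (axes h) ++
                   rem (h *: delta_mx 0 j) (axes h)) w in
  h^-1 * (h^-1 * (P (x + h *: delta_mx 0 i + h *: delta_mx 0 j)
    - P (x + h *: delta_mx 0 i) - P (x + h *: delta_mx 0 j) + P x)).

(** The averages commute, hence those along the axes of differentiation can be
    taken last, where [is_derive_segavg] applies to them. *)
Lemma C2_with_mollify d h w : has_modulus d w -> 0 < h ->
  C2_with (mollify h w) (mollify_grad h w) (mollify_hess h w).
Proof.
move=> mw h0.
have cs s := smooth_continuous (s := s) mw.
have ct s z : continuous (fun y => smooth s w (y + z)).
  exact: has_modulus_continuous (has_modulus_translate z (has_modulus_smooth s mw)).
have cN (f : 'rV[R]_n -> R) : continuous f -> continuous (fun y => - f y).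
  by move=> cf y; apply: continuousN; exact: cf.
have dP s v y : is_derive y v (smooth (v :: s) w) (smooth s w (y + v) - smooth s w y).
  by apply: is_derive_segavg; exact: cs.
have dZ s i y : is_derive y (delta_mx 0 i) (smooth (h *: delta_mx 0 i :: s) w)
    (h^-1 * (smooth s w (y + h *: delta_mx 0 i) - smooth s w y)).
  have := is_derive_dirZ h^-1 (dP s (h *: delta_mx 0 i) y).
  by rewrite scalerA mulVf ?gt_eqF// scale1r.
split=> [|i|i j|y i|y i j].
- exact: cs.
- under eq_fun do rewrite mxE; apply: continuous_mull.
  by apply: continuous_addr; [exact: ct|apply: cN; exact: cs].
- under eq_fun do rewrite mxE; do 2 apply: continuous_mull.
  apply: continuous_addr; last exact: cs.
  apply: continuous_addr; last by apply: cN; exact: ct.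
  apply: continuous_addr; last by apply: cN; exact: ct.
  by under eq_fun do rewrite -addrA; exact: ct.
- rewrite mxE /=.
  have -> : mollify h w = smooth (h *: delta_mx 0 i ::
      (rem (h *: delta_mx 0 i) (axes h) ++ axes h)) w.
    apply: smooth_perm mw _.
    by rewrite -cat_cons perm_cat2r perm_to_rem// mem_axes.
  exact: dZ.
have -> : (fun z => mollify_grad h w z 0 j) = fun z =>
    h^-1 * (smooth (h *: delta_mx 0 i :: (rem (h *: delta_mx 0 i) (axes h) ++
      rem (h *: delta_mx 0 j) (axes h))) w (z + h *: delta_mx 0 j) -
      smooth (h *: delta_mx 0 i :: (rem (h *: delta_mx 0 i) (axes h) ++
      rem (h *: delta_mx 0 j) (axes h))) w z).
  apply/funext => z; rewrite mxE /=.
  rewrite (@smooth_perm d _ (h *: delta_mx 0 i :: (rem (h *: delta_mx 0 i) (axes h) ++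
      rem (h *: delta_mx 0 j) (axes h))) w mw)//.
  by rewrite -cat_cons perm_catC perm_cat2r perm_to_rem// mem_axes.
set s := _ ++ _; rewrite mxE /= -/s.
set A := segavg _ _; have dA z : is_derive z (delta_mx 0 i) A
    (h^-1 * (smooth s w (z + h *: delta_mx 0 i) - smooth s w z)) by exact: dZ.
have dAt := is_derive_translate (dA (y + h *: delta_mx 0 j)).
have D := is_deriveZ h^-1 (is_deriveB dAt (dA y)).
apply: is_derive_eq D _; rewrite /GRing.scale /= (addrAC y).
move: (smooth s w _) (smooth s w _) (smooth s w _) (smooth s w _) => a b c e.
ring.
Qed.

Lemma mollify_hess_sym d h w x : has_modulus d w ->
  (mollify_hess h w x)^T = mollify_hess h w x.
Proof.
move=> mw; apply/matrixP => i j; rewrite !mxE /=.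
set s := rem (h *: delta_mx 0 i) _ ++ _; set s' := _ ++ _.
have -> : smooth s' w = smooth s w by apply: smooth_perm mw _; rewrite perm_catC.
rewrite (addrAC x (h *: delta_mx 0 j)); congr (_ * (_ * (_ + _))).
by rewrite [LHS]addrAC.
Qed.

Lemma mollify_hess_dist d1 d2 h w1 w2 x y (e : R) i j : 0 < h ->
  has_modulus d1 w1 -> has_modulus d2 w2 ->
  (forall z, `|w1 (x + z) - w2 (y + z)| <= e) ->
  `|mollify_hess h w1 x i j - mollify_hess h w2 y i j| <= 4 * e / h ^+ 2.
Proof.
move=> h0 m1 m2 hw; rewrite !mxE /=; set s := _ ++ _.
have D z : `|smooth s w1 (x + z) - smooth s w2 (y + z)| <= e.
  by apply: smooth_dist m1 m2 _ => z'; rewrite -!addrA; exact: hw.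
have := D (h *: delta_mx 0 i + h *: delta_mx 0 j); have := D (h *: delta_mx 0 i).
have := D (h *: delta_mx 0 j); have := D 0; rewrite !addr0 !addrA.
move: (smooth s w1 _) (smooth s w1 _) (smooth s w1 _) (smooth s w1 _) => a1 b1 c1 f1.
move: (smooth s w2 _) (smooth s w2 _) (smooth s w2 _) (smooth s w2 _) => a2 b2 c2 f2.
rewrite !ler_norml => ha hb hc hf.
rewrite (_ : _ - _ = (a1 - b1 - c1 + f1 - (a2 - b2 - c2 + f2)) / h ^+ 2); last first.
  by field; rewrite gt_eqF.
rewrite -mulNr !ler_pM2r ?invr_gt0 ?exprn_gt0//.
by apply/andP; split; lra.
Qed.

End Smooth.

(** * Linear second-order bounds survive mollification *)

Section Balls.
Context {R : realType} {n : nat}.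

Lemma compact_ball (x : 'rV[R]_n) (r : R) : compact [set y | `|y - x| <= r].
Proof.
apply: bounded_closed_compact.
  exists (`|x| + r); split; [exact: num_real|move=> M rM y /= yr].
  by have := ler_normD (y - x) x; rewrite subrK; lra.
have cn : continuous (fun y : 'rV[R]_n => `|y - x|).
  move=> y; apply/continuous_epsP => e e0; exists e => // w we.
  apply: le_trans (ler_dist_dist _ _) _.
  by rewrite opprB addrA subrK addrAC subrr add0r ltW.
rewrite (_ : [set y | _] = (fun y => `|y - x|) @^-1` [set a | a <= r])//.
by apply: closed_comp => [y _|]; [exact: cn|exact: closed_le].
Qed.

End Balls.

Section Heat.
Context {R : realType} {n m : nat}.
Variable xi : 'I_m -> 'rV[R]_n.
Hypothesis m0 : (0 < m)%N.
Implicit Types (w f : 'rV[R]_n -> R) (v x y z : 'rV[R]_n) (d : R -> R) (t e : R).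

(** One step of a symmetric random walk along the directions [xi]. *)
Definition stepavg t w y : R :=
  (2 * m%:R)^-1 * \sum_(k < m) (w (y + t *: xi k) + w (y - t *: xi k)).

Let m2 : 0 < (2 * m%:R : R). Proof. by rewrite mulr_gt0// ltr0n. Qed.

Lemma stepavg_le t w1 w2 y : (forall z, w1 z <= w2 z) -> stepavg t w1 y <= stepavg t w2 y.
Proof.
move=> h; rewrite ler_pM2l ?invr_gt0//.
by apply: ler_sum => k _; apply: lerD; exact: h.
Qed.

Lemma stepavg_linear t (a : R) w1 w2 y :
  stepavg t (fun z => a * w1 z + w2 z) y = a * stepavg t w1 y + stepavg t w2 y.
Proof.
rewrite /stepavg mulrCA -mulrDr; congr (_ * _).
by rewrite mulr_sumr -big_split/=; apply: eq_bigr => k _; ring.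
Qed.

Lemma stepavg_cst t (a : R) y : stepavg t (fun=> a) y = a.
Proof.
rewrite /stepavg sumr_const card_ord -mulr_natr -mulr2n -mulr_natr.
by field; rewrite pnatr_eq0 -lt0n.
Qed.

Lemma stepavg_dist t w1 w2 x y e :
  (forall z, `|w1 (x + z) - w2 (y + z)| <= e) ->
  `|stepavg t w1 x - stepavg t w2 y| <= e.
Proof.
move=> h; rewrite /stepavg -mulrBr normrM gtr0_norm ?invr_gt0//.
rewrite mulrC ler_pdivrMr// -sumrB; apply: le_trans (ler_norm_sum _ _ _) _.
rewrite (_ : e * _ = \sum_(k < m) (e + e)); last first.
  by rewrite sumr_const card_ord -mulr_natr; ring.
apply: ler_sum => k _; rewrite opprD addrACA.
by apply: le_trans (ler_normD _ _) _; rewrite lerD.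
Qed.

Lemma has_modulus_stepavg t d w : has_modulus d w -> has_modulus d (stepavg t w).
Proof.
move=> mw e e0; have [d0 hd] := mw e e0; split=> // x y xy.
by apply: stepavg_dist => z; apply: hd; rewrite opprD addrACA subrr addr0.
Qed.

Lemma has_modulus_iter t d w k : has_modulus d w -> has_modulus d (iter k (stepavg t) w).
Proof. by move=> mw; elim: k => //= k IH; exact: has_modulus_stepavg. Qed.

Lemma stepavg_close t d w e y : 0 < t -> has_modulus d w -> 0 < e ->
  (forall k, t * `|xi k| < d e) -> `|stepavg t w y - w y| <= e.
Proof.
move=> t0 mw e0 h; have [d0 hd] := mw e e0.
rewrite -[w y in X in `|X|](stepavg_cst t (w y) y) /stepavg -mulrBr normrM.
rewrite gtr0_norm ?invr_gt0// mulrC ler_pdivrMr// -sumrB.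
apply: le_trans (ler_norm_sum _ _ _) _.
rewrite (_ : e * _ = \sum_(k < m) (e + e)); last first.
  by rewrite sumr_const card_ord -mulr_natr; ring.
apply: ler_sum => k _; rewrite opprD addrACA.
apply: le_trans (ler_normD _ _) _; rewrite lerD//; apply: hd.
  by rewrite addrAC subrr add0r normrZ gtr0_norm.
by rewrite addrAC subrr add0r normrN normrZ gtr0_norm.
Qed.

Lemma segavg_sum v (I : Type) (r : seq I) (F : I -> 'rV[R]_n -> R) x :
  (forall i, continuous (F i)) ->
  segavg v (fun y => \sum_(i <- r) F i y) x = \sum_(i <- r) segavg v (F i) x.
Proof.
move=> cF; elim: r => [|i r IH].
  rewrite big_nil -[RHS](segavg_cst v 0 x); congr segavg.
  by apply/funext => y; rewrite big_nil.
rewrite big_cons -IH -[segavg v (F i) x]mul1r -segavg_linear//; last first.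
  by apply: continuous_sumr.
by congr segavg; apply/funext => y; rewrite big_cons mul1r.
Qed.

(** The walk commutes with smoothing, since both are averages of translates. *)
Lemma segavg_stepavg v t w x : continuous w ->
  segavg v (stepavg t w) x = stepavg t (segavg v w) x.
Proof.
move=> cw; have ct z : continuous (fun y => w (y + z)).
  move=> y; apply/continuous_epsP => e e0.
  have /continuous_epsP/(_ e e0)[r r0 hr] := cw (y + z); exists r => // s sr.
  by rewrite (addrAC y); exact: hr.
pose F k y := w (y + t *: xi k) + w (y - t *: xi k).
have cF k : continuous (F k) by apply: continuous_addr; exact: ct.
have c0 : continuous (fun _ : 'rV[R]_n => 0 : R) by move=> y; exact: cst_continuous.
have -> : stepavg t w = fun y => (2 * m%:R)^-1 * (\sum_k F k y) + 0.
  by apply/funext => y; rewrite addr0.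
rewrite (segavg_linear _ _ _ _ c0); last exact: continuous_sumr.
rewrite segavg_cst addr0 segavg_sum// /stepavg; congr (_ * _).
apply: eq_bigr => k _; rewrite -!segavg_translate.
have := segavg_linear v 1 x (ct (t *: xi k)) (ct (- (t *: xi k))).
rewrite mul1r => <-; congr segavg.
by apply/funext => y; rewrite /F mul1r.
Qed.

Lemma smooth_iter s t d w k : has_modulus d w ->
  smooth s (iter k (stepavg t) w) = iter k (stepavg t) (smooth s w).
Proof.
move=> mw; have one u : has_modulus d u -> smooth s (stepavg t u) = stepavg t (smooth s u).
  move=> mu; elim: s => //= v s ->; apply/funext => x; apply: segavg_stepavg.
  exact: smooth_continuous mu.
by elim: k => //= k <-; rewrite one//; exact: has_modulus_iter.
Qed.

Lemma iter_stepavg_le t k w1 w2 y : (forall z, w1 z <= w2 z) ->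
  iter k (stepavg t) w1 y <= iter k (stepavg t) w2 y.
Proof. by move=> h; elim: k y => //= k IH y; exact: stepavg_le. Qed.

Lemma iter_stepavg_addc t k w (a : R) y :
  iter k (stepavg t) (fun z => w z + a) y = iter k (stepavg t) w y + a.
Proof.
elim: k y => //= k IH y.
have -> : iter k (stepavg t) (fun z => w z + a) =
    fun z => 1 * iter k (stepavg t) w z + a.
  by apply/funext => z; rewrite mul1r.
by rewrite stepavg_linear stepavg_cst mul1r.
Qed.

Lemma stepavg_support t w (r c : R) : 0 < t -> (forall k, `|xi k| <= c) ->
  (forall y, r < `|y| -> w y = 0) ->
  forall y, r + t * c < `|y| -> stepavg t w y = 0.
Proof.
move=> t0 hc hw y yr; rewrite /stepavg big1 ?mulr0// => k _.
have tk : t * `|xi k| <= t * c by rewrite ler_wpM2l// ltW.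
rewrite !hw ?addr0//.
  have := lerB_normD y (- (t *: xi k)); rewrite normrN normrZ (gtr0_norm t0).
  by lra.
have := lerB_normD y (t *: xi k); rewrite normrZ (gtr0_norm t0).
by lra.
Qed.

Lemma iter_stepavg_support t w (r c : R) k : 0 < t -> (forall k, `|xi k| <= c) ->
  (forall y, r < `|y| -> w y = 0) ->
  forall y, r + k%:R * (t * c) < `|y| -> iter k (stepavg t) w y = 0.
Proof.
move=> t0 hc hw; elim: k => [|k IH] y /=; first by rewrite mul0r addr0; exact: hw.
rewrite -natr1 mulrDl mul1r addrA => yk.
exact: (stepavg_support t0 hc IH).
Qed.

Lemma C2_with_stepavg t f G H : C2_with f G H ->
  C2_with (stepavg t f) (fun y => \row_i stepavg t (fun z => G z 0 i) y)
    (fun y => \matrix_(i, j) stepavg t (fun z => H z i j) y).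
Proof.
have ct u z : continuous u -> continuous (fun y => u (y + z) : R).
  move=> cu y; apply/continuous_epsP => e e0.
  have /continuous_epsP/(_ e e0)[r r0 hr] := cu (y + z); exists r => // s sr.
  by rewrite (addrAC y); exact: hr.
have cS u : continuous u -> continuous (stepavg t u).
  move=> cu; apply: continuous_mull; apply: continuous_sumr => k.
  by apply: continuous_addr; exact: ct.
have dS u du v y : (forall y, is_derive y v u (du y)) ->
    is_derive y v (stepavg t u) (stepavg t du y).
  move=> D; have -> : stepavg t u = (2 * m%:R)^-1 *: \sum_(k < m)
      ((fun y => u (y + t *: xi k)) + (fun y => u (y - t *: xi k))).
    by apply/funext => z; rewrite /stepavg fctE fct_sumE.
  apply: is_deriveZ; apply: is_derive_sum => k; apply: is_deriveD.
    exact: is_derive_translate.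
  exact: is_derive_translate.
case=> c0 c1 c2 d1 d2; split=> [|i|i j|y i|y i j].
- exact: cS.
- by under eq_fun do rewrite mxE; exact: cS.
- by under eq_fun do rewrite mxE; exact: cS.
- by rewrite mxE; apply: dS => z; exact: d1.
- rewrite mxE; under eq_fun do rewrite mxE.
  by apply: (dS (fun z => G z 0 j)) => z; exact: d2.
Qed.

Lemma C2_with_iter t f G H k : C2_with f G H ->
  exists G', C2_with (iter k (stepavg t) f) G'
    (fun y => \matrix_(i, j) iter k (stepavg t) (fun z => H z i j) y).
Proof.
move=> fGH; elim: k => [|k [G' IH]].
  exists G => /=; have -> : (fun y => \matrix_(i, j) H y i j) = H => //.
  by apply/funext => y; apply/matrixP => i j; rewrite mxE.
have := C2_with_stepavg t IH; set G2 := fun y => \row__ _ => D.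
exists G2; move: D; congr C2_with.
apply/funext => y; apply/matrixP => i j; rewrite !mxE /=.
by congr stepavg; apply/funext => z; rewrite mxE.
Qed.

(** The walk solves the heat equation for [\sum_k qf (hess f) (xi k)] up to a small
    error when one step counts for this time. *)
Definition steptime t : R := t ^+ 2 / (2 * m%:R).

Lemma stepavg_second_difference t f G H y : 0 < t -> C2_with f G H ->
  exists2 s : 'I_m -> R, forall k, `|s k| <= t &
    stepavg t f y - f y = steptime t * \sum_k qf (H (y + s k *: xi k)) (xi k).
Proof.
move=> t0 fGH; have /choice[s hs] k : exists s : R, `|s| <= t /\
    f (y + t *: xi k) + f (y - t *: xi k) - 2 * f y =
    t ^+ 2 * qf (H (y + s *: xi k)) (xi k).
  by have [s st e] := second_difference fGH y (xi k) t0; exists s.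
exists s => [k|]; first by have [] := hs k.
rewrite -[f y in X in _ - X](stepavg_cst t (f y) y) /stepavg -mulrBr -sumrB.
rewrite /steptime mulrAC [RHS]mulrC; congr (_ * _); rewrite mulr_sumr.
by apply: eq_bigr => k _; have [_ <-] := hs k; ring.
Qed.

Lemma qf_dist (A B : 'M[R]_n) z e : (forall i j, `|A i j - B i j| <= e) ->
  `|qf A z - qf B z| <= e * (n%:R * `|z|) ^+ 2.
Proof.
move=> h; rewrite -qfBl /qf mxE.
have -> : e * (n%:R * `|z|) ^+ 2 = \sum_(j < n) \sum_(i < n) (`|z| * e * `|z|).
  by rewrite !sumr_const card_ord -mulrnA -[_ *+ (n * n)]mulr_natr natrM; ring.
apply: le_trans (ler_norm_sum _ _ _) _; apply: ler_sum => j _.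
rewrite mxE mulr_suml; apply: le_trans (ler_norm_sum _ _ _) _.
apply: ler_sum => i _; rewrite !mxE !normrM.
by rewrite ler_pM ?mulr_ge0// ?rV_coord_le// ler_pM// ?rV_coord_le.
Qed.

Lemma bounded_support_max (f : 'rV[R]_n -> R) (r : R) : continuous f ->
  (forall y, r < `|y| -> f y = 0) -> exists x, forall y, f y <= f x.
Proof.
move=> cf fr; pose B := [set y : 'rV[R]_n | `|y| <= `|r|].
have cB : compact B.
  by have := @compact_ball R n 0 `|r|; under eq_fun do rewrite subr0.
have B0 : B !=set0 by exists 0; rewrite /B /= normr0.
have [c _ cmax] := EVT_max_rV B0 cB (continuous_subspaceT cf).
have [|/existsNP[y /negP]] := pselect (forall y, f y <= f c).
  by exists c.
rewrite -ltNge => fy.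
have out z : ~ B z -> f z = 0.
  move=> /negP; rewrite -ltNge => rz; apply: fr; apply: le_lt_trans rz.
  exact: ler_norm.
have inB z : B z -> f z <= f c by move=> Bz; apply: cmax; rewrite inE.
have nBy : ~ B y by move=> /inB; rewrite leNgt fy.
exists y => z; rewrite (out y nBy).
have [/inB fz|/out ->//] := pselect (B z).
by apply: le_trans fz _; rewrite -(out y nBy) ltW.
Qed.

(** The functions tested are everywhere twice continuously differentiable and
    touch from above globally. *)
Definition touching_trace_ge g (c : R) := forall phi G H x, C2_with phi G H ->
  (H x)^T = H x -> (forall y, g y - phi y <= g x - phi x) ->
  c <= \sum_k qf (H x) (xi k).

Section Bound.
Variables (g : 'rV[R]_n -> R) (d : R -> R) (r c : R).
Hypotheses (mg : has_modulus d g) (gr : forall y, r < `|y| -> g y = 0)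
  (gc : touching_trace_ge g c).

(** Compare [g] with the random walk started from a mollification [q] of [g]:
    where [g - iter k.+1 (stepavg t) q] is maximal, the Hessian of the iterate is
    controlled by the touching condition, so that this maximum drops by almost
    [steptime t * c] at each step. *)
Lemma le_iter_stepavg (e del : R) : 0 < e -> 0 < del -> exists2 t0 : R, 0 < t0 &
  forall t, 0 < t < t0 -> forall N x,
    g x <= iter N (stepavg t) g x + del - N%:R * steptime t * (c - e).
Proof.
move=> e0 del0; have del2 : 0 < del / 2 by rewrite divr_gt0.
have [dd0 hdd] := mg del2.
(* [h] is so small that [q] stays within [del / 2] of [g] *)
pose h := d (del / 2) / (2 * n.+1%:R + 1).
have h0 : 0 < h by rewrite divr_gt0// ltr_wpDl// mulr_ge0.
pose q := mollify h g.
have qg x : `|q x - g x| <= del / 2.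
  rewrite /q; have [z zle ->] := mollify_mean x (ltW h0) mg.
  apply: hdd; rewrite addrAC subrr add0r; apply: le_lt_trans zle _.
  rewrite /h mulrA ltr_pdivrMr; last by rewrite ltr_wpDl// mulr_ge0.
  rewrite mulrC ltr_pM2l//; have : (n%:R : R) < n.+1%:R by rewrite ltr_nat.
  by lra.
pose X : R := \sum_k `|xi k|.
have hX k : `|xi k| <= X by rewrite /X (bigD1 k)//= lerDl sumr_ge0.
have X0 : 0 <= X by rewrite sumr_ge0.
pose C := 2 * m%:R * (n%:R * X) ^+ 2 + 1.
have C0 : 0 < C by rewrite ltr_wpDl// !mulr_ge0// exprn_ge0// mulr_ge0.
pose e' := e / C.
have e'0 : 0 < e' by rewrite divr_gt0.
pose Hq i j y := mollify_hess h g y i j.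
pose d' (e : R) := d (e * h ^+ 2 / 4).
have mH i j : has_modulus d' (Hq i j).
  move=> a a0; have a1 : 0 < a * h ^+ 2 / 4 by rewrite divr_gt0// mulr_gt0// exprn_gt0.
  have [d0 hd] := mg a1; split=> // x y xy.
  apply: le_trans (mollify_hess_dist i j h0 mg mg (e := a * h ^+ 2 / 4) _) _.
    by move=> z; apply: hd; rewrite opprD addrACA subrr addr0.
  by rewrite (_ : 4 * _ / _ = a)//; field; rewrite gt_eqF.
have d'e : 0 < d' e' by apply: (mg _).1; rewrite divr_gt0// mulr_gt0// exprn_gt0.
have X1 : 0 < X + 1 by rewrite ltr_wpDl.
exists (d' e' / (X + 1)); first exact: divr_gt0.
move=> t /andP[t0]; rewrite ltr_pdivlMr// => tX N.
have txi k : t * `|xi k| < d' e'.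
  apply: le_lt_trans tX; rewrite ler_wpM2l ?(ltW t0)//.
  by apply: le_trans (hX k) _; rewrite lerDl.
have tau0 : 0 < steptime t by rewrite divr_gt0// exprn_gt0.
pose V k := iter k (stepavg t) q.
pose HV k y := \matrix_(i, j) iter k (stepavg t) (Hq i j) y.
have CV k : exists G, C2_with (V k) G (HV k).
  exact: (C2_with_iter t k (C2_with_mollify mg h0)).
have HVsym k x : (HV k x)^T = HV k x.
  apply/matrixP => i j; rewrite !mxE; congr (iter k _ _ _); apply/funext => y.
  by rewrite /Hq -{1}(mollify_hess_sym h y mg) mxE.
have drop k x : (forall y, g y - V k.+1 y <= g x - V k.+1 x) ->
    steptime t * (c - e) <= V k.+1 x - V k x.
  move=> xmax; have [G1 C1] := CV k.+1.
  have cle := gc C1 (HVsym k.+1 x) xmax.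
  have [G C2] := CV k; have [s st ->] := stepavg_second_difference x t0 C2.
  rewrite ler_pM2l//.
  (* all iterates of the Hessian of [q] share one modulus of continuity, and one
     step of the walk changes each of them little *)
  have near_hess j : qf (HV k.+1 x) (xi j) - 2 * e' * (n%:R * X) ^+ 2 <=
      qf (HV k (x + s j *: xi j)) (xi j).
    have ent i i' : `|HV k.+1 x i i' - HV k (x + s j *: xi j) i i'| <= 2 * e'.
      rewrite !mxE /=; have mk := has_modulus_iter t k (mH i i').
      have := stepavg_close x t0 mk e'0 txi.
      have : `|iter k (stepavg t) (Hq i i') x -
          iter k (stepavg t) (Hq i i') (x + s j *: xi j)| <= e'.
        apply: (mk e' e'0).2; rewrite opprD addrA subrr add0r normrN normrZ.
        by apply: le_lt_trans (txi j); rewrite ler_wpM2r.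
      move=> h1 h2; rewrite (_ : 2 * e' = e' + e'); last by ring.
      by apply: le_trans (ler_distD (iter k (stepavg t) (Hq i i') x) _ _) (lerD h2 h1).
    have := qf_dist (xi j) ent; rewrite ler_norml => /andP[_ le1].
    have le2 : 2 * e' * (n%:R * `|xi j|) ^+ 2 <= 2 * e' * (n%:R * X) ^+ 2.
      have e2 : 0 <= 2 * e' by rewrite mulr_ge0// ltW.
      rewrite (ler_wpM2l e2)// ler_pXn2r ?nnegrE ?mulr_ge0//.
      by rewrite ler_wpM2l// hX.
    by rewrite lerBlDr -lerBlDl; apply: le_trans le1 le2.
  have : \sum_j (qf (HV k.+1 x) (xi j) - 2 * e' * (n%:R * X) ^+ 2) <=
      \sum_j qf (HV k (x + s j *: xi j)) (xi j) by apply: ler_sum => j _.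
  rewrite sumrB sumr_const card_ord -mulr_natr; apply: le_trans.
  have e'C : e' * C = e by rewrite divfK// gt_eqF.
  have : 2 * e' * (n%:R * X) ^+ 2 * m%:R <= e by rewrite -[leRHS]e'C /C; lra.
  by move: cle; move: (\sum_j _) => S; lra.
have supp k y : r + 2 * n%:R * h + k%:R * (t * X) < `|y| -> V k y = 0.
  have suppq z : r + 2 * n%:R * h < `|z| -> q z = 0.
    rewrite /q; have [u ule ->] := mollify_mean z (ltW h0) mg => rz.
    by apply: gr; have := lerB_normD z u; lra.
  by move: y; apply: iter_stepavg_support.
have main k x : g x <= V k x + del / 2 - k%:R * steptime t * (c - e).
  elim: k x => [|k IH] x.
    by rewrite !mul0r subr0 /V /=; have := qg x; rewrite ler_norml => /andP[]; lra.
  have [|y yr|x1 x1max] := @bounded_support_max (fun y => -1 * V k.+1 y + g y)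
      (r + 2 * n%:R * h + k.+1%:R * (t * X)).
  - have [G [cV _ _ _ _]] := CV k.+1.
    apply: continuous_addr; last exact: has_modulus_continuous mg.
    exact: continuous_mull.
  - rewrite supp// gr ?mulr0 ?addr0//; apply: le_lt_trans yr.
    by rewrite -addrA lerDl addr_ge0// !mulr_ge0// ltW.
  have x1max' y : g y - V k.+1 y <= g x1 - V k.+1 x1.
    by have := x1max y; rewrite !mulN1r !(addrC (- _)).
  have := drop k x1 x1max'; have := IH x1; have := x1max' x.
  rewrite -natr1; move: (V k.+1 x) (V k.+1 x1) (V k x1) => v1 v2 v3; lra.
move=> x; apply: le_trans (main N x) _; rewrite lerD2r.
have le1 : V N x <= iter N (stepavg t) g x + del / 2.
  rewrite -iter_stepavg_addc; apply: iter_stepavg_le => z.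
  by have := qg z; rewrite ler_norml => /andP[]; lra.
by rewrite [in leRHS](splitr del) addrA lerD2r.
Qed.

Lemma stepavg_dotp x0 t (a K : R) y :
  stepavg t (fun z => a + K * dotp (z - x0) (z - x0)) y =
  a + K * dotp (y - x0) (y - x0) + steptime t * (2 * K * \sum_k dotp (xi k) (xi k)).
Proof.
have e1 z : dotp (y + z - x0) (y + z - x0) =
    dotp (y - x0) (y - x0) + 2 * dotp z (y - x0) + dotp z z.
  rewrite (addrAC y); move: (y - x0) => u.
  by rewrite dotpDl !dotpDr (dotpC u z); ring.
rewrite /stepavg; under eq_bigr do rewrite !e1 !dotpNl dotpNr !dotpZl dotpZr.
set D := dotp (y - x0) (y - x0).
rewrite (eq_bigr (fun k => (2 * (a + K * D)) + (2 * K * t ^+ 2) * dotp (xi k) (xi k))).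
  rewrite big_split/= sumr_const card_ord -mulr_sumr -[_ *+ m]mulr_natr /steptime.
  by move: (\sum_k _) => S; field; rewrite pnatr_eq0 -lt0n.
by move=> k _; ring.
Qed.

(** Otherwise the Hessian of the mollification [f] of [g] violates the bound near
    [x0], and the walk started from [f] grows too slowly at [x0]: the estimate of
    [le_iter_stepavg] carries over from [g] to [f], as smoothing is monotone and
    commutes with the walk. *)
Lemma mollify_trace_ge (h : R) x0 : 0 < h ->
  c <= \sum_k qf (mollify_hess h g x0) (xi k).
Proof.
move=> h0; rewrite leNgt; apply/negP.
pose b y := \sum_k qf (mollify_hess h g y) (xi k); rewrite -/(b x0) => bc.
pose e := (c - b x0) / 5.
have e0 : 0 < e by rewrite divr_gt0// subr_gt0.
pose f := mollify h g.
have fC := C2_with_mollify mg h0; rewrite -/f in fC.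
pose S := \sum_k (n%:R * `|xi k|) ^+ 2.
have S0 : 0 <= S by rewrite sumr_ge0// => k _; rewrite sqr_ge0.
have S1 : 0 < S + 1 by rewrite ltr_wpDl.
pose a1 := e * h ^+ 2 / (4 * (S + 1)).
have a10 : 0 < a1 by rewrite divr_gt0// mulr_gt0// exprn_gt0.
have a1E : 4 * a1 / h ^+ 2 = e / (S + 1).
  by rewrite /a1; field; rewrite !gt_eqF.
have [rb0 hrb] := mg a10; set rb := d a1 in rb0 hrb.
have H_dist y1 y2 i j : `|y1 - y2| < rb ->
    `|mollify_hess h g y1 i j - mollify_hess h g y2 i j| <= e / (S + 1).
  move=> yy; rewrite -a1E; apply: mollify_hess_dist mg mg _ => // z.
  by apply: hrb; rewrite opprD addrACA subrr addr0.
have e_sum (F1 F2 : 'I_m -> R) (a : R) :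
    (forall k, `|F1 k - F2 k| <= a * (n%:R * `|xi k|) ^+ 2) ->
    \sum_k F1 k <= \sum_k F2 k + a * S.
  move=> hF; rewrite /S mulr_sumr -big_split/=; apply: ler_sum => k _.
  by have := hF k; rewrite ler_norml => /andP[_]; lra.
have eS : e / (S + 1) * S <= e.
  by rewrite mulrAC ler_pdivrMr// ler_wpM2l ?(ltW e0)// lerDl.
have b_near y : `|y - x0| < rb -> b y <= b x0 + e.
  move=> yx; apply: le_trans (e_sum _ (fun k => qf (mollify_hess h g x0) (xi k)) _ _) _.
    by move=> k; apply: qf_dist => i j; exact: H_dist yx.
  by rewrite lerD2l.
have [B B0 gB] : exists2 B : R, 0 <= B & forall y, `|g y| <= B.
  have cg := has_modulus_continuous mg.
  have [x1 h1] := bounded_support_max cg gr.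
  have [|y yr|x2 h2] := @bounded_support_max (fun y => -1 * g y) r.
  - exact: continuous_mull.
  - by rewrite gr// mulr0.
  exists (`|g x1| + `|g x2|); first exact: addr_ge0.
  move=> y; rewrite ler_norml; have := h1 y; have := h2 y.
  have := ler_norm (g x1); have := ler_norm (- g x2); rewrite normrN.
  by have := normr_ge0 (g x1); have := normr_ge0 (g x2); lra.
pose B' := 4 * (2 * B) / h ^+ 2 * S.
have B'0 : 0 <= B'.
  by rewrite mulr_ge0// divr_ge0 ?exprn_ge0 ?(ltW h0)// !mulr_ge0.
have b_far y : b y <= b x0 + B'.
  apply: e_sum => k; apply: qf_dist => i j; apply: mollify_hess_dist mg mg _ => // z.
  by apply: le_trans (ler_normB _ _) _; have := gB (y + z); have := gB (x0 + z); lra.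
pose K := B' / rb ^+ 2.
have K0 : 0 <= K by rewrite divr_ge0// exprn_ge0// ltW.
(* the rate [b] is nearly at most [b x0] close to [x0]; elsewhere it is bounded, and
   the quadratic term makes up for the difference *)
have b_le y : b y <= b x0 + e + K * dotp (y - x0) (y - x0).
  have [yx|yx] := ltrP `|y - x0| rb.
    by have := b_near y yx; have := mulr_ge0 K0 (dotp_ge0 (y - x0)); lra.
  have : B' <= K * dotp (y - x0) (y - x0).
    rewrite -[leLHS](@divfK _ (rb ^+ 2)) ?gt_eqF ?exprn_gt0// -/K ler_wpM2l//.
    apply: le_trans (norm_sqr_le_dotp _).
    by rewrite ler_pXn2r ?nnegrE ?(ltW rb0).
  by have := b_far y; lra.
pose X : R := \sum_k `|xi k|.
have hX k : `|xi k| <= X by rewrite /X (bigD1 k)//= lerDl sumr_ge0.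
have X0 : 0 <= X by rewrite sumr_ge0.
have X1 : 0 < X + 1 by rewrite ltr_wpDl.
have step t y : 0 < t -> t * (X + 1) < rb -> stepavg t f y - f y <= steptime t * (b y + e).
  move=> t0 tX; have [s st ->] := stepavg_second_difference y t0 fC.
  have tau0 : 0 < steptime t by rewrite divr_gt0// exprn_gt0.
  rewrite ler_pM2l//; apply: le_trans (e_sum _ (fun k => qf (mollify_hess h g y) (xi k)) _ _) _.
    move=> k; apply: qf_dist => i j; apply: H_dist.
    rewrite addrAC subrr add0r normrZ; apply: le_lt_trans tX.
    by apply: ler_pM => //; apply: le_trans (hX k) _; rewrite lerDl.
  by rewrite lerD2l.
pose C1 := 2 * K * \sum_k dotp (xi k) (xi k).
have C10 : 0 <= C1.
  apply: mulr_ge0; first exact: mulr_ge0.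
  by apply: sumr_ge0 => k _; exact: dotp_ge0.
pose Psi y := b x0 + 2 * e + K * dotp (y - x0) (y - x0).
have walk t k y : 0 < t -> t * (X + 1) < rb ->
    iter k (stepavg t) f y <= f y + k%:R * steptime t * (Psi y + k%:R * steptime t * C1).
  move=> t0 tX; have tau0 : 0 < steptime t by rewrite divr_gt0// exprn_gt0.
  elim: k y => [|k IH] y; first by rewrite !mul0r addr0.
  set kt := k%:R * steptime t; have kt0 : 0 <= kt by rewrite mulr_ge0// ltW.
  have -> : k.+1%:R * steptime t = kt + steptime t by rewrite -natr1 mulrDl mul1r.
  have E1 : iter k.+1 (stepavg t) f y <=
      stepavg t (fun z => 1 * f z + (kt * (b x0 + 2 * e + kt * C1) + kt * K * dotp (z - x0) (z - x0))) y.
    rewrite /=; apply: stepavg_le => z; apply: le_trans (IH z) _.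
    by rewrite -/kt /Psi le_eqVlt; apply/orP; left; apply/eqP; ring.
  apply: le_trans E1 _; rewrite stepavg_linear stepavg_dotp mul1r.
  have E2 := step t y t0 tX; have E3 := b_le y.
  have E4 : steptime t * (b y + e) <= steptime t * Psi y.
    by rewrite ler_pM2l// /Psi; lra.
  have E5 : 0 <= (kt + steptime t) * steptime t * C1.
    exact: mulr_ge0 (mulr_ge0 (addr_ge0 kt0 (ltW tau0)) (ltW tau0)) C10.
  have -> : steptime t * (2 * (kt * K) * \sum_k0 dotp (xi k0) (xi k0)) = kt * steptime t * C1.
    by rewrite /C1; ring.
  rewrite (_ : kt * _ + _ = kt * Psi y + kt * kt * C1); last by rewrite /Psi; ring.
  move: (Psi y) (stepavg t f y) (f y) E2 E4 E5 => P0 f1 f2 E2 E4 E5.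
  rewrite -subr_ge0.
  have -> : f2 + (kt + steptime t) * (P0 + (kt + steptime t) * C1) -
    (f1 + (kt * P0 + kt * kt * C1 + kt * steptime t * C1)) =
    (steptime t * P0 - (f1 - f2)) + (kt + steptime t) * steptime t * C1 by ring.
  by lra.
(* up to the time [s] the quadratic term contributes less than [e] to the rate *)
pose s := e / (C1 + 1).
have C11 : 0 < C1 + 1 by rewrite ltr_wpDl.
have s0 : 0 < s by rewrite divr_gt0.
have del0 : 0 < s * e / 4 by rewrite divr_gt0// mulr_gt0.
have [t0 t00 ht0] := le_iter_stepavg e0 del0.
pose t := Num.min (t0 / 2) (Num.min (rb / (X + 2)) (Num.min 1 (s / 2))).
have X2 : 0 < X + 2 by rewrite ltr_wpDl.
have t_gt0 : 0 < t.
  by rewrite /t !lt_min; apply/and4P; split; rewrite ?ltr01//; exact: divr_gt0.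
have : t <= t by [].
rewrite {2}/t !le_min => /and4P[tt0 trb t1 ts].
have tX : t * (X + 1) < rb.
  move: trb; rewrite ler_pdivlMr//; apply: lt_le_trans.
  by rewrite ltr_pM2l// ltrD2l ltr1n.
have tau0 : 0 < steptime t by rewrite divr_gt0// exprn_gt0.
have tau_s : steptime t <= s / 2.
  apply: le_trans ts; rewrite /steptime ler_pdivrMr// expr2 ler_wpM2l ?(ltW t_gt0)//.
  have : (1 : R) <= m%:R by rewrite ler1n.
  by lra.
have st0 : 0 <= s / steptime t by rewrite divr_ge0// ltW.
have /andP[N1 N2] := truncn_itv st0; set N := Num.truncn _ in N1 N2.
rewrite ler_pdivlMr// in N1; rewrite ltr_pdivrMr// -natr1 mulrDl mul1r in N2.
have Nle : s / 2 <= N%:R * steptime t by lra.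
(* smooth the estimate for [g]; the walk and the smoothing commute *)
have low : f x0 <= iter N (stepavg t) f x0 + s * e / 4 - N%:R * steptime t * (c - e).
  have tt : 0 < t < t0 by lra.
  pose w z := 1 * iter N (stepavg t) g z + (s * e / 4 - N%:R * steptime t * (c - e)).
  have mN := has_modulus_iter t N mg.
  have mc a : has_modulus (fun=> 1) (fun _ : 'rV[R]_n => a : R).
    by move=> ? ?; split=> // *; rewrite subrr normr0 ltW.
  have : mollify h g x0 <= mollify h w x0.
    have mw : has_modulus d w.
      move=> a a0; have [d0 hd] := mN a a0; split=> // y z yz.
      by rewrite /w !mul1r opprD addrACA subrr addr0; exact: hd.
    apply: smooth_le mg mw _ => y; rewrite /w mul1r addrA.
    exact: ht0.
  rewrite /w /mollify (smooth_linear _ _ mN (mc _)) mul1r smooth_cst.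
  by rewrite (smooth_iter _ _ _ mg) addrA.
have up := walk t N x0 t_gt0 tX.
rewrite /Psi subrr dotp0r mulr0 addr0 in up.
have sC : N%:R * steptime t * C1 <= e.
  apply: (@le_trans _ _ (s * C1)); first by rewrite ler_wpM2r.
  by rewrite /s mulrAC ler_pdivrMr// ler_wpM2l ?(ltW e0)// lerDl.
have bce : c - e = b x0 + 4 * e by rewrite /e; field.
move: low up; rewrite bce; move: (iter _ _ _ _) (f x0) => F1 F0 low up.
have A : N%:R * steptime t * (b x0 + 4 * e) - s * e / 4 <=
  N%:R * steptime t * (b x0 + 2 * e + N%:R * steptime t * C1) by lra.
have A2 : N%:R * steptime t * (b x0 + 2 * e + N%:R * steptime t * C1) <=
  N%:R * steptime t * (b x0 + 3 * e).
  by rewrite ler_wpM2l ?mulr_ge0 ?(ltW tau0)//; lra.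
have A3 : s / 2 * e <= N%:R * steptime t * e by rewrite ler_wpM2r ?(ltW e0).
have A4 : 0 < s * e by rewrite mulr_gt0.
move: (N%:R * steptime t) A A2 A3 => T; nra.
Qed.
End Bound.

End Heat.

Section MollifyDet.
Context {R : realType} {n : nat}.
Implicit Types (g : 'rV[R]_n -> R) (x : 'rV[R]_n).

(** The determinant bound is a family of linear ones, each of which survives
    mollification. *)
Lemma mollify_det_ge g (d : R -> R) (r K c : R) :
  (0 < n)%N -> has_modulus d g -> (forall y, r < `|y| -> g y = 0) -> 0 <= c ->
  (forall phi G H x, C2_with phi G H -> (H x)^T = H x ->
    (forall y, g y - phi y <= g x - phi x) ->
    psd (H x + K%:M) /\ c ^+ n <= \det (H x + K%:M)) ->
  forall h x, 0 < h -> psd (mollify_hess h g x + K%:M) /\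
    forall s, 0 < s -> (c + s) ^+ n <= \det (mollify_hess h g x + K%:M + s%:M).
Proof.
move=> n0 mg gr c0 test h x h0.
have pA : psd (mollify_hess h g x + K%:M).
  split; first by rewrite linearD/= tr_scalar_mx (mollify_hess_sym _ _ mg).
  move=> z; rewrite -/(qf _ _) qfDl qf_scalar.
  pose xi (k : 'I_1) := z.
  have : touching_trace_ge xi g (- (K * dotp z z)).
    move=> phi G H y C2 sH ymax; rewrite big_ord1.
    have [pH _] := test _ _ _ _ C2 sH ymax.
    by have := psd_qf z pH; rewrite qfDl qf_scalar; lra.
  move=> tz; have := mollify_trace_ge (ltn0Sn 0) mg gr tz x h0.
  by rewrite big_ord1; lra.
split=> // s s0; apply: det_ge_of_mxtrace_conj => // X mu mu0 emu.
set k0 := K * \sum_k dotp (row k X) (row k X).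
have sumE (A : 'M[R]_n) : \sum_k qf (A + K%:M) (row k X) = \sum_k qf A (row k X) + k0.
  rewrite /k0 mulr_sumr -big_split/=; apply: eq_bigr => k _.
  by rewrite qfDl qf_scalar.
rewrite sumE -lerBlDr.
apply: (mollify_trace_ge n0 mg gr) => // phi G H y C2 sH ymax.
have [pH dH] := test _ _ _ _ C2 sH ymax.
by rewrite lerBlDr -sumE; exact: det_le_mxtrace_conj.
Qed.

End MollifyDet.

(** * Convexity from touching paraboloids *)

Section Usc.
Context {R : realType} {T : topologicalType}.

Definition usc_on (S : set T) (f : T -> R) := forall x, S x -> forall c, f x < c ->
  \forall y \near x, S y -> f y < c.

(** Near each point of [S] the function stays below a constant, so by compactness
    it is bounded on [S]. Were the supremum not attained, these constants could be
    chosen below it, and the same argument would give a smaller upper bound. *)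
Lemma usc_max (S : set T) (f : T -> R) : compact S -> S !=set0 -> usc_on S f ->
  exists2 x, S x & forall y, S y -> f y <= f x.
Proof.
move=> /compact_near_coveringP/near_covering_withinP cS [x0 Sx0] uf.
have [M ubM] : exists M, forall y, S y -> f y <= M.
  have := cS R +oo (fun c y => f y < c) _ _; case=> [x Sx|M [_ hM]].
    exists ([set y | S y -> f y < f x + 1], [set c | f x + 1 < c]).
      split; first by apply: uf => //; rewrite ltrDl.
      by exists (f x + 1); split; [exact: num_real|].
    by case=> y c /= [h1 h2] Sy; apply: lt_trans (h1 Sy) h2.
  by exists (M + 1) => y Sy; apply: ltW; apply: hM => //; rewrite ltrDl.
have hs : has_sup (f @` S).
  by split; [exists (f x0), x0|exists M => _ [y Sy <-]; exact: ubM].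
pose s := sup (f @` S); have le_s y : S y -> f y <= s.
  by move=> Sy; apply: sup_upper_bound => //; exists y.
apply: contrapT => nmax.
have lt_s y : S y -> f y < s.
  move=> Sy; rewrite lt_neqAle le_s// andbT; apply/eqP => fys.
  by apply: nmax; exists y => // z Sz; rewrite fys le_s.
have := cS R s^'- (fun c y => f y < c) _ _; case=> [x Sx|c c0 hc].
  exists ([set y | S y -> f y < (f x + s) / 2], [set c | (f x + s) / 2 < c]).
    have := lt_s x Sx => fxs.
    split; first by apply: uf => //; lra.
    by apply: nbhs_left_gt; lra.
  by case=> y c /= [h1 h2] Sy; apply: lt_trans (h1 Sy) h2.
have : s <= s - c / 2.
  apply: ge_sup; first by exists (f x0), x0.
  move=> _ [y Sy <-]; apply: ltW; apply: hc => //.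
    rewrite /ball_ /= opprB addrC subrK gtr0_norm ?divr_gt0//.
    by move: c0 => /= c0; rewrite ltr_pdivrMr// ltr_pMr// ltr1n.
  by rewrite gtrBl divr_gt0.
by move: c0 => /= c0; lra.
Qed.

End Usc.

Section Convexity.
Context {R : realType} {n : nat}.
Implicit Types (U : 'rV[R]_n -> R) (a b d v w x y z : 'rV[R]_n).

Lemma continuous_quad (A : 'M[R]_n) p x (c : R) : A^T = A -> continuous (quad A p x c).
Proof. by move=> sA; have [] := C2_with_quad p x c sA. Qed.

Lemma near_lt (f : 'rV[R]_n -> R) x (c : R) : continuous f -> f x < c ->
  nbhs x [set y | f y < c].
Proof.
move=> cf fxc; have e0 : 0 < c - f x by rewrite subr_gt0.
have e2 : 0 < (c - f x) / 2 by rewrite divr_gt0.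
have /continuous_epsP/(_ _ e2)[r r0 hr] := cf x.
apply/(@nbhs_normP R 'rV[R]_n x); exists r => // y; rewrite /ball_ /= distrC => yr.
have := hr _ yr; rewrite addrCA subrr addr0 ler_norml; lra.
Qed.

Lemma near_gt (f : 'rV[R]_n -> R) x (c : R) : continuous f -> c < f x ->
  nbhs x [set y | c < f y].
Proof.
move=> cf fxc; have := @near_lt (fun y => -1 * f y) x (- c) (continuous_mull cf).
rewrite mulN1r ltrN2 => /(_ fxc); apply: filterS => y /=.
by rewrite mulN1r ltrN2.
Qed.

Lemma near_in_ball x y (r : R) : `|y - x| < r -> nbhs y [set z | `|z - x| < r].
Proof.
move=> yx; apply/(@nbhs_normP R 'rV[R]_n y); exists (r - `|y - x|).
  by rewrite /= subr_gt0.
move=> z; rewrite /ball_ /= distrC => yz; have := ler_normD (z - y) (y - x).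
by rewrite addrA subrK; lra.
Qed.

(** The form [|d|^2 - d^T d] measures the distance to the line spanned by [d]. *)
Lemma gram_identity d w : dotp d d != 0 ->
  qf ((dotp d d)%:M - d^T *m d) w =
  dotp d d * dotp (w - (dotp w d / dotp d d) *: d) (w - (dotp w d / dotp d d) *: d).
Proof.
move=> d0; rewrite qfBl qf_scalar qf_rank1 !dotpBl !dotpBr !dotpZl !dotpZr.
rewrite (dotpC d w); move: (dotp w d) (dotp w w) (dotp d d) d0 => P Q N N0.
by field.
Qed.

(** A function that no paraboloid with a direction of strict concavity touches
    from above is convex: were it above a chord, it would be touched from above by
    a paraboloid that is slightly concave along the chord and very convex across
    it. *)
Lemma convex_of_touching U x0 (r : R) :
  usc_on [set y | `|y - x0| <= r] U ->
  (forall (A : 'M[R]_n) p x c y, A^T = A -> `|y - x0| < r ->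
     (\forall z \near y, U z <= quad A p x c z) -> U y = quad A p x c y ->
     forall v, 0 <= qf A v) ->
  forall a b (l : R), `|a - x0| < r -> `|b - x0| < r -> 0 <= l <= 1 ->
    U (a + l *: (b - a)) <= U a + l * (U b - U a).
Proof.
move=> uU test a b l ar br l01; rewrite leNgt; apply/negP => above.
set x1 := a + _ in above; pose d := b - a.
pose gam := U x1 - (U a + l * (U b - U a)).
have gam0 : 0 < gam by rewrite subr_gt0.
have d0 : d != 0.
  apply/eqP => dz; move: above; rewrite /x1 -/d dz scaler0 addr0.
  by have : b = a by [apply/eqP; rewrite -subr_eq0 -/d dz]; move=> ->; rewrite subrr mulr0; lra.
pose N := dotp d d.
have N0 : 0 < N.
  by rewrite lt_neqAle dotp_ge0 andbT eq_sym; apply: contra_neq d0; exact: dotp_eq0.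
pose del := gam / 4.
pose Rm : 'M[R]_n := N%:M - d^T *m d.
have sR : Rm^T = Rm by rewrite linearB/= tr_scalar_mx trmx_mul trmxK.
(* concave along [d], with coefficient [k] across it *)
pose A k : 'M[R]_n := k *: Rm - (del / N ^+ 2) *: (d^T *m d).
have sA k : (A k)^T = A k by rewrite /A linearB !linearZ/= sR trmx_mul trmxK.
pose p := ((U b - U a + del) / N) *: d.
pose psi k := quad (A k) p a (U a + gam / 4).
pose sig y := dotp (y - a) d / N.
pose Rr y := qf Rm (y - a).
pose base y := U a + gam / 4 + (U b - U a + del) * sig y - del * sig y ^+ 2.
have psiE k y : psi k y = base y + k * Rr y.
  rewrite /psi /quad /base /sig /Rr /A qfBl !qfZl qf_rank1 /p dotpZl (dotpC d).
  by field; rewrite gt_eqF.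
have RrE y : Rr y = N * dotp (y - a - sig y *: d) (y - a - sig y *: d).
  by apply: gram_identity; rewrite gt_eqF.
have Rr0 y : 0 <= Rr y by rewrite RrE mulr_ge0 ?dotp_ge0// ltW.
have csig : continuous sig.
  have -> : sig = quad 0 (N^-1 *: d) a 0.
    apply/funext => y; rewrite /quad add0r dotpZl /sig dotpC mulrC.
    by rewrite /qf mulmx0 mul0mx mxE addr0.
  by apply: continuous_quad; rewrite trmx0.
have cRr : continuous Rr.
  have -> : Rr = quad Rm 0 a 0 by apply/funext => y; rewrite /quad dotp0l !add0r.
  exact: continuous_quad.
have cbase : continuous base.
  have -> : base = psi 0 by apply/funext => y; rewrite psiE mul0r addr0.
  exact: continuous_quad.
pose S := [set y | `|y - x0| <= r] `&` [set y | 0 <= sig y <= 1].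
have cS : compact S.
  apply: compact_closedI; first exact: compact_ball.
  rewrite (_ : [set y | _] = (sig @^-1` [set t | 0 <= t]) `&` (sig @^-1` [set t | t <= 1])).
    by apply: closedI; apply: closed_comp => [y _|]; try exact: csig;
      [exact: closed_ge|exact: closed_le].
  by apply/seteqP; split=> y /= => [/andP[]|[-> ->]].
have uS : usc_on S U.
  move=> y [yr _] e ye; apply: filterS (uU y yr e ye) => z h [zr _]; exact: h.
have sigE t : sig (a + t *: d) = t.
  by rewrite /sig addrAC subrr add0r dotpZl mulfK// gt_eqF.
have RrE0 t : Rr (a + t *: d) = 0.
  by rewrite RrE sigE (addrAC a) subrr add0r subrr dotp0l mulr0.
have segr t : 0 <= t <= 1 -> `|a + t *: d - x0| < r.
  move=> t01; have -> : a + t *: d - x0 = (1 - t) *: (a - x0) + t *: (b - x0).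
    by apply/rowP => i; rewrite !mxE; ring.
  apply: le_lt_trans (ler_normD _ _) _; rewrite !normrZ !ger0_norm; try lra.
  have [t1|t1] := eqVneq t 1; first by rewrite t1 subrr mul0r mul1r add0r.
  have : (1 - t) * `|a - x0| < (1 - t) * r by rewrite ltr_pM2l// subr_gt0 lt_neqAle t1; lra.
  have : t * `|b - x0| <= t * r by rewrite ler_wpM2l; lra.
  by lra.
have Sx1 : S x1 by split; [apply: ltW; exact: segr|rewrite /= /x1 -/d sigE].
have [yM SyM UM] := usc_max cS (ex_intro _ x1 Sx1) uS.
pose B := `|U a + gam / 4| + `|U b - U a + del| + del.
have base_ge y : 0 <= sig y <= 1 -> - B <= base y.
  move=> s01; rewrite /base /B.
  have : `|(U b - U a + del) * sig y| <= `|U b - U a + del|.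
    by rewrite normrM ler_piMr// ger0_norm; lra.
  have : del * sig y ^+ 2 <= del by rewrite ler_piMr ?exprn_ile1//; rewrite /del; lra.
  have := ler_norm (- (U a + gam / 4)); rewrite normrN ler_norml.
  by lra.
(* for large [k] the maximum is attained near the chord, and the heights at the
   endpoints keep it away from these *)
have near_interior : \forall k \near +oo, S `<=` (fun y => 0 < U y - psi k y ->
    `|y - x0| < r /\ 0 < sig y < 1).
  have /compact_near_coveringP/near_covering_withinP cov := cS.
  apply: (cov R +oo (fun k y => 0 < U y - psi k y -> `|y - x0| < r /\ 0 < sig y < 1)).
  move=> y Sy; have [Ry|Ry] := eqVneq (Rr y) 0; last first.
    have Ryp : 0 < Rr y by rewrite lt_neqAle eq_sym Ry Rr0.
    have Ry2 : Rr y / 2 < Rr y by rewrite ltr_pdivrMr// ltr_pMr// ltr1n.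
    pose k0 := (`|U yM| + B) / (Rr y / 2).
    exists ([set z | Rr y / 2 < Rr z], [set k | Num.max 0 k0 < k]).
      split; first exact: near_gt.
      by exists (Num.max 0 k0); split; [exact: num_real|].
    case=> z k /= [hz]; rewrite gt_max => /andP[k_gt0 hk] Sz.
    rewrite psiE => val; exfalso.
    have h1 := UM z Sz; have h2 := base_ge z Sz.2; have h3 := ler_norm (U yM).
    rewrite ltr_pdivrMr in hk; last by rewrite divr_gt0.
    have h4 : k * (Rr y / 2) < k * Rr z by rewrite ltr_pM2l.
    by lra.
  have yE : y = a + sig y *: d.
    have := RrE y; rewrite Ry => /esym/eqP; rewrite mulf_eq0 (gt_eqF N0) /= => /eqP.
    by move=> /dotp_eq0/eqP; rewrite subr_eq0 subr_eq addrC => /eqP.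
  have endpoint : U y + gam / 4 <= base y -> \forall z \near y & k \near +oo,
      S z -> 0 < U z - psi k z -> `|z - x0| < r /\ 0 < sig z < 1.
    move=> byE; have n1 : U y < U y + gam / 8 by rewrite ltrDl divr_gt0.
    have n2 : U y + gam / 8 < base y by lra.
    exists ([set z | (S z -> U z < U y + gam / 8) /\ U y + gam / 8 < base z], [set k | 0 < k]).
      split; first by apply: filterS2 (uS y Sy _ n1) (near_gt cbase n2).
      by exists 0; split; [exact: num_real|].
    case=> z k /= [[h1 h2] k0] Sz; rewrite psiE => val; exfalso.
    by have := h1 Sz; have := mulr_ge0 (ltW k0) (Rr0 z); lra.
  have [s0|s0] := eqVneq (sig y) 0.
    apply: endpoint; have ya : y = a by rewrite yE s0 scale0r addr0.
    by rewrite /base s0 ya; lra.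
  have [s1|s1] := eqVneq (sig y) 1.
    apply: endpoint; have yb : y = b by rewrite yE s1 scale1r /d addrC subrK.
    by rewrite /base s1 yb; lra.
  have s01 : 0 < sig y < 1 by rewrite !lt_neqAle eq_sym s0 s1; have [_ /andP[-> ->]] := Sy.
  have yr : `|y - x0| < r by rewrite yE; apply: segr; have [] := Sy.
  have /andP[p1 p2] := s01.
  exists ([set z | `|z - x0| < r /\ 0 < sig z < 1], setT).
    split; last exact: filterT.
    apply: filterS3 (near_in_ball yr) (near_gt csig p1) (near_lt csig p2) => z /= z1 z2 z3.
    by split=> //; rewrite z2.
  by case=> z k /= [].
have [k hk] : exists k, S `<=` (fun y => 0 < U y - psi k y ->
    `|y - x0| < r /\ 0 < sig y < 1).
  by case: near_interior => M [_ hM]; exists (M + 1); apply: hM; rewrite ltrDl.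
have cpsi : continuous (psi k) by exact: continuous_quad.
have uSp : usc_on S (fun y => U y - psi k y).
  move=> y Sy e ye; pose e2 := (e - (U y - psi k y)) / 2.
  have e20 : 0 < e2 by rewrite divr_gt0// subr_gt0.
  have n1 : U y < U y + e2 by rewrite ltrDl.
  have n2 : psi k y - e2 < psi k y by rewrite gtrDl oppr_lt0.
  apply: filterS2 (uS y Sy _ n1) (near_gt cpsi n2) => z h1 h2 Sz.
  by have := h1 Sz; rewrite /= in h2; rewrite /e2 in h2 *; lra.
have [y Sy ymax] := usc_max cS (ex_intro _ x1 Sx1) uSp.
have val1 : 0 < U x1 - psi k x1.
  rewrite psiE /x1 -/d RrE0 mulr0 addr0 /base sigE -/x1.
  have : l * (1 - l) <= 1 by nra.
  have del0 : 0 <= del by rewrite divr_ge0// ltW.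
  move=> /(ler_piMr del0) h1.
  have -> : U x1 - (U a + gam / 4 + (U b - U a + del) * l - del * l ^+ 2) =
      gam * (3 / 4) - del * (l * (1 - l)) by rewrite /gam; field.
  by have : del = gam / 4 by []; move: (del * (l * (1 - l))) h1 => T; lra.
have [yr ys] := hk y Sy (lt_le_trans val1 (ymax x1 Sx1)).
have := test (A k) p a (U a + gam / 4 + (U y - psi k y)) y (sA k) yr.
have quadC z : quad (A k) p a (U a + gam / 4 + (U y - psi k y)) z = psi k z + (U y - psi k y).
  by rewrite /psi /quad; ring.
move=> tst; have near_y : \forall z \near y,
    U z <= quad (A k) p a (U a + gam / 4 + (U y - psi k y)) z.
  have /andP[s1 s2] := ys.
  apply: filterS3 (near_in_ball yr) (near_gt csig s1) (near_lt csig s2) => z /= z1 z2 z3.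
  rewrite quadC; have Sz : S z by split; rewrite /= ?ltW// z2.
  by have := ymax z Sz; lra.
have eq_y : U y = quad (A k) p a (U a + gam / 4 + (U y - psi k y)) y.
  by rewrite quadC; ring.
have d' := tst near_y eq_y.
have := d' d; rewrite /A qfBl !qfZl qf_rank1 -/N.
have -> : qf Rm d = 0.
  have := RrE0 1; rewrite /Rr scale1r addrAC subrr add0r => ->//.
rewrite mulr0 sub0r divfK ?expf_neq0 ?gt_eqF//.
by rewrite /del; lra.
Qed.

End Convexity.

(** * Convex functions *)

Section ConvexNear.
Context {R : realType} {n : nat}.
Implicit Types (U phi : 'rV[R]_n -> R) (v w x y z : 'rV[R]_n).

Definition convex_near U x0 (r : R) := forall a b (l : R),
  `|a - x0| < r -> `|b - x0| < r -> 0 <= l <= 1 ->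
  U (a + l *: (b - a)) <= U a + l * (U b - U a).

(** Upper semicontinuity bounds [U (y + w)] and [U (y - w)] from above, and convexity
    at the midpoint [y] turns the latter bound into one from below. *)
Lemma usc_convex_continuous U x0 (r : R) y :
  usc_on [set y | `|y - x0| < r] U -> convex_near U x0 r -> `|y - x0| < r ->
  {for y, continuous U}.
Proof.
move=> uU cU yr; apply/continuous_epsP => e e0.
have n1 : U y < U y + e by rewrite ltrDl.
have /(@nbhs_normP R 'rV[R]_n y)[r1 r10 h1] := uU y yr _ n1.
have /(@nbhs_normP R 'rV[R]_n y)[r2 r20 h2] := near_in_ball yr.
exists (Num.min r1 r2); first by rewrite lt_min r10.
move=> w; rewrite lt_min => /andP[w1 w2].
have inr z : `|z| < r2 -> `|y + z - x0| < r.
  by move=> zr; apply: h2; rewrite /ball_ /= opprD addrA subrr sub0r normrN.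
have lt1 z : `|z| < r1 -> `|z| < r2 -> U (y + z) < U y + e.
  move=> zr1 zr2; apply: h1; last exact: inr.
  by rewrite /ball_ /= opprD addrA subrr sub0r normrN.
have A := lt1 w w1 w2; have B := lt1 (- w).
rewrite normrN in B; have {}B := B w1 w2.
have := cU (y - w) (y + w) (1 / 2).
rewrite inr ?normrN// inr// => /(_ isT isT).
have -> : y - w + (1 / 2) *: (y + w - (y - w)) = y.
  by apply/rowP => i; rewrite !mxE; field.
by rewrite ler_norml => /(_ _)C; have := C _; lra.
Qed.

(** By convexity the slope of [U] between [y - t *: v] and [y] is at most that
    between [y] and [y + v], and for small [t] it is nearly at least [dotp (G y) v]. *)
Lemma touching_subgradient U phi G H x0 (r : R) y v :
  convex_near U x0 r -> C2_with phi G H -> `|y - x0| < r -> `|y + v - x0| < r ->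
  (\forall z \near y, U z <= phi z) -> U y = phi y ->
  U y + dotp (G y) v <= U (y + v).
Proof.
move=> cU C2 yr yvr nU Uy.
rewrite -subr_ge0 -(pmulr_rge0 _ (ltr0Sn _ 0)) leNgt; apply/negP; rewrite mul1r => neg.
pose e := - (U (y + v) - (U y + dotp (G y) v)) / 2.
have e0 : 0 < e by rewrite /e; lra.
have /is_deriveP/(_ e e0)[r1 r10 h1] := C2_with_line C2 y (- v) 0.
rewrite scale0r addr0 dotpNr in h1.
have /(@nbhs_normP R 'rV[R]_n y)[r2 r20 h2] := near_in_ball yr.
have /(@nbhs_normP R 'rV[R]_n y)[r3 r30 h3] := nU.
have v1 : 0 < `|v| + 1 by rewrite ltr_wpDl.
pose t := Num.min (Num.min 1 (r1 / 2)) (Num.min (r2 / (`|v| + 1)) (r3 / (`|v| + 1))) / 2.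
have mn0 : 0 < Num.min (Num.min 1 (r1 / 2)) (Num.min (r2 / (`|v| + 1)) (r3 / (`|v| + 1))).
  by rewrite !lt_min ltr01 !divr_gt0.
have t0 : 0 < t by rewrite divr_gt0.
have : t < t * 2 by rewrite ltr_pMr// ltr1n.
rewrite {2}/t divfK// !lt_min => /andP[/andP[t1 tr1] /andP[]].
rewrite !ltr_pdivlMr// => tr2 tr3.
have tv b : t * (`|v| + 1) < b -> `|y - (y - t *: v)| < b.
  move=> tb; rewrite opprB addrC subrK normrZ gtr0_norm//; apply: le_lt_trans tb.
  by rewrite ler_pM2l// lerDl.
have Ut : U (y - t *: v) <= phi (y - t *: v) by apply: h3; exact: tv.
have yt : `|y - t *: v - x0| < r by apply: h2; exact: tv.
have := h1 t; rewrite gtr0_norm// => /(_ _)h1'.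
have {}h1' : `|phi (y + (0 + t%:A) *: - v) - phi y - t * - dotp (G y) v| <= e * t.
  by apply: h1'; lra.
move: h1'; rewrite add0r [t%:A]mulr1 scalerN ler_norml => /andP[_ h1'].
have t1' : 0 <= t / (1 + t) <= 1.
  have t11 : 0 < 1 + t by rewrite addr_gt0.
  rewrite divr_ge0 ?(ltW t0) ?(ltW t11)//= ler_pdivrMr// mul1r.
  by rewrite lerDr.
have := cU (y - t *: v) (y + v) (t / (1 + t)) yt yvr t1'.
have -> : y - t *: v + (t / (1 + t)) *: (y + v - (y - t *: v)) = y.
  by apply/rowP => i; rewrite !mxE; field; rewrite gt_eqF// addr_gt0.
move=> cv.
have {}cv : (1 + t) * U y <= U (y - t *: v) + t * U (y + v).
  have : (1 + t) * U y <= (1 + t) * (U (y - t *: v) + t / (1 + t) * (U (y + v) - U (y - t *: v))).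
    by rewrite ler_pM2l// addr_gt0.
  congr (_ <= _); field; rewrite gt_eqF// addr_gt0//.
have : t * (U y + dotp (G y) v - e) <= t * U (y + v) by lra.
by rewrite ler_pM2l// /e; lra.
Qed.

Lemma norm_le_axis x (r E : R) : 0 < r ->
  (forall i, dotp x (r *: delta_mx 0 i) <= E) ->
  (forall i, dotp x (- (r *: delta_mx 0 i)) <= E) -> 0 <= E -> `|x| <= E / r.
Proof.
move=> r0 h1 h2 E0; rewrite rV_norm_le ?divr_ge0 ?(ltW r0)//; apply/forallP => i.
have := h1 i; have := h2 i; rewrite dotpNr dotpZr dotp_delta => a b.
by rewrite ler_norml -mulNr ler_pdivrMr// ler_pdivlMr// !(mulrC _ r); lra.
Qed.

Lemma dotp_sqr_le x : dotp x x <= n%:R * `|x| ^+ 2.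
Proof. by apply: le_trans (ler_norm _) _; rewrite expr2; exact: dotp_le_norm. Qed.

Lemma has_modulus_of_support (g : 'rV[R]_n -> R) (r : R) : continuous g ->
  (forall y, r < `|y| -> g y = 0) -> exists d, has_modulus d g.
Proof.
move=> cg gr.
have unif e : exists del : R, 0 < e -> 0 < del /\
    forall x y, `|x - y| < del -> `|g x - g y| <= e.
  have [e0|] := ltrP 0 e; last by exists 0.
  have /compact_near_coveringP cov := @compact_ball R n 0 (r + 1).
  have /cov : forall x, [set y : 'rV[R]_n | `|y - 0| <= r + 1] x ->
      \forall x' \near x & del \near 0^'+, forall y, `|x' - y| < del -> `|g x' - g y| <= e.
    move=> x _; have e2 : 0 < e / 2 by rewrite divr_gt0.
    have /continuous_epsP/(_ _ e2)[s s0 hs] := cg x.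
    exists ([set x' | `|x' - x| < s / 2], [set del | del < s / 2]).
      split; first by apply: near_in_ball; rewrite subrr normr0 divr_gt0.
      by apply: nbhs_right_lt; rewrite divr_gt0.
    case=> x' del /= [hx hdel] y yd.
    have close z : `|z - x| < s -> `|g z - g x| <= e / 2.
      by move=> zx; have := hs (z - x) zx; rewrite (addrC x) subrK.
    apply: le_trans (ler_distD (g x) _ _) _; rewrite (splitr e) lerD//.
      by apply: close; lra.
    rewrite distrC; apply: close; apply: le_lt_trans (ler_distD x' _ _) _.
    by rewrite (distrC y x'); lra.
  case=> del /= del0 hdel.
  exists (Num.min 1 (del / 2)) => _; split; first by rewrite lt_min ltr01 divr_gt0.
  move=> x y; rewrite lt_min => /andP[xy1 xyd].
  have [xr|xr] := lerP `|x - 0| (r + 1).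
    apply: (hdel (del / 2)) => //=; last by rewrite divr_gt0.
    by rewrite sub0r normrN gtr0_norm ?divr_gt0// ltr_pdivrMr// ltr_pMr// ltr1n.
  rewrite subr0 in xr; rewrite !gr ?subrr ?normr0 ?(ltW e0)//; last by lra.
  by have := lerB_normD x (y - x); rewrite (addrC x) subrK (distrC y x); lra.
have [d hd] := choice unif.
by exists d => e e0; exact: hd.
Qed.

Lemma psd_det_ge0 (A : 'M[R]_n) : psd A -> 0 <= \det A.
Proof. by move=> /psd_cholesky[T -> _]; rewrite det_mulmx det_tr -expr2 sqr_ge0. Qed.

Lemma continuous_maxr0 (f : 'rV[R]_n -> R) y : {for y, continuous f} ->
  {for y, continuous (fun z => Num.max (f z) 0)}.
Proof.
move=> /continuous_epsP cf; apply/continuous_epsP => e e0.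
have [r r0 hr] := cf e e0; exists r => // w wr; apply: le_trans (hr w wr).
move: (f (y + w)) (f y) => p q; have := ler_norm (p - q); have := ler_norm (- (p - q)).
by rewrite normrN ler_norml; case: (lerP p 0); case: (lerP q 0); lra.
Qed.

End ConvexNear.

(** * The comparison near a maximum of the doubled variables *)

Lemma powD_le {R : realType} (x y : R) n : (0 < n)%N -> 0 <= x -> 0 <= y ->
  x ^+ n + y ^+ n <= (x + y) ^+ n.
Proof.
case: n => // n _ x0 y0; elim: n => [|n IH]; first by rewrite !expr1.
rewrite exprS [(x + y) ^+ _]exprS [y ^+ _]exprS.
have h1 : x * x ^+ n.+1 <= x * (x + y) ^+ n.+1.
  by rewrite ler_wpM2l//; apply: le_trans IH; rewrite lerDl exprn_ge0.
have h2 : y * y ^+ n.+1 <= y * (x + y) ^+ n.+1.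
  by rewrite ler_wpM2l//; apply: le_trans IH; rewrite lerDr exprn_ge0.
by rewrite mulrDl lerD.
Qed.

(** [a] and [b] are the increments of the subsolution and of the supersolution at
    the two points given by the doubling of variables, so that both vanish at 0.
    There [a] is differentiable with gradient [P], and [b] lies above the
    perturbation of [a] by a convex quadratic polynomial with gradient [e], which
    raises the gradient into the region where [gam] has gained [om]. *)
Section Local.
Context {R : realType} {n : nat}.
Variables (a b f1 f2 gam : 'rV[R]_n -> R) (D : set 'rV[R]_n) (P e : 'rV[R]_n)
  (r0 K0 kap om Mb : R).
Implicit Types (phi : 'rV[R]_n -> R) (y z : 'rV[R]_n).
Hypotheses (n0 : (0 < n)%N) (r00 : 0 < r0) (K00 : 0 < K0) (kap0 : 0 < kap)
  (om0 : 0 < om) (Mb0 : 0 < Mb).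
Hypotheses (ca : convex_near a 0 r0) (cta : forall y, `|y| < r0 -> {for y, continuous a}).
Hypotheses (aP : forall z, `|z| < r0 -> dotp P z <= a z <= dotp P z + K0 * dotp z z).
Hypothesis (ab : forall z, `|z| < r0 -> a z + dotp e z + kap * dotp z z <= b z).
Hypotheses (b0 : b 0 = 0) (lb : usc_on [set z | `|z| < r0] (fun z => - b z)).
Hypothesis (test_a : forall phi G H y, C2_with phi G H -> `|y| < r0 ->
  (\forall z \near y, a z <= phi z) -> a y = phi y ->
  [/\ psd (H y), D (G y) & f1 y <= gam (G y) * \det (H y)]).
Hypothesis (test_b : forall phi G H y, C2_with phi G H -> `|y| < r0 -> b y < Mb ->
  (\forall z \near y, phi z <= b z) -> phi y = b y -> psd (H y) -> D (G y) ->
  gam (G y) * \det (H y) <= f2 y).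
Hypotheses (cf1 : {for 0, continuous f1}) (cf2 : forall s, f2 0 < s ->
  exists2 r : R, 0 < r & forall y, `|y| < r -> f2 y < s).
Hypotheses (gP : 0 <= gam P) (gam_up : forall s, gam P < s -> exists2 r : R, 0 < r &
  forall p, D p -> `|p - P| < r -> gam p < s).
Hypothesis (gam_low : exists2 r : R, 0 < r & forall p, `|p - (P + e)| < r ->
  D p /\ gam P + om <= gam p).

(** The slopes of affine functions that lie under the paraboloid of slope [P] up to
    [eps] on a ball are close to [P]: this is what freezes the gradient variable. *)
Lemma slope_close q y (r eps : R) : 0 < r -> `|y| <= r -> 0 <= eps ->
  (forall v, `|v| <= r -> dotp q v <= dotp P v + K0 * dotp (y + v) (y + v) + eps) ->
  `|q - P| <= 4 * K0 * n%:R * r + eps / r.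
Proof.
have nn0 : 0 < (n%:R : R) by rewrite ltr0n.
move=> r_gt0 yr eps0 h.
have E0 : 0 <= 4 * K0 * n%:R * r ^+ 2 + eps.
  by rewrite addr_ge0// mulr_ge0 ?sqr_ge0// !mulr_ge0// ltW.
have -> : 4 * K0 * n%:R * r + eps / r = (4 * K0 * n%:R * r ^+ 2 + eps) / r.
  by field; rewrite gt_eqF.
have axis v : `|v| <= r -> dotp (q - P) v <= 4 * K0 * n%:R * r ^+ 2 + eps.
  move=> vr; rewrite dotpBl; have := h v vr.
  have le1 : dotp (y + v) (y + v) <= n%:R * (2 * r) ^+ 2.
    apply: le_trans (dotp_sqr_le _) _; rewrite ler_pM2l// ler_pXn2r ?nnegrE//; last first.
      by rewrite mulr_ge0// ltW.
    by apply: le_trans (ler_normD _ _) _; lra.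
  have le2 : K0 * dotp (y + v) (y + v) <= 4 * K0 * n%:R * r ^+ 2.
    apply: le_trans (_ : K0 * (n%:R * (2 * r) ^+ 2) <= _); first by rewrite ler_pM2l.
    by rewrite le_eqVlt; apply/orP; left; apply/eqP; ring.
  by lra.
have ax i : `|r *: delta_mx 0 i : 'rV[R]_n| <= r.
  rewrite normrZ gtr0_norm// ler_piMr ?(ltW r_gt0)// rV_norm_le//; apply/forallP => j.
  by rewrite mxE /=; case: (j == i); rewrite ?normr1 ?normr0.
by apply: norm_le_axis => // i; apply: axis; rewrite ?normrN.
Qed.

Let base0 : a 0 = 0.
Proof.
have := @aP 0; rewrite normr0 => /(_ r00); rewrite !dotp0r mulr0 addr0 => h.
by apply/eqP; rewrite eq_le andbC.
Qed.

(** Near 0 all test functions have gradients close to [P], so [a] satisfies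
    [det (D^2 a) >= c ^+ n] for a constant [c], in the sense of touching functions.
    Mollification preserves this. Only a compactly supported function can be
    mollified here: [a] is replaced by the positive part [g] of [a - Q], where the
    paraboloid [Q] of opening [K] lies below [a] near 0 and above it away from 0.
    A function touching [g] at one of its zeros has a minimum there, and the Hessian
    [2 * K] of [Q] then gives the bound by itself. *)
Lemma smooth_subsolution (sg : R) : 0 < sg -> exists c r : R,
  [/\ 0 <= c, 0 < r, f1 0 - sg <= (gam P + sg) * c ^+ n
    & forall eps : R, 0 < eps -> exists F G H, [/\ C2_with F G H,
        forall z, `|z| <= r -> `|F z - a z| <= eps
      & forall y, psd (H y) /\
          forall s : R, 0 < s -> (c + s) ^+ n <= \det (H y + s%:M)]].
Proof.
move=> sg0.
have nn0 : 0 < (n%:R : R) by rewrite ltr0n.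
have gPs : 0 < gam P + sg by rewrite ltr_wpDl.
have [|c c0 cE] := @nth_rootP R n (Num.max (f1 0 - sg) 0 / (gam P + sg)) n0.
  by rewrite divr_ge0 ?(ltW gPs)// le_max lexx orbT.
(* [K > K0] separates [Q] from [a] away from 0, and [c <= 2 * K] is what the zeros
   of [g] require *)
pose K := K0 + 1 + c.
have K_gt0 : 0 < K by rewrite ltr_wpDr// addr_gt0.
have K2c : c <= 2 * K.
  by have := ltW K00; have := c0; rewrite /K; lra.
have a0 : a 0 = 0 := base0.
have sg_lt t : t < t + sg by rewrite ltrDl.
have [rs rs0 hrs] := gam_up (sg_lt _).
have /continuous_epsP/(_ _ sg0)[r1 r10 hr1] := cf1.
have Kn0 : 0 < 4 * K0 * n%:R + 1 by rewrite ltr_wpDl// !mulr_ge0// ltW.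
pose rho := Num.min (Num.min (r0 / 2) r1) (rs / (4 * K0 * n%:R + 1)).
have rho0 : 0 < rho by rewrite !lt_min r10 !divr_gt0.
have : rho <= rho by [].
rewrite {2}/rho !le_min => /andP[/andP[rho_r0 rho_r1]].
rewrite ler_pdivlMr// => rho_rs.
have sub_r0 z : `|z| < rho -> `|z| < r0 by move=> zr; apply: lt_trans zr _; lra.
pose beta := rho ^+ 2 / 4.
have beta0 : 0 < beta by rewrite divr_gt0// exprn_gt0.
pose Q := quad K%:M P 0 (- beta).
have QE z : Q z = - beta + dotp P z + K * dotp z z by rewrite /Q /quad subr0 qf_scalar.
have sK t : (t%:M : 'M[R]_n)^T = t%:M by rewrite tr_scalar_mx.
have cQ : continuous Q by exact: continuous_quad.
(* the two branches agree for [rho / 2 <= `|z|] *)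
pose g z := if `|z| < rho then Num.max (a z - Q z) 0 else 0.
have g_ge0 z : 0 <= g z by rewrite /g; case: ifP => // _; rewrite le_max lexx orbT.
have g_far z : rho / 2 <= `|z| -> g z = 0.
  move=> zr; rewrite /g; case: ifP => // zlt; apply/max_idPr.
  have [_] := andP (@aP z (sub_r0 z zlt)); rewrite QE => le1.
  have le2 : beta <= dotp z z.
    apply: le_trans (norm_sqr_le_dotp z); rewrite /beta.
    have -> : rho ^+ 2 / 4 = (rho / 2) ^+ 2 by field.
    by rewrite ler_pXn2r ?nnegrE// divr_ge0// ltW.
  have : 0 <= c * dotp z z by rewrite mulr_ge0// dotp_ge0.
  by rewrite /K; lra.
have cg : continuous g.
  move=> y; have [yr|yr] := ltrP `|y| rho; last first.
    apply/continuous_epsP => e' e'0; exists (rho / 2); first by rewrite divr_gt0.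
    move=> w wr; rewrite !g_far ?subrr ?normr0 ?(ltW e'0)//; first by lra.
    by have := lerB_normD y w; lra.
  have cm : {for y, continuous (fun z => Num.max (a z - Q z) 0)}.
    apply: continuous_maxr0; apply: (@continuousB _ _ _ a Q); first exact/cta/sub_r0.
    exact: cQ.
  apply/continuous_epsP => e' e'0.
  have /continuous_epsP/(_ _ e'0)[r r_gt0 hr] := cm.
  exists (Num.min r (rho - `|y|)); first by rewrite lt_min r_gt0 subr_gt0.
  move=> w; rewrite lt_min => /andP[wr wy]; rewrite /g yr ifT; first exact: hr.
  by apply: le_lt_trans (ler_normD _ _) _; lra.
have [d mg] : exists d, has_modulus d g.
  by apply: (has_modulus_of_support (r := rho) cg) => y yr; apply: g_far; lra.
have test phi G H x : C2_with phi G H -> (H x)^T = H x ->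
    (forall y, g y - phi y <= g x - phi x) ->
    psd (H x + (2 * K)%:M) /\ c ^+ n <= \det (H x + (2 * K)%:M).
  move=> C2 sH xmax; have := g_ge0 x; rewrite le_eqVlt => /orP[/eqP gx|gx].
    have pH : psd (H x).
      apply: (hess_global_min C2) sH => y; have := xmax y; have := g_ge0 y.
      by rewrite -gx; lra.
    split; first by apply: psdD => //; apply: psd_scalar; rewrite mulr_ge0// ltW.
    have K2 : 0 < 2 * K by rewrite mulr_gt0.
    have := @det_ge_of_mxtrace_conj R n (H x) 0 (2 * K) n0 pH (lexx 0) K2.
    move=> h; apply: le_trans (h _) => [|X mu mu0 emu]; last first.
      by rewrite mul0r mulr0 sumr_ge0// => k _; exact: psd_qf.
    by rewrite add0r ler_pXn2r ?nnegrE ?(ltW K2).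
  have xr : `|x| < rho by move: gx; rewrite /g; case: ifP; rewrite ?ltxx.
  have gxE : g x = a x - Q x.
    by move: gx; rewrite /g xr; case: (leP (a x - Q x) 0) => //; rewrite ltxx.
  pose phi' y := phi y + quad K%:M P 0 (- beta + (g x - phi x)) y.
  have phi'E y : phi' y = phi y + Q y + (g x - phi x) by rewrite /phi' /Q /quad; ring.
  have C2' := C2_withD C2 (C2_with_quad P 0 (- beta + (g x - phi x)) (sK K)).
  have near_x : \forall z \near x, a z <= phi' z.
    have xr' : `|x - 0| < rho by rewrite subr0.
    apply: filterS (near_in_ball xr') => z /=; rewrite subr0 => zr.
    have : a z - Q z <= g z by rewrite /g zr le_max lexx.
    by have := xmax z; rewrite phi'E; lra.
  have eq_x : a x = phi' x by rewrite phi'E gxE; ring.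
  have [pH DG le1] := test_a C2' (sub_r0 x xr) near_x eq_x.
  rewrite scale_scalar_mx in pH le1; split=> //.
  have dH := psd_det_ge0 pH.
  set q := G x + _ in DG le1.
  have qP : `|q - P| < rs.
    have sub v : `|v| <= rho -> dotp q v <= dotp P v + K0 * dotp (x + v) (x + v) + 0.
      move=> vr; have xv : `|x + v| < r0.
        by apply: le_lt_trans (ler_normD _ _) _; lra.
      have x0r : `|x - 0| < r0 by rewrite subr0; exact: sub_r0.
      have xv0 : `|x + v - 0| < r0 by rewrite subr0.
      have le2 := touching_subgradient ca C2' x0r xv0 near_x eq_x.
      have /andP[le3 _] := @aP x (sub_r0 x xr); have /andP[_ le4] := @aP (x + v) xv.
      by rewrite (dotpDr P) in le4; rewrite -/q in le2; lra.
    have := slope_close rho0 (ltW xr) (lexx 0) sub.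
    by rewrite mul0r addr0; lra.
  have gq := hrs q DG qP.
  rewrite cE ler_pdivrMr// ge_max mulr_ge0 ?(ltW gPs)// andbT.
  have h1 := hr1 x (lt_le_trans xr rho_r1); rewrite add0r ler_norml in h1.
  have h2 : gam q * \det (H x + (2 * K)%:M) <= (gam P + sg) * \det (H x + (2 * K)%:M).
    by rewrite ler_wpM2r// ltW.
  by rewrite mulrC; lra.
have gr y : rho < `|y| -> g y = 0 by move=> yr; apply: g_far; lra.
have Hmol := mollify_det_ge n0 mg gr c0 test.
have KN0 : 0 < K * n%:R + 1 by rewrite ltr_wpDl// mulr_ge0// ltW.
pose rA := Num.min (rho / 2) (Num.min 1 (beta / (K * n%:R + 1))).
have rA0 : 0 < rA.
  by rewrite !lt_min; apply/and3P; split=> //; exact: divr_gt0.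
have : rA <= rA by [].
rewrite {2}/rA !le_min => /and3P[rA_rho rA_1]; rewrite ler_pdivlMr// => rA_beta.
have rA_rho' : rA < rho by lra.
have gE z : `|z| <= rA -> g z = a z - Q z.
  move=> zr; have zrho : `|z| < rho by apply: le_lt_trans zr _.
  rewrite /g zrho; apply/max_idPl.
  have /andP[le1 _] := @aP z (sub_r0 z zrho); rewrite QE.
  have le2 : K * dotp z z <= K * (n%:R * rA).
    rewrite ler_pM2l//; apply: le_trans (dotp_sqr_le z) _; rewrite ler_pM2l//.
    apply: le_trans (_ : rA ^+ 2 <= _); first by rewrite ler_pXn2r ?nnegrE ?(ltW rA0).
    by rewrite expr2 ler_piMr ?(ltW rA0).
  by lra.
exists c, rA; split=> //.
  by rewrite cE mulrC divfK ?gt_eqF// le_max lexx.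
move=> eps eps0; have [de0 hde] := mg eps eps0.
pose h := d eps / (2 * n%:R + 1).
have n21 : 0 < 2 * n%:R + 1 :> R by rewrite ltr_wpDl// mulr_ge0.
have h0 : 0 < h by rewrite divr_gt0.
have mol_near z : `|mollify h g z - g z| <= eps.
  have [w wh ->] := mollify_mean z (ltW h0) mg.
  apply: hde; rewrite addrAC subrr add0r; apply: le_lt_trans wh _.
  rewrite /h mulrA ltr_pdivrMr// mulrC ltr_pM2l//; lra.
pose F z := mollify h g z + Q z.
have F_near z : `|z| <= rA -> `|F z - a z| <= eps.
  move=> zr; have := mol_near z; rewrite (gE z zr) /F; congr (`| _ | <= _); ring.
have CF := C2_withD (C2_with_mollify mg h0) (C2_with_quad P 0 (- beta) (sK K)).
do 3 eexists; split; [exact: CF|exact: F_near|].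
by move=> y; rewrite scale_scalar_mx; exact: Hmol.
Qed.

(** A smooth approximation [F] of [a], raised by the perturbation with half of its
    curvature, still touches [b] from below after a vertical shift, at a point [zs]
    near 0: the other half keeps [b] above it elsewhere. Its Hessian has
    determinant at least [(c + kap) ^+ n] and its gradient is close to [P + e]. *)
Lemma local_comparison : f1 0 + om * kap ^+ n <= f2 0.
Proof.
rewrite leNgt; apply/negP => gap.
pose sg := Num.min om ((f1 0 + om * kap ^+ n - f2 0) / 3).
have sg0 : 0 < sg by rewrite lt_min om0 divr_gt0// subr_gt0.
have : sg <= sg by [].
rewrite {2}/sg le_min => /andP[sg_om sg_gap].
have sK (t : R) : (t%:M : 'M[R]_n)^T = t%:M by rewrite tr_scalar_mx.
have a0 : a 0 = 0 := base0.
have [c [r [c0 r_gt0 l2 approx]]] := smooth_subsolution sg0.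
have [r2 r20 hr2] : exists2 r : R, 0 < r & forall y, `|y| < r -> f2 y < f2 0 + sg.
  by apply: cf2; rewrite ltrDl.
(* [rA]: the approximation holds; [rp]: increments for slopes; [del]: distance of
   the contact point to 0; [eps]: error of the approximation *)
have [rl rl0 hrl] := gam_low.
pose rA := Num.min r (Num.min (r0 / 2) (r2 / 2)).
have rA0 : 0 < rA by rewrite /rA lt_min r_gt0 lt_min !divr_gt0.
have : rA <= rA by [].
rewrite {2}/rA le_min => /andP[rA_r]; rewrite le_min => /andP[rA_r0 rA_r2].
have rA_r0' : rA < r0 by lra.
have rA_r2' : rA < r2 by lra.
have Kn0 : 0 < 4 * K0 * n%:R + 1 by rewrite ltr_wpDl// !mulr_ge0// ltW.
pose rp := Num.min (rA / 2) (rl / (16 * (4 * K0 * n%:R + 1))).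
have rp0 : 0 < rp.
  by rewrite lt_min; apply/andP; split; apply: divr_gt0 => //; exact: mulr_gt0.
have : rp <= rp by [].
rewrite {2}/rp le_min => /andP[rp_rA]; rewrite ler_pdivlMr ?mulr_gt0// => rp_rl.
pose bar := quad (K0 + kap / 2)%:M (P + e) 0 0.
have barE z : bar z = dotp P z + dotp e z + (K0 + kap / 2) * dotp z z.
  by rewrite /bar /quad add0r subr0 qf_scalar dotpDl.
have [rM rM0 hrM] : exists2 rM : R, 0 < rM & forall z, `|z| < rM -> bar z < Mb / 2.
  have bar0 : bar 0 < Mb / 2.
    by rewrite barE !dotp0r mulr0 !addr0 divr_gt0.
  have cbar : continuous bar by exact: continuous_quad.
  have /(@nbhs_normP R 'rV[R]_n 0)[rM rM0 h] := near_lt cbar bar0.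
  by exists rM => // z zr; apply: h; rewrite /ball_ /= sub0r normrN.
pose del := Num.min rp (Num.min rM (rl / (4 * kap))).
have del0 : 0 < del.
  by rewrite lt_min rp0 lt_min rM0 /=; apply: divr_gt0 => //; exact: mulr_gt0.
have : del <= del by [].
rewrite {2}/del le_min => /andP[del_rp]; rewrite le_min => /andP[del_rM].
rewrite ler_pdivlMr ?mulr_gt0// => del_rl.
pose eps := Num.min (kap * del ^+ 2 / 8) (Num.min (rp * rl / 16) (Mb / 8)).
have eps0 : 0 < eps.
  rewrite !lt_min; apply/and3P; split; apply: divr_gt0 => //; apply: mulr_gt0 => //.
  exact: exprn_gt0.
have : eps <= eps by [].
rewrite {2}/eps !le_min => /and3P[eps_del eps_rp eps_M].
have [F [GF [HF [CF F_near' HF_det]]]] := approx eps eps0.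
have F_near z : `|z| <= rA -> `|F z - a z| <= eps.
  by move=> zr; apply: F_near'; exact: le_trans zr rA_r.
pose quadk := quad (kap / 2)%:M e 0.
pose psi z := F z + quadk 0 z.
have quadkE t z : quadk t z = t + dotp e z + kap / 2 * dotp z z.
  by rewrite /quadk /quad subr0 qf_scalar.
pose B := [set z : 'rV[R]_n | `|z - 0| <= rA].
have cpsi : continuous psi.
  apply: continuous_addr; last exact: continuous_quad.
  by have [] := CF.
have uB : usc_on B (fun z => psi z + - b z).
  move=> y; rewrite /B /= subr0 => yr s ys; pose s2 := (s - (psi y + - b y)) / 2.
  have s20 : 0 < s2 by rewrite divr_gt0// subr_gt0.
  have yr0 : `|y| < r0 by apply: le_lt_trans yr _.
  have m1 : psi y < psi y + s2 by rewrite ltrDl.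
  have m2 : - b y < - b y + s2 by rewrite ltrDl.
  apply: filterS2 (near_lt cpsi m1) (lb yr0 m2) => z /= z1 z2; rewrite subr0 => zr.
  have := z2 (le_lt_trans zr rA_r0'); rewrite /s2 in z1 *; lra.
have B0' : B 0 by rewrite /B /= subrr normr0 ltW.
have [zs Bzs zmax] := usc_max (@compact_ball R n 0 rA) (ex_intro _ 0 B0') uB.
rewrite /B /= subr0 in Bzs.
have zs_r0 : `|zs| < r0 by apply: le_lt_trans Bzs _.
have F0 : - eps <= F 0.
  by have := F_near 0; rewrite normr0 a0 subr0 ler_norml => /(_ (ltW rA0))/andP[].
have psi0 : psi 0 = F 0 by rewrite /psi quadkE !dotp0r mulr0 !addr0.
have at0 := zmax 0 B0'; rewrite psi0 b0 oppr0 addr0 in at0.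
have Fzs := F_near zs Bzs; rewrite ler_norml in Fzs.
have psizs : psi zs = F zs + (dotp e zs + kap / 2 * dotp zs zs).
  by rewrite /psi quadkE add0r.
have abzs := @ab zs zs_r0.
have zs_del : `|zs| < del.
  have le1 : kap / 2 * `|zs| ^+ 2 <= kap / 2 * dotp zs zs.
    by rewrite ler_pM2l ?divr_gt0//; exact: norm_sqr_le_dotp.
  have le2 : kap * `|zs| ^+ 2 < kap * del ^+ 2.
    have : 0 < kap * del ^+ 2 by rewrite mulr_gt0// exprn_gt0.
    by rewrite psizs in at0; lra.
  by move: le2; rewrite ltr_pM2l// ltr_pXn2r ?nnegrE ?(ltW del0).
have zs_rp : `|zs| <= rp by apply: ltW; apply: lt_le_trans zs_del _.
have zs_rA : `|zs| < rA by apply: le_lt_trans zs_rp _; lra.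
pose phi z := F z + quadk (b zs - psi zs) z.
have phiE z : phi z = psi z + (b zs - psi zs).
  by rewrite /phi /psi !quadkE; ring.
have Cphi := C2_withD CF (C2_with_quad e 0 (b zs - psi zs) (sK (kap / 2))).
set Hphi := fun y => _ + 2 *: (kap / 2)%:M in Cphi.
have HphiE : Hphi zs = HF zs + kap%:M.
  by rewrite /Hphi scale_scalar_mx; congr (_ + _%:M); field.
have bzs : b zs < Mb.
  have := hrM zs (lt_le_trans zs_del del_rM); rewrite barE.
  have /andP[_] := @aP zs zs_r0.
  by rewrite psizs in at0; lra.
have near_zs : \forall z \near zs, phi z <= b z.
  have zsr : `|zs - 0| < rA by rewrite subr0.
  apply: filterS (near_in_ball zsr) => z /= zr; rewrite phiE.
  by have := zmax z (ltW zr); lra.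
have eq_zs : phi zs = b zs by rewrite phiE; ring.
have [pA dA] := HF_det zs.
have pHphi : psd (Hphi zs).
  by rewrite HphiE; apply: psdD => //; apply: psd_scalar; exact: ltW.
have psdF y : psd (HF y) by have [] := HF_det y.
set Gphi := fun y => _ + (e + _) in Cphi.
have GphiP : `|Gphi zs - (P + e)| < rl.
  set q := GF zs.
  have -> : Gphi zs - (P + e) = (q - P) + kap *: zs.
    rewrite /Gphi -/q subr0 mul_mx_scalar scalerA.
    have -> : 2 * (kap / 2) = kap by field.
    by rewrite opprD addrACA [e + _]addrC addrK.
  have qP : `|q - P| <= 4 * K0 * n%:R * rp + 2 * eps / rp.
    apply: (@slope_close q zs rp (2 * eps)) => //; first by rewrite mulr_ge0// ltW.
    move=> v vr; have zv : `|zs + v| <= rA.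
      by apply: le_trans (ler_normD _ _) _; lra.
    have := psd_tangent_le CF zs v psdF; rewrite -/q.
    have := F_near _ zv; rewrite ler_norml => Fzv.
    have /andP[le1 _] := @aP zs zs_r0.
    have /andP[_ le2] := @aP _ (le_lt_trans zv rA_r0').
    by rewrite (dotpDr P) in le2; lra.
  have kz : `|kap *: zs| <= rl / 4.
    rewrite normrZ gtr0_norm//.
    have : kap * `|zs| <= kap * del by rewrite ler_pM2l// ltW.
    by lra.
  have e2 : 2 * eps / rp <= rl / 8 by rewrite ler_pdivrMr//; lra.
  apply: le_lt_trans (ler_normD _ _) _; lra.
have [DG gG] := hrl _ GphiP.
have fin := test_b Cphi zs_r0 bzs near_zs eq_zs pHphi DG.
have f2zs := hr2 zs (le_lt_trans Bzs rA_r2').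
have dphi : c ^+ n + kap ^+ n <= \det (Hphi zs).
  rewrite HphiE; apply: le_trans (dA kap kap0).
  by apply: powD_le => //; exact: ltW.
have cn0 : 0 <= c ^+ n by rewrite exprn_ge0.
have kn0 : 0 <= kap ^+ n by rewrite exprn_ge0// ltW.
have l1 : (gam P + om) * (c ^+ n + kap ^+ n) <= gam (Gphi zs) * \det (Hphi zs).
  by apply: ler_pM => //; rewrite addr_ge0// ltW.
have l3 : (gam P + sg) * c ^+ n <= (gam P + om) * c ^+ n.
  by rewrite ler_wpM2r// lerD2l.
have l4 : 0 <= gam P * kap ^+ n by rewrite mulr_ge0.
lra.
Qed.

End Local.

(** * Doubling of variables *)

Section Semicontinuous.
Context {R : realType} {T : topologicalType}.
Implicit Types (S : set T) (f g : T -> R).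

Lemma usc_onD S f g : usc_on S f -> usc_on S g -> usc_on S (fun x => f x + g x).
Proof.
move=> uf ug x Sx c fgc; pose e := (c - (f x + g x)) / 2.
have e0 : 0 < e by rewrite divr_gt0// subr_gt0.
have f1 : f x < f x + e by rewrite ltrDl.
have g1 : g x < g x + e by rewrite ltrDl.
apply: filterS2 (uf x Sx _ f1) (ug x Sx _ g1) => y fy gy Sy.
by have := fy Sy; have := gy Sy; rewrite /e; lra.
Qed.

Lemma usc_on_sub S S' f : S' `<=` S -> usc_on S f -> usc_on S' f.
Proof.
move=> sS uf x Sx c fc; apply: filterS (uf x (sS _ Sx) c fc) => y fy Sy.
exact/fy/sS.
Qed.

End Semicontinuous.

Section Product.
Context {R : realType} {X Y : topologicalType}.

Lemma usc_on_fst (A : set X) (B : set Y) (f : X -> R) :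
  usc_on A f -> usc_on (A `*` B) (fun p => f p.1).
Proof.
move=> uf [x y] [/= Ax By] c fc.
exists ([set a | A a -> f a < c], setT).
  by split; [exact: uf|exact: filterT].
by move=> [a b] [/= fa _] [Aa _]; exact: fa.
Qed.

Lemma usc_on_snd (A : set X) (B : set Y) (f : Y -> R) :
  usc_on B f -> usc_on (A `*` B) (fun p => f p.2).
Proof.
move=> uf [x y] [/= Ax By] c fc.
exists (setT, [set b | B b -> f b < c]).
  by split; [exact: filterT|exact: uf].
by move=> [a b] [/= _ fb] [_ Bb]; exact: fb.
Qed.

End Product.

Section Translation.
Context {R : realType} {n : nat}.
Implicit Types (f : 'rV[R]_n -> R) (a x y : 'rV[R]_n).

Lemma near_translate (Q : set 'rV[R]_n) a y :
  (\forall w \near y + a, Q w) -> \forall z \near y, Q (z + a).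
Proof.
move=> /(@nbhs_normP R 'rV[R]_n (y + a))[r r0 h].
apply/(@nbhs_normP R 'rV[R]_n y); exists r => // z /= zr; apply: h.
by rewrite /ball_ /= opprD addrACA subrr addr0.
Qed.

Lemma continuous_translate f a y :
  {for y + a, continuous f} -> {for y, continuous (fun z : 'rV[R]_n => f (z + a))}.
Proof. by move=> cf B fB; exact: (near_translate (cf B fB)). Qed.

Lemma near_translate0 (Q : set 'rV[R]_n) y :
  (\forall w \near y, Q w) -> exists2 r : R, 0 < r & forall z, `|z| < r -> Q (z + y).
Proof.
move=> /(@nbhs_normP R 'rV[R]_n y)[r /= r0 h]; exists r => // z zr; apply: h.
by rewrite /ball_ /= opprD addrCA subrr addr0 normrN.
Qed.

Lemma usc_on_continuous (S : set 'rV[R]_n) f : continuous f -> usc_on S f.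
Proof. by move=> cf x Sx c fc; apply: filterS (near_lt cf fc). Qed.

Lemma C2_with_shift f G H a (c : R) : C2_with f G H ->
  C2_with (fun w => f (w - a) + c) (fun w => G (w - a)) (fun w => H (w - a)).
Proof.
have s0 : (0 : 'M[R]_n)^T = 0 by rewrite trmx0.
move=> Cf; have := C2_withD (C2_with_translate (- a) Cf) (C2_with_quad 0 0 c s0).
have -> : (fun y => f (y - a) + quad 0 0 0 c y) = (fun w => f (w - a) + c).
  by apply/funext => w; rewrite /quad dotp0l addr0 /qf subr0 mulmx0 mul0mx mxE addr0.
have -> : (fun y => G (y - a) + (0 + 2 *: ((y - 0) *m 0))) = (fun w => G (w - a)).
  by apply/funext => w; rewrite mulmx0 scaler0 !addr0.
by have -> : (fun y => H (y - a) + 2 *: 0) = (fun w => H (w - a));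
  first by apply/funext => w; rewrite scaler0 addr0.
Qed.

Lemma dotpDsqr x y : dotp (x + y) (x + y) = dotp x x + 2 * dotp y x + dotp y y.
Proof. by rewrite dotpDl !dotpDr (dotpC x y); ring. Qed.

End Translation.

Section Cone.
Context {R : realType} {n : nat}.

Lemma directional_coneD (D : set 'rV[R]_n) p q :
  directional_cone D -> D p -> D q -> D (p + q).
Proof.
move=> [_ cD hD _] Dp Dq.
have h01 : Itv.spec (@Itv.num_sem R) (Itv.Real `[0%Z, 1%Z]) (2^-1 : R).
  by apply/and3P; split; rewrite ?num_real// ?bnd_simp; lra.
have := cD p q (Itv.mk h01); rewrite !inE => /(_ Dp Dq).
move=> /(hD 2 _ (ler0n R 2)); congr D.
by rewrite /conv /= /unstable.onem; apply/rowP => i; rewrite !mxE; field.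
Qed.

End Cone.

Section Doubling.
Context {R : realType} {n : nat}.
Variables (Om : set 'rV[R]_n) (f U V theta : 'rV[R]_n -> R).
Local Notation K := (closure Om).
Hypothesis oOm : open Om.
Hypothesis cK : compact K.
Hypothesis cf : forall x, Om x -> {for x, continuous f}.
Hypothesis uU : usc_on K U.
Hypothesis uV : usc_on K (fun x : 'rV[R]_n => - V x).
Hypothesis UV : forall x : 'rV[R]_n, K x -> ~ Om x -> U x <= V x.
Hypothesis ct : continuous theta.
Hypothesis theta0 : forall x : 'rV[R]_n, K x -> theta x <= 0.

Let W (p : 'rV[R]_n * 'rV[R]_n) := U p.1 + theta p.1 - V p.2.

Let uW : usc_on (K `*` K) W.
Proof.
apply: usc_onD; last exact: (@usc_on_snd R _ _ K K (fun y => - V y)).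
apply: (@usc_on_fst R _ _ K K (fun x => U x + theta x)).
by apply: usc_onD => //; exact: usc_on_continuous.
Qed.

Let dist2 (p : 'rV[R]_n * 'rV[R]_n) := dotp (p.1 - p.2) (p.1 - p.2).

Let cdist2 : continuous dist2.
Proof.
move=> p; apply: (@continuous_comp _ _ _ (fun q : 'rV[R]_n * 'rV[R]_n => q.1 - q.2)
  (fun z => dotp z z)).
  by apply: continuousB; [exact: cvg_fst|exact: cvg_snd].
have : continuous (quad (1%:M : 'M[R]_n) 0 0 0).
  by apply: continuous_quad; exact: tr_scalar_mx.
have -> : quad 1%:M 0 0 0 = fun z : 'rV[R]_n => dotp z z; last exact.
by apply/funext => z; rewrite /quad dotp0l subr0 qf1 !add0r.
Qed.

(** As [al] grows, the pairs of points at which the doubled function is at least [m0]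
    cluster only at pairs [(x, x)] with [U x + theta x - V x >= m0]. Such [x] lie in
    [Om], so by compactness both points lie in [Om] and [f] nearly agrees at them
    once [al] is large. *)
Lemma doubling (m0 e0 : R) : 0 < m0 -> 0 < e0 ->
  (exists2 x, Om x & m0 <= U x + theta x - V x) ->
  exists (al : R) xh yh, [/\ 0 < al, Om xh, Om yh, f yh < f xh + e0 &
    m0 <= U xh + theta xh - V yh /\
    forall x y, K x -> K y ->
      U x + theta x - V y - al * dotp (x - y) (x - y) <=
      U xh + theta xh - V yh - al * dotp (xh - yh) (xh - yh)].
Proof.
move=> m00 e00 [x1 Ox1 mx1].
have KK : compact (K `*` K) by exact: compact_setX.
have cov : \forall al \near +oo, K `*` K `<=` [set p : 'rV[R]_n * 'rV[R]_n |
    m0 <= W p - al * dist2 p -> [/\ Om p.1, Om p.2 & f p.2 < f p.1 + e0]].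
  have /compact_near_coveringP := KK.
  move=> /(_ R +oo%R (fun al p => (K `*` K) p -> m0 <= W p - al * dist2 p ->
      [/\ Om p.1, Om p.2 & f p.2 < f p.1 + e0])).
  have Fp : Filter (+oo : set_system R) by exact: filter_filter.
  move=> /(_ Fp) cover; apply: (filterS _ (cover _)); first by move=> al h p Kp; exact: h.
  move=> [x y] [/= Kx Ky]; have Kxy : (K `*` K) (x, y) by [].
  have d_ge0 p : 0 <= dist2 p by exact: dotp_ge0.
  have al_pos : \forall al \near +oo, (0 : R) < al by exact: nbhs_pinfty_gt.
  have [xy|xy] := eqVneq x y; last first.
    have d0 : 0 < dist2 (x, y).
      rewrite lt_neqAle d_ge0 andbT eq_sym; apply/eqP => /dotp_eq0/eqP.
      by rewrite subr_eq0 (negPf xy).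
    have WC : W (x, y) < W (x, y) + 1 by rewrite ltrDl.
    have d2 : dist2 (x, y) / 2 < dist2 (x, y) by lra.
    have N1 := uW Kxy WC.
    have N2 : \forall p \near (x, y), dist2 (x, y) / 2 < dist2 p.
      exact: (@cvgr_gt _ _ _ _ _ _ (@cdist2 (x, y)) _ d2).
    have al_big : \forall al \near +oo, (W (x, y) + 1) / (dist2 (x, y) / 2) < al.
      by apply: nbhs_pinfty_gt; exact: num_real.
    exists ([set p | ((K `*` K) p -> W p < W (x, y) + 1) /\ dist2 (x, y) / 2 < dist2 p],
            [set al | 0 < al /\ (W (x, y) + 1) / (dist2 (x, y) / 2) < al]).
      split; first exact: filterI N1 N2.
      exact: filterI al_pos al_big.
    move=> [p al] [/= [p1 p2] [al0 al1]] Kp.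
    have := p1 Kp; rewrite ltr_pdivrMr ?divr_gt0// in al1.
    have : al * (dist2 (x, y) / 2) <= al * dist2 p by rewrite ler_pM2l// ltW.
    by lra.
  subst y; have [Ox|nOx] := pselect (Om x).
    have e2 : 0 < e0 / 2 by rewrite divr_gt0.
    have Nf : \forall z \near x, Om z /\ `|f x - f z| < e0 / 2.
      apply: filterI; first exact: open_nbhs_nbhs.
      have := cf Ox => /(@cvgrPdist_lt _ R _ _ (nbhs_filter x) f (f x)); exact.
    exists ([set p | (Om p.1 /\ `|f x - f p.1| < e0 / 2) /\
                     (Om p.2 /\ `|f x - f p.2| < e0 / 2)], setT).
      split; last exact: filterT.
      exists ([set z | Om z /\ `|f x - f z| < e0 / 2],
              [set z | Om z /\ `|f x - f z| < e0 / 2]) => //.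
    move=> [p al] /= [] [] [Op1 h1] [Op2 h2] _ _ _; split=> //.
    by move: h1 h2; rewrite !ltr_norml => /andP[? ?] /andP[? ?]; lra.
  have Wm : W (x, x) < m0.
    by rewrite /W /=; have := UV Kx nOx; have := theta0 Kx; lra.
  exists ([set p | (K `*` K) p -> W p < m0], [set al | 0 < al]).
    by split; [exact: uW|exact: al_pos].
  move=> [p al] [/= p1 al0] Kp; have := p1 Kp.
  have : 0 <= al * dist2 p by rewrite mulr_ge0// ltW.
  by lra.
have [al [al0 hal]] : exists al : R, 0 < al /\ K `*` K `<=` [set p : 'rV[R]_n * 'rV[R]_n |
    m0 <= W p - al * dist2 p -> [/\ Om p.1, Om p.2 & f p.2 < f p.1 + e0]].
  have al_pos : \forall al \near +oo, (0 : R) < al by exact: nbhs_pinfty_gt.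
  exact: filter_ex (filterI al_pos cov).
have uPhi : usc_on (K `*` K) (fun p => W p + - (al * dist2 p)).
  apply: usc_onD => // p Kp c pc.
  have cd : {for p, continuous (fun q => - (al * dist2 q))}.
    by apply: continuousN; apply: continuousM; [exact: cst_continuous|exact: cdist2].
  by apply: filterS (@cvgr_lt _ _ _ _ _ _ cd _ pc).
have Kx1 := subset_closure Ox1.
have [[xh yh] Khh hmax] := usc_max KK (ex_intro _ (x1, x1) (conj Kx1 Kx1)) uPhi.
have big : m0 <= W (xh, yh) - al * dist2 (xh, yh).
  apply: le_trans (hmax (x1, x1) (conj Kx1 Kx1)).
  by rewrite /dist2 /= subrr dotp0l mulr0 subr0.
have [Oxh Oyh fh] := hal _ Khh big.
exists al, xh, yh; split=> //; split; last by move=> x y Kx Ky; exact: hmax (x, y) _.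
apply: le_trans big _; rewrite gerBl mulr_ge0 ?(ltW al0)//; exact: dotp_ge0.
Qed.

End Doubling.

(** * Comparison for truncated functions *)

Section RealComparison.
Context {R : realType} {n : nat}.
Variables (Om D : set 'rV[R]_n) (f g U V : 'rV[R]_n -> R) (M : R).
Variables (qbar : 'rV[R]_n) (omega : R -> R).
Local Notation K := (closure Om).
Hypothesis n0 : (0 < n)%N.
Hypothesis oOm : open Om.
Hypothesis cK : compact K.
Hypothesis hD : directional_cone D.
Hypothesis cf : forall x, Om x -> {for x, continuous f}.
Hypothesis hg : {within D, continuous g}.
Hypothesis hg0 : forall p, D p -> 0 <= g p.
Hypothesis hgmono : forall p q, D p -> D q -> g p <= g (p + q).
Hypothesis qD : D° qbar.
Hypothesis omega0 : forall eta, 0 < eta -> 0 < omega eta.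
Hypothesis hgs : forall p eta, D p -> 0 < eta ->
  g p + omega eta <= g (p + eta *: qbar).
Hypothesis uU : usc_on K U.
Hypothesis uV : usc_on K (fun x : 'rV[R]_n => - V x).
Hypothesis UV : forall x : 'rV[R]_n, K x -> ~ Om x -> U x <= V x.
Hypothesis UM : forall x : 'rV[R]_n, K x -> - M <= U x <= M.
Hypothesis VM : forall x : 'rV[R]_n, K x -> - M <= V x <= M.
Hypothesis subU : forall phi G H y, C2_with phi G H -> Om y -> - M < U y ->
  (\forall z \near y, U z <= phi z) -> U y = phi y ->
  [/\ psd (H y), D (G y) & f y <= g (G y) * \det (H y)].
Hypothesis supV : forall phi G H y, C2_with phi G H -> Om y -> V y < M ->
  (\forall z \near y, phi z <= V z) -> phi y = V y -> psd (H y) -> D (G y) ->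
  g (G y) * \det (H y) <= f y.

(** The differential inequality holds only where the truncation is inactive, but a
    truncated function is locally minimal elsewhere. *)
Lemma subsolution_convex x0 (r : R) :
  (forall z, `|z - x0| <= r -> Om z) -> convex_near U x0 r.
Proof.
move=> rOm a b l; apply: convex_of_touching.
  by apply: usc_on_sub uU => z /= zr; exact/subset_closure/rOm.
move=> A p x c y sA yr Uq Uy v; have Oy := rOm y (ltW yr).
have CA := C2_with_quad p x c sA.
have [UyM|Uylt] := leP (U y) (- M); last first.
  have [[_ pA] _ _] := subU CA Oy Uylt Uq Uy.
  have := pA v; rewrite -/(qf _ _) qfZl pmulr_rge0//.
(* where the truncation is active the paraboloid has a local minimum *)
have Kq : \forall z \near y, - M <= quad A p x c z.
  have Oz : \forall z \near y, Om z by exact: open_nbhs_nbhs.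
  apply: filterS2 Uq Oz => z Uz Oz; apply: le_trans Uz.
  by have /andP[] := UM (subset_closure Oz).
have /(@nbhs_normP R 'rV[R]_n y)[rho rho0 h] := Kq.
have [->|v0] := eqVneq v 0; first by rewrite /qf mul0mx mul0mx mxE.
have nv : 0 < `|v| by rewrite normr_gt0.
pose t := rho / (2 * `|v|); have t0 : 0 < t by rewrite divr_gt0// mulr_gt0.
have tv : `|t *: v| < rho.
  have rho0' : 0 < rho by exact: rho0.
  rewrite normrZ gtr0_norm//; have -> : t * `|v| = rho / 2; last by lra.
  by rewrite /t; field; rewrite gt_eqF.
have [s _ ss] := second_difference CA y v t0.
have hp := h (y + t *: v); have hm := h (y - t *: v).
rewrite /ball_ /= opprD addrA subrr sub0r normrN in hp.
rewrite /ball_ /= opprB addrCA subrr addr0 in hm.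
have := hp tv; have := hm tv; rewrite qfZl in ss.
have t2 : 0 < t ^+ 2 by rewrite exprn_gt0.
have : 0 <= t ^+ 2 * (2 * qf A v) by rewrite -ss; lra.
by rewrite pmulr_rge0// pmulr_rge0.
Qed.

Lemma subsolution_convex_near x : Om x -> exists2 r : R, 0 < r &
  (forall z, `|z| < r -> Om (z + x)) /\ convex_near U x r.
Proof.
move=> Ox; have : \forall z \near x, Om z by exact: open_nbhs_nbhs.
move=> /near_translate0[r r0 h].
exists (r / 2); first by rewrite divr_gt0.
split=> [z zr|]; first by apply: h; lra.
by apply: subsolution_convex => z zr; rewrite -(subrK x z); apply: h; lra.
Qed.

Lemma subsolution_continuous x : Om x -> {for x, continuous U}.
Proof.
move=> Ox; have [r r0 [rO cU]] := subsolution_convex_near Ox.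
apply: usc_convex_continuous cU _; last by rewrite subrr normr0.
apply: usc_on_sub uU => z /= zr; apply: subset_closure.
by have := rO _ zr; rewrite subrK.
Qed.

(** The perturbation [theta] is nonpositive on [K], with gradient in the interior
    of [D] and positive curvature. The paraboloid touching [U] at [xh] is given by
    the penalization; it shows that the slope [P] belongs to [D]. *)
Theorem comparison_real x : Om x -> U x <= V x.
Proof.
move=> Ox; have [//|VU] := leP (U x) (V x); exfalso.
have [dl dl0 hdl] := near_translate0 qD.
have [B B0 KB] : exists2 B : R, 0 < B & forall z, K z -> `|z| <= B.
  have [B0 [_ hB]] := compact_bounded cK.
  exists (`|B0| + 1); first by rewrite ltr_wpDl.
  by apply: hB; apply: le_lt_trans (ler_norm _) _; rewrite ltrDl.
pose ka := dl / (4 * B); have ka0 : 0 < ka by rewrite divr_gt0// mulr_gt0.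
have kaB : ka * B = dl / 4 by rewrite /ka; field; rewrite gt_eqF.
have sI (t : R) : (t%:M : 'M[R]_n)^T = t%:M by exact: tr_scalar_mx.
(* [ka] is so small that the gradient [qbar + ka *: z] of [h0] stays within
   [dl / 4] of [qbar] on [K] *)
pose h0 := quad (ka / 2)%:M qbar 0 0.
have ch0 : continuous h0 by exact: continuous_quad.
have h0E z : h0 z = dotp qbar z + ka / 2 * dotp z z.
  by rewrite /h0 /quad add0r subr0 qf_scalar.
have Kx := subset_closure Ox.
have [x2 Kx2 x2max] := usc_max cK (ex_intro _ x Kx) (usc_on_continuous (S := K) ch0).
pose m := U x - V x; have m_gt0 : 0 < m by rewrite subr_gt0.
have dh : 0 <= h0 x2 - h0 x by rewrite subr_ge0; exact: x2max.
pose eta := m / 2 / (h0 x2 - h0 x + 1).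
have dh1 : 0 < h0 x2 - h0 x + 1 by lra.
have eta0 : 0 < eta by rewrite !divr_gt0.
have eta_m : eta * (h0 x2 - h0 x) < m.
  have : eta * (h0 x2 - h0 x + 1) = m / 2 by rewrite /eta divfK ?gt_eqF.
  by rewrite mulrDr mulr1; lra.
pose theta z := eta * (h0 z - h0 x2).
have ct : continuous theta.
  apply: continuous_mull; apply: continuous_addr => //.
  by move=> z; exact: cst_continuous.
have theta0 z : K z -> theta z <= 0.
  by move=> Kz; rewrite /theta pmulr_rle0// subr_le0; exact: x2max.
pose m0 := U x + theta x - V x.
have m00 : 0 < m0 by rewrite /m0 /theta; rewrite /m in eta_m; lra.
pose kap := eta * ka / 2; have kap0 : 0 < kap by rewrite divr_gt0// mulr_gt0.
pose om := omega (eta / 2); have om0 : 0 < om by apply: omega0; rewrite divr_gt0.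
have e00 : 0 < om * kap ^+ n by rewrite mulr_gt0// exprn_gt0.
have Ex : exists2 z, Om z & m0 <= U z + theta z - V z by exists x.
have [al [xh [yh [al0 Oxh Oyh fhh [mhh hmax]]]]] :=
  doubling oOm cK cf uU uV UV ct theta0 m00 e00 Ex.
have Kxh := subset_closure Oxh; have Kyh := subset_closure Oyh.
have Uxh : - M < U xh.
  by have := theta0 _ Kxh; have /andP[] := VM Kyh; lra.
have Vyh : V yh < M.
  by have := theta0 _ Kxh; have /andP[] := UM Kxh; lra.
pose e : 'rV[R]_n := eta *: (qbar + ka *: xh).
have thE z : theta (z + xh) = theta xh + dotp e z + kap * dotp z z.
  rewrite /theta !h0E /e /kap dotpDr !dotpDl !dotpDr dotpZl dotpDl dotpZl (dotpC xh z).
  by field.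
pose P : 'rV[R]_n := (2 * al) *: (xh - yh) - e.
have [r1 r10 [OU1 cU1]] := subsolution_convex_near Oxh.
have [r2 r20 h2] : exists2 r : R, 0 < r & forall z, `|z| < r -> Om (z + yh).
  by have [r r0 [rO _]] := subsolution_convex_near Oyh; exists r.
have [r3 r30 h3] : exists2 r : R, 0 < r & forall z, `|z| < r -> - M < U (z + xh).
  have N : \forall z \near xh, - M < U z.
    exact: (@cvgr_gt _ _ _ _ _ _ (subsolution_continuous Oxh) _ Uxh).
  exact: near_translate0 N.
pose r0 := Num.min r1 (Num.min r2 r3).
have r00 : 0 < r0 by rewrite /r0 lt_min r10 lt_min r20.
have lt_r0 z : `|z| < r0 -> [/\ `|z| < r1, `|z| < r2 & `|z| < r3].
  by rewrite lt_min => /andP[z1]; rewrite lt_min => /andP[].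
(* the maximum in the first variable, [yh] being fixed *)
pose q := quad al%:M P xh (U xh).
have qE z : q (z + xh) = U xh + dotp P z + al * dotp z z.
  by rewrite /q /quad addrK qf_scalar.
have Uq z : Om (z + xh) -> U (z + xh) <= q (z + xh).
  move=> Oz; have := hmax _ yh (subset_closure Oz) Kyh.
  rewrite qE thE; have -> : z + xh - yh = z + (xh - yh) by rewrite addrA.
  have -> : dotp P z = 2 * al * dotp (xh - yh) z - dotp e z
    by rewrite /P (dotpBl _ e) dotpZl.
  rewrite dotpDsqr; set w := xh - yh.
  have : 0 <= kap * dotp z z by rewrite mulr_ge0 ?dotp_ge0// ltW.
  set d1 := dotp w z; set d2 := dotp z z; set d3 := dotp e z.
  set d4 := dotp w w; lra.
have Cq := C2_with_quad P xh (U xh) (sI al).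
have Uqnear : \forall z \near xh, U z <= q z.
  have Oz : \forall z \near xh, Om z by exact: open_nbhs_nbhs.
  by apply: filterS Oz => z Oz; have := Uq (z - xh); rewrite subrK; exact.
have Uq0 : U xh = q xh.
  by have := qE 0; rewrite add0r !dotp0r mulr0 !addr0.
have DP : D P.
  have [_ + _] := subU Cq Oxh Uxh Uqnear Uq0.
  by rewrite subrr mul0mx scaler0 addr0.
suff : f xh + om * kap ^+ n <= f yh by lra.
have := @local_comparison R n (fun z => U (z + xh) - U xh) (fun z => V (z + yh) - V yh)
  (fun z => f (z + xh)) (fun z => f (z + yh)) g D P e r0 al kap om (M - V yh).
rewrite !add0r; apply=> //.
- by rewrite subr_gt0.
- move=> a b l; rewrite !subr0 => /lt_r0[a1 _ _] /lt_r0[b1 _ _] l01.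
  have := cU1 (a + xh) (b + xh) l; rewrite !addrK => /(_ a1 b1 l01).
  have -> : b + xh - (a + xh) = b - a by rewrite opprD addrACA subrr addr0.
  by rewrite addrAC; set u1 := U _; set u2 := U _; set u3 := U _; lra.
- move=> y /lt_r0[y1 _ _].
  apply: continuousB; last exact: cst_continuous.
  exact/continuous_translate/subsolution_continuous/OU1.
- move=> z /lt_r0[z1 _ _]; apply/andP; split; last first.
    by have := Uq z (OU1 z z1); rewrite qE; lra.
  have := touching_subgradient (y := xh) (v := z) cU1 Cq.
  rewrite subrr normr0 [xh + z]addrC addrK => /(_ r10 z1 Uqnear Uq0).
  by rewrite mul0mx scaler0 addr0; lra.
- move=> z /lt_r0[z1 z2 _].
  have := hmax _ _ (subset_closure (OU1 z z1)) (subset_closure (h2 z z2)).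
  have -> : z + xh - (z + yh) = xh - yh by rewrite opprD addrACA subrr add0r.
  by rewrite thE; lra.
- by rewrite subrr.
- move=> z /= /lt_r0[_ z2 _] c zc.
  have Kz := subset_closure (h2 z z2).
  have zc' : - V (z + yh) < c - V yh by lra.
  have := near_translate (uV Kz zc').
  apply: filterS => w Vw /= /lt_r0[_ w2 _].
  by have := Vw (subset_closure (h2 w w2)); lra.
- move=> phi G H y Cphi /lt_r0[y1 _ y3] near_y eq_y.
  have := subU (C2_with_shift xh (U xh) Cphi) (OU1 y y1) (h3 y y3).
  rewrite addrK; apply; last by lra.
  have N : \forall z \near (y + xh) + - xh, U (z + xh) - U xh <= phi z by rewrite addrK.
  apply: filterS (near_translate N) => z; rewrite subrK; lra.
- move=> phi G H y Cphi /lt_r0[_ y2 _] VyM near_y eq_y.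
  have VyM' : V (y + yh) < M by lra.
  have := supV (C2_with_shift yh (V yh) Cphi) (h2 y y2) VyM'.
  rewrite addrK; apply; last by lra.
  have N : \forall z \near (y + yh) + - yh, phi z <= V (z + yh) - V yh by rewrite addrK.
  apply: filterS (near_translate N) => z; rewrite subrK; lra.
- by apply: continuous_translate; rewrite add0r; exact: cf.
- move=> s fs; have N : \forall z \near yh, f z < s.
    exact: (@cvgr_lt _ _ _ _ _ _ (cf Oyh) _ fs).
  exact: near_translate0 N.
- exact: hg0.
- move=> s gs; have cgP : {for (P : subspace D), continuous (g : subspace D -> R)}.
    exact: hg.
  have : \forall p \near (P : subspace D), g p < s.
    exact: (@cvgr_lt _ _ _ _ _ _ cgP _ gs).
  rewrite /prop_near1 /nbhs /= -nbhs_subspace_in// => /near_translate0[r r_0 h].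
  by exists r => // p Dp pr; rewrite -(subrK P p); apply: h => //; rewrite subrK.
- exists (eta * dl / 4); first by rewrite divr_gt0// mulr_gt0.
  move=> p pr; set w := p - (P + e) in pr.
  (* [p = (P + (eta / 2) *: qbar) + (eta / 2) *: q1]: one half of the gradient of the
     perturbation pays for [omega], the other absorbs the errors *)
  pose q1 := qbar + (2 * ka) *: xh + (2 / eta) *: w.
  have Dq1 : D q1.
    rewrite /q1 -addrA addrC; apply: hdl.
    have ka20 : 0 < 2 * ka by exact: mulr_gt0.
    have eta2' : 0 < 2 / eta by exact: divr_gt0.
    apply: le_lt_trans (ler_normD _ _) _.
    have -> : `|(2 * ka) *: xh| = 2 * (ka * `|xh|).
      by rewrite normrZ gtr0_norm// mulrA.
    have -> : `|(2 / eta) *: w| = 2 / eta * `|w| by rewrite normrZ gtr0_norm.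
    have le1 : ka * `|xh| <= dl / 4 by rewrite -kaB ler_pM2l// KB.
    have le2 : 2 / eta * `|w| < dl / 2.
      have -> : dl / 2 = 2 / eta * (eta * dl / 4) by field; rewrite gt_eqF.
      by rewrite ltr_pM2l// divr_gt0.
    by move: le1 le2; set t1 := ka * _; set t2 := 2 / eta * _; lra.
  have [_ _ sD _] := hD.
  have eta20 : 0 < eta / 2 by rewrite divr_gt0.
  have Dq2 : D (P + (eta / 2) *: qbar).
    apply: directional_coneD => //; apply: sD; first exact: ltW.
    exact: interior_subset.
  have Dq3 : D ((eta / 2) *: q1) by apply: sD => //; exact: ltW.
  have -> : p = P + (eta / 2) *: qbar + (eta / 2) *: q1.
    apply/rowP => i; rewrite /q1 /w /e !mxE; field; rewrite gt_eqF//.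
  split; first exact: directional_coneD.
  by apply: le_trans (hgs DP eta20) _; exact: hgmono.
Qed.

End RealComparison.

(** * Truncation of extended real valued functions *)

Section Clip.
Context {R : realType}.
Implicit Types (M r : R) (e : \bar R).

Definition clip M e : R :=
  match e with
  | r%:E => Num.max (- M) (Num.min r M)
  | +oo%E => M
  | -oo%E => - M
  end.

Lemma clip_itv M e : 0 < M -> - M <= clip M e <= M.
Proof.
move=> M0; case: e => [r| |] /=; [|lra..].
by rewrite le_max lexx/= ge_max ge_min lexx orbT andbT; lra.
Qed.

Lemma clip_le M e e' : 0 < M -> (e <= e')%E -> clip M e <= clip M e'.
Proof.
move=> M0 ee'; have /andP[le1 le2] := clip_itv e M0.
have /andP[le3 le4] := clip_itv e' M0.
case: e e' ee' le1 le2 le3 le4 => [r| |] [r'| |] //=; rewrite lee_fin => rr' _ _ _ _.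
rewrite ge_max le_max lexx/= le_max; apply/orP; right.
by rewrite le_min !ge_min rr' lexx orbT.
Qed.

Lemma clipN M e : 0 < M -> clip M (- e)%E = - clip M e.
Proof.
move=> M0; case: e => [r| |] //=; last by rewrite opprK.
have [a1|a1] := leP r M; have [a2|a2] := leP (- r) M.
- by rewrite !(max_idPr _) ?opprK//; lra.
- by rewrite (max_idPr _) ?(max_idPl _) ?opprK//; lra.
- by rewrite (max_idPl _) ?(max_idPr _)//; lra.
- by exfalso; lra.
Qed.

Lemma le_clip M e : (e < M%:E)%E -> (e <= (clip M e)%:E)%E.
Proof.
case: e => [r| |] //=; last by rewrite leNye.
by rewrite lte_fin lee_fin => rM; rewrite le_max le_min lexx (ltW rM) orbT.
Qed.

Lemma clip_id M e : (e < M%:E)%E -> - M < clip M e -> e = (clip M e)%:E.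
Proof.
case: e => [r| |] //=; last by rewrite ltxx.
rewrite lte_fin => rM; rewrite (min_idPl (ltW rM)) lt_max ltxx /= => /ltW rM'.
by rewrite (max_idPr rM').
Qed.

Lemma clip_lt M e r : 0 < M -> clip M e < r -> M < r \/ (e < r%:E)%E.
Proof.
move=> M0; case: e => [s| |] /=; [|by left|by right; rewrite ltNyr].
by rewrite gt_max gt_min lte_fin => /andP[_ /orP[]]; [right|left].
Qed.

Lemma lt_clip M e r : 0 < M -> - M < r -> (e < r%:E)%E -> clip M e < r.
Proof.
move=> M0 Mr; case: e => [s| |] //=.
by rewrite lte_fin gt_max gt_min Mr => ->.
Qed.

End Clip.

Section Truncation.
Context {R : realType} {n : nat}.
Implicit Types (K : set 'rV[R]_n) (u v : 'rV[R]_n -> \bar R).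

Lemma USC_near K u x (a : R) : USC K u -> K x -> (u x < a%:E)%E ->
  \forall y \near x, K y -> (u y < a%:E)%E.
Proof.
move=> [_ uu] Kx ua; have [V + Vu] := uu x a ua.
rewrite /nbhs /= -nbhs_subspace_in// => VK.
have {}VK : \forall y \near x, K y -> V y by exact: VK.
by apply: filterS VK => y VKy Ky; apply/Vu/VKy.
Qed.

Lemma LSC_opp K v : LSC K v -> USC K (fun x => - v x)%E.
Proof.
move=> [v1 v2]; split=> [x Kx|x a]; first by rewrite eqe_oppLR; exact: v1.
rewrite lteNl -EFinN => /v2[V Vx hV]; exists V => // y /hV.
by rewrite EFinN lteNl.
Qed.

Lemma USC_bounded K u : compact K -> USC K u ->
  exists M0 : R, forall M : R, M0 < M -> forall x, K x -> (u x < M%:E)%E.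
Proof.
move=> /compact_near_coveringP cK uu; have [uy _] := uu.
suff [M0 [_ h]] : \forall M \near +oo%R, K `<=` [set x | K x -> (u x < M%:E)%E].
  by exists M0 => M M0M x Kx; exact: h.
apply: cK => x Kx.
have [a ua] : exists a : R, (u x < a%:E)%E.
  case: (u x) (uy x Kx) => [r _| //|_]; last by exists 0; rewrite ltNyr.
  by exists (r + 1); rewrite lte_fin ltrDl.
have al_big : \forall al \near +oo, a < al by apply: nbhs_pinfty_gt; exact: num_real.
exists ([set y | K y -> (u y < a%:E)%E], [set al | a < al]).
  by split; [exact: USC_near|exact: al_big].
by move=> [y al] [/= y1 al1] Ky; apply: lt_trans (y1 Ky) _; rewrite lte_fin.
Qed.

Lemma usc_clip K u (M : R) : 0 < M -> USC K u -> usc_on K (fun x => clip M (u x)).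
Proof.
move=> M0 uu x Kx c uc; have /andP[le1 _] := clip_itv (u x) M0.
have [Mc|/(USC_near uu Kx)] := clip_lt M0 uc.
  apply: filterS filterT => y _ _; have /andP[_ le2] := clip_itv (u y) M0.
  exact: le_lt_trans le2 Mc.
apply: filterS => y uy Ky; apply: lt_clip => //; last exact: uy.
exact: le_lt_trans le1 uc.
Qed.

End Truncation.

Theorem proposition8p3 (R : realType) (n : nat)
    (Omega D : set 'rV[R]_n) (f g : 'rV[R]_n -> R) (u v : 'rV[R]_n -> \bar R)
    (hOmega : bounded_domain Omega)
    (hD : directional_cone D)
    (hf : {within closure Omega, continuous f})
    (hf0 : forall x, closure Omega x -> 0 <= f x)
    (hg : {within D, continuous g})
    (hg0 : forall p, D p -> 0 <= g p)
    (hgmono : forall p q, D p -> D q -> g p <= g (p + q))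
    (hgstrict : exists (qbar : 'rV[R]_n) (omega : R -> R),
      [/\ D° qbar,
          forall eta, 0 < eta -> 0 < omega eta,
          omega eta @[eta --> 0^'+] --> 0
        & forall p eta, D p -> 0 < eta ->
            g p + omega eta <= g (p + eta *: qbar)])
    (hu : USC (closure Omega) u)
    (hv : LSC (closure Omega) v)
    (hsub : admissible_subsolution (monotonicity_cone D psd)
              (gdet_operator f g) Omega u)
    (hsup : admissible_supersolution (monotonicity_cone D psd)
              (gdet_operator f g) Omega v) :
  (forall x, boundary Omega x -> (u x <= v x)%E) ->
  forall x, Omega x -> (u x <= v x)%E.
Proof.
move=> uv x Ox.
have [oOm _ _ bOm] := hOmega.
have [qbar [omega [qD omega0 _ hgs]]] := hgstrict.
have n0 : (0 < n)%N.
  rewrite lt0n; apply/eqP => n0; subst n.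
  have := hgs qbar 1 (interior_subset qD) ltr01.
  have -> : qbar + 1 *: qbar = qbar by apply/rowP => -[].
  by have := omega0 1 ltr01; lra.
have cK : compact (closure Omega).
  apply: bounded_closed_compact; last exact: closed_closure.
  have [B [_ hB]] := bOm.
  exists (B + 1); split; first exact: num_real.
  move=> M BM y Ky; have /hB Om_le : B < M by lra.
  have cB : closed [set z : 'rV[R]_n | `|z| <= M].
    have := compact_closed (@norm_hausdorff _ _) (@compact_ball R n 0 M).
    by congr closed; apply/seteqP; split => z /=; rewrite subr0.
  by have := closure_subset Om_le Ky; rewrite -(closure_id _).1.
have cf y : Omega y -> {for y, continuous f}.
  move=> Oy; have : {within Omega, continuous f}.
    exact: continuous_subspaceW (@subset_closure _ Omega) hf.
  by rewrite continuous_open_subspace// => /(_ y); apply; rewrite inE.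
have [M1 uM] := USC_bounded cK hu.
have hv' := LSC_opp hv; have [M2 vM] := USC_bounded cK hv'.
pose M := Num.max 0 (Num.max M1 M2) + 1.
have [M0 M1M M2M] : [/\ 0 < M, M1 < M & M2 < M].
  rewrite /M; have : Num.max 0 (Num.max M1 M2) <= Num.max 0 (Num.max M1 M2) by [].
  by rewrite {1}ge_max ge_max => /and3P[? ? ?]; split; lra.
have {}uM := uM M M1M; have {}vM := vM M M2M.
pose U y := clip M (u y); pose V y := clip M (v y).
have VE y : - V y = clip M (- v y)%E by rewrite clipN//.
have vV y : closure Omega y -> ((V y)%:E <= v y)%E.
  by move=> Ky; rewrite -leeN2 -EFinN VE; exact/le_clip/vM.
suff UV : U x <= V x.
  have Kx := subset_closure Ox.
  apply: le_trans (le_clip (uM _ Kx)) _; apply: le_trans (vV _ Kx).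
  by rewrite lee_fin.
apply: (@comparison_real R n Omega D f g U V M qbar omega) => //.
- exact: usc_clip.
- have -> : (fun y => - V y) = (fun y => clip M (- v y)%E) by apply/funext.
  exact: usc_clip.
- move=> y Ky nOy; apply: clip_le => //; apply: uv; split=> //.
  by move=> /interior_subset.
- by move=> y _; exact: clip_itv.
- by move=> y _; exact: clip_itv.
- move=> phi G H y Cphi Oy Uy Uphi Ey; have Ky := subset_closure Oy.
  have [] := hsub y Oy (phi y, G y, H y).
    exists phi; split; first exact: C2_with_near Cphi y.
    + have Oz : \forall z \near y, Omega z by exact: open_nbhs_nbhs.
      apply: filterS2 Uphi Oz => z Uz Oz; have Kz := subset_closure Oz.
      by apply: le_trans (le_clip (uM _ Kz)) _; rewrite lee_fin.
    + by rewrite (clip_id (uM _ Ky) Uy) -/(U y) Ey.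
    + by rewrite (C2_with_grad Cphi) (C2_with_hess Cphi).
  by move=> [/= DG pH]; rewrite /gdet_operator /= subr_ge0.
- move=> phi G H y Cphi Oy Vy Vphi Ey pH DG; have Ky := subset_closure Oy.
  have [] := hsup y Oy (phi y, G y, H y); last by case; split.
    exists phi; split; first exact: C2_with_near Cphi y.
    + have Oz : \forall z \near y, Omega z by exact: open_nbhs_nbhs.
      apply: filterS2 Vphi Oz => z Vz Oz.
      by apply: le_trans (vV _ (subset_closure Oz)); rewrite lee_fin.
    + apply/eqP; rewrite -eqe_opp; apply/eqP.
      rewrite (clip_id (vM _ Ky)) -VE; last by rewrite ltrN2.
      by rewrite Ey EFinN.
    + by rewrite (C2_with_grad Cphi) (C2_with_hess Cphi).
  by move=> [_]; rewrite /gdet_operator /= subr_le0.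
Qed.
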